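(* (1) The formal power series $P^{\mathbb L}_\lambda(\mathbf x)$ $(\lambda\in\mathcal{SP})$ form a formal $\mathbb L$-basis of $\Gamma^{\mathbb L}(\mathbf x)$. (2) The formal power series $Q^{\mathbb L}_\lambda(\mathbf x)$ $(\lambda\in\mathcal{SP})$ form a formal $\mathbb L$-basis of $\Gamma^{\mathbb L}_+(\mathbf x)$.
   Context: $\mathbb L$ is the Lazard ring with universal formal group law $F_{\mathbb L}(u,v)=u+v+\sum_{i,j\ge1}a_{i,j}u^iv^j$; $a+_Fb=F_{\mathbb L}(a,b)$ and $\overline a\in\mathbb L[[a]]$ is the formal inverse ($a+_F\overline a=0$). $\mathcal{SP}$ is the set of all strict partitions. For a strict partition $\lambda=(\lambda_1>\cdots>\lambda_r>0)$ and $n\ge r$, $$P^{\mathbb L}_\lambda(x_1,\ldots,x_n)=\frac1{(n-r)!}\sum_{w\in S_n}w\Big[\prod_{i=1}^rx_i^{\lambda_i}\prod_{i=1}^r\prod_{j=i+1}^n\frac{x_i+_Fx_j}{x_i+_F\overline x_j}\Big],$$ $$Q^{\mathbb L}_\lambda(x_1,\ldots,x_n)=\frac1{(n-r)!}\sum_{w\in S_n}w\Big[\prod_{i=1}^r(x_i+_Fx_i)x_i^{\lambda_i-1}\prod_{i=1}^r\prod_{j=i+1}^n\frac{x_i+_Fx_j}{x_i+_F\overline x_j}\Big],$$ where $S_n$ permutes $x_1,\ldots,x_n$; both are $0$ for $n<r$. They satisfy the stability $P^{\mathbb L}_\lambda(x_1,\ldots,x_{n-1},0)=P^{\mathbb L}_\lambda(x_1,\ldots,x_{n-1})$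 and likewise for $Q^{\mathbb L}_\lambda$. A formal power series $f(x_1,\ldots,x_n)$ over $\mathbb L$ is $\mathbb L$-supersymmetric if it is symmetric and $f(t,\overline t,x_3,\ldots,x_n)=f(0,0,x_3,\ldots,x_n)$. $\Gamma^{\mathbb L}(\mathbf x_n)$ is the ring of all such series, and $\Gamma^{\mathbb L}_+(\mathbf x_n)$ the subring of those $f$ for which $f(t,x_2,\ldots,x_n)-f(0,x_2,\ldots,x_n)$ is divisible by $t+_Ft$. Define $\Gamma^{\mathbb L}(\mathbf x)=\varprojlim_n\Gamma^{\mathbb L}(\mathbf x_n)$ and $\Gamma^{\mathbb L}_+(\mathbf x)=\varprojlim_n\Gamma^{\mathbb L}_+(\mathbf x_n)$ along the maps $x_{n+1}=0$, and $P^{\mathbb L}_\lambda(\mathbf x)=\varprojlim_nP^{\mathbb L}_\lambda(x_1,\ldots,x_n)\in\Gamma^{\mathbb L}(\mathbf x)$, $Q^{\mathbb L}_\lambda(\mathbf x)=\varprojlim_nQ^{\mathbb L}_\lambda(x_1,\ldots,x_n)\in\Gamma^{\mathbb L}_+(\mathbf x)$. ''Formal $\mathbb L$-basis'' means that every element can be written uniquely as a possibly infinite formal linear combination of the given elements with coefficients in $\mathbb L$ (such sums converge as formal power series, since only terms of degree at least $|\lambda|$ in the $x_i$ occur in the element indexed by $\lambda$). *)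

(* Defs.v *)
From HB Require Import structures.
From mathcomp Require Import all_boot all_order all_algebra all_fingroup.
From mathcomp Require Import mpoly.
From mathcomp Require Import boolp classical_sets cardinality fsbigop.

Set Implicit Arguments.
Unset Strict Implicit.
Unset Printing Implicit Defensive.

Import GRing.Theory.

Local Open Scope ring_scope.
Local Open Scope classical_set_scope.

(* [mps n R] is R[[x_1,...,x_n]]; the variable x_(i+1) is [psX R i], i : 'I_n. *)

Record mps (n : nat) (R : Type) := Mps { mps_coef :> 'X_{1..n} -> R }.

HB.instance Definition _ (n : nat) (R : Type) := gen_eqMixin (mps n R).
HB.instance Definition _ (n : nat) (R : Type) := gen_choiceMixin (mps n R).

Lemma mpsP (n : nat) (R : Type) (f g : mps n R) : (forall m, f m = g m) -> f = g.
Proof. by case: f g => [f] [g] /= e; congr Mps; apply/funext. Qed.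

Definition mps_const (n : nat) (R : nzRingType) (c : R) : mps n R :=
  Mps (fun m => if m == 0%MM then c else 0).
Definition mps_add (n : nat) (R : nzRingType) (f g : mps n R) : mps n R :=
  Mps (fun m => f m + g m).
Definition mps_opp (n : nat) (R : nzRingType) (f : mps n R) : mps n R :=
  Mps (fun m => - f m).
Definition mps_mul (n : nat) (R : nzRingType) (f g : mps n R) : mps n R :=
  Mps (fun m => \sum_(k : 'X_{1..n < (mdeg m).+1, (mdeg m).+1}
                      | m == (k.1 + k.2)%MM) f k.1 * g k.2).

Lemma mps_addA (n : nat) (R : nzRingType) : associative (@mps_add n R).
Proof. by move=> f g h; apply: mpsP => m /=; rewrite addrA. Qed.
Lemma mps_addC (n : nat) (R : nzRingType) : commutative (@mps_add n R).
Proof. by move=> f g; apply: mpsP => m /=; rewrite addrC. Qed.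
Lemma mps_add0 (n : nat) (R : nzRingType) :
  left_id (mps_const n (0 : R)) (@mps_add n R).
Proof. by move=> f; apply: mpsP => m /=; rewrite if_same add0r. Qed.
Lemma mps_addN (n : nat) (R : nzRingType) :
  left_inverse (mps_const n (0 : R)) (@mps_opp n R) (@mps_add n R).
Proof. by move=> f; apply: mpsP => m /=; rewrite if_same addNr. Qed.

HB.instance Definition _ (n : nat) (R : nzRingType) :=
  GRing.isZmodule.Build (mps n R)
    (@mps_addA n R) (@mps_addC n R) (@mps_add0 n R) (@mps_addN n R).

(* The ring axioms are inherited from {mpoly R[n]} by truncation. *)
Definition mps_trunc (n : nat) (R : nzRingType) (d : nat) (f : mps n R) :
    {mpoly R[n]} := \sum_(k : 'X_{1..n < d}) f k *: 'X_[k].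

Lemma mps_truncE (n : nat) (R : nzRingType) (d : nat) (f : mps n R) m :
  (mdeg m < d)%N -> (mps_trunc d f)@_m = f m.
Proof. exact: mcoeff_mpoly. Qed.

Lemma mdeg_addP (n : nat) (m k l : 'X_{1..n}) : m = (k + l)%MM ->
  (mdeg k <= mdeg m)%N /\ (mdeg l <= mdeg m)%N.
Proof. by move=> ->; rewrite mdegD leq_addr leq_addl. Qed.

Lemma mps_mulE (n : nat) (R : nzRingType) (d : nat) (f g : mps n R) m :
  (mdeg m < d)%N -> mps_mul f g m = (mps_trunc d f * mps_trunc d g)@_m.
Proof.
move=> md; rewrite mcoeffM /=; apply: eq_bigr => k /eqP mk.
have [le1 le2] := mdeg_addP mk.
by rewrite !mps_truncE // (leq_ltn_trans _ md).
Qed.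

Lemma mcoeffM_eq (n : nat) (R : nzRingType) (p p' q q' : {mpoly R[n]}) m :
    (forall k, (mdeg k <= mdeg m)%N -> p@_k = p'@_k) ->
    (forall k, (mdeg k <= mdeg m)%N -> q@_k = q'@_k) ->
  (p * q)@_m = (p' * q')@_m.
Proof.
move=> hp hq; rewrite !mcoeffM; apply: eq_bigr => k /eqP mk.
have [le1 le2] := mdeg_addP mk.
by rewrite hp ?hq.
Qed.

Lemma mps_mulA (n : nat) (R : nzRingType) : associative (@mps_mul n R).
Proof.
move=> f g h; apply: mpsP => m.
rewrite !(@mps_mulE n R (mdeg m).+1) //.
transitivity ((mps_trunc (mdeg m).+1 f *
  (mps_trunc (mdeg m).+1 g * mps_trunc (mdeg m).+1 h))@_m).
  by apply: mcoeffM_eq => // k km; rewrite mps_truncE // (@mps_mulE _ _ (mdeg m).+1).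
rewrite mulrA; apply: mcoeffM_eq => // k km.
by rewrite mps_truncE // (@mps_mulE _ _ (mdeg m).+1).
Qed.

Lemma mps_trunc1 (n : nat) (R : nzRingType) d :
  mps_trunc d.+1 (mps_const n (1 : R)) = 1.
Proof.
apply/mpolyP => m; rewrite mcoeff1.
have [md|md] := ltnP (mdeg m) d.+1.
  by rewrite mps_truncE //=; case: eqP.
rewrite /mps_trunc raddf_sum /= big1 => [|k _].
  by case: eqP md => // ->; rewrite mdeg0.
rewrite mcoeffZ mcoeffX; case: (bmnm k =P m); rewrite ?mulr0 // => e.
by have := leq_trans (bmdeg k) md; rewrite e ltnn.
Qed.

Lemma mps_mul1f (n : nat) (R : nzRingType) :
  left_id (mps_const n (1 : R)) (@mps_mul n R).
Proof.
move=> f; apply: mpsP => m.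
by rewrite (@mps_mulE _ _ (mdeg m).+1) // mps_trunc1 mul1r mps_truncE.
Qed.
Lemma mps_mulf1 (n : nat) (R : nzRingType) :
  right_id (mps_const n (1 : R)) (@mps_mul n R).
Proof.
move=> f; apply: mpsP => m.
by rewrite (@mps_mulE _ _ (mdeg m).+1) // mps_trunc1 mulr1 mps_truncE.
Qed.
Lemma mps_mulDl (n : nat) (R : nzRingType) :
  left_distributive (@mps_mul n R) +%R.
Proof.
move=> f g h; apply: mpsP => m /=; rewrite -big_split /=.
by apply: eq_bigr => k _; rewrite mulrDl.
Qed.
Lemma mps_mulDr (n : nat) (R : nzRingType) :
  right_distributive (@mps_mul n R) +%R.
Proof.
move=> f g h; apply: mpsP => m /=; rewrite -big_split /=.
by apply: eq_bigr => k _; rewrite mulrDr.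
Qed.
Lemma mps_1neq0 (n : nat) (R : nzRingType) : mps_const n (1 : R) != 0.
Proof.
apply/eqP => /(congr1 (fun f : mps n R => f 0%MM)) /= /eqP.
by rewrite eqxx oner_eq0.
Qed.

HB.instance Definition _ (n : nat) (R : nzRingType) :=
  GRing.Zmodule_isNzRing.Build (mps n R) (@mps_mulA n R) (@mps_mul1f n R)
    (@mps_mulf1 n R) (@mps_mulDl n R) (@mps_mulDr n R) (@mps_1neq0 n R).

Lemma mps_mulC (n : nat) (R : comNzRingType) (f g : mps n R) : f * g = g * f.
Proof.
apply: mpsP => m; rewrite [LHS](@mps_mulE _ _ (mdeg m).+1) //.
by rewrite mulrC -mps_mulE.
Qed.

HB.instance Definition _ (n : nat) (R : comNzRingType) :=
  GRing.PzRing_hasCommutativeMul.Build (mps n R) (@mps_mulC n R).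

Definition psX (n : nat) (R : nzRingType) (i : 'I_n) : mps n R :=
  Mps (fun m => if m == U_(i)%MM then 1 else 0).

Definition map_mps (n : nat) (R S : Type) (phi : R -> S) (f : mps n R) :
  mps n S := Mps (phi \o f).

(* Substitution f(g_1,...,g_n).  It is meaningful when all the g_i have zero
   constant coefficient: the monomials of f of degree > |m| then contribute
   nothing to the coefficient of x^m. *)
Definition psubst (n p : nat) (R : comNzRingType)
    (f : mps n R) (g : 'I_n -> mps p R) : mps p R :=
  Mps (fun m => \sum_(a : 'X_{1..n < (mdeg m).+1})
                  f a * (\prod_(i < n) g i ^+ (bmnm a i)) m).

Definition fgl_add (n : nat) (R : comNzRingType) (F : mps 2 R)
    (a b : mps n R) : mps n R :=
  psubst F (fun k : 'I_2 => if k == ord0 then a else b).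

Definition is_fgl (R : comNzRingType) (F : mps 2 R) : Prop :=
  [/\ let u : mps 1 R := psX R ord0 in fgl_add F u 0 = u /\ fgl_add F 0 u = u,
      let u : mps 2 R := psX R (inord 0) in
      let v : mps 2 R := psX R (inord 1) in
        fgl_add F u v = fgl_add F v u
    & let u : mps 3 R := psX R (inord 0) in
      let v : mps 3 R := psX R (inord 1) in
      let w : mps 3 R := psX R (inord 2) in
        fgl_add F (fgl_add F u v) w = fgl_add F u (fgl_add F v w)].

Definition is_lazard (L : comNzRingType) (F : mps 2 L) : Prop :=
  is_fgl F /\
  forall (R : comNzRingType) (G : mps 2 R), is_fgl G ->
    exists2 phi : {rmorphism L -> R}, map_mps phi F = G &
      forall psi : {rmorphism L -> R}, map_mps psi F = G -> psi =1 phi.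

(* The series i(a) with zero constant coefficient such that a +_F i(a) = 0;
   it exists and is unique when F is a formal group law. *)
Definition fgl_inv (R : comNzRingType) (F : mps 2 R) : mps 1 R :=
  xget 0 [set i : mps 1 R | i 0%MM = 0 /\ fgl_add F (psX R ord0) i = 0].

Definition fgl_opp (n : nat) (R : comNzRingType) (F : mps 2 R) (a : mps n R) :
  mps n R := psubst (fgl_inv F) (fun=> a).

Definition strict_part := {la : seq nat | sorted gtn la && (0%N \notin la)}.

(* (1/k) * \sum_(w in I) num w / den w, computed in the total ring of
   fractions: for k and all the [den w] regular, it is the unique f in A (if
   there is one) satisfying the equation obtained by clearing denominators. *)
Definition frac_sum (A : comNzRingType) (I : finType) (k : nat)
    (num den : I -> A) : A :=
  xget 0 [set f | (f * \prod_w den w) *+ k =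
                  \sum_w num w * \prod_(w' | w' != w) den w'].

Definition psperm (n : nat) (R : comNzRingType) (w : 'S_n) (f : mps n R) :
  mps n R := psubst f (fun i => psX R (w i)).

(* (1/(n-r)!) \sum_(w in S_n)
     w [mono * \prod_(i<r) \prod_(i<j<n) (x_i +_F x_j) / (x_i +_F \bar x_j)] *)
Definition HL_sym (n : nat) (R : comNzRingType) (F : mps 2 R) (r : nat)
    (mono : mps n R) : mps n R :=
  frac_sum (n - r)`!
    (fun w : 'S_n => psperm w (mono *
       \prod_(i < n | (i < r)%N) \prod_(j < n | (i < j)%N)
         fgl_add F (psX R i) (psX R j)))
    (fun w : 'S_n => psperm w
      (\prod_(i < n | (i < r)%N) \prod_(j < n | (i < j)%N)
         fgl_add F (psX R i) (fgl_opp F (psX R j)))).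

Definition PL (R : comNzRingType) (F : mps 2 R) (la : strict_part) (n : nat) :
    mps n R :=
  let r := size (val la) in
  if (r <= n)%N then
    HL_sym F r (\prod_(i < n | (i < r)%N) psX R i ^+ nth 0%N (val la) i)
  else 0.

Definition QL (R : comNzRingType) (F : mps 2 R) (la : strict_part) (n : nat) :
    mps n R :=
  let r := size (val la) in
  if (r <= n)%N then
    HL_sym F r (\prod_(i < n | (i < r)%N)
      (fgl_add F (psX R i) (psX R i) * psX R i ^+ (nth 0%N (val la) i).-1))
  else 0.

Definition ps_symmetric (n : nat) (R : comNzRingType) (f : mps n R) : Prop :=
  forall w : 'S_n, psperm w f = f.

(* The first two variables are [i] and [j]; the variable t is identified with
   x_i, and the condition is empty for n < 2. *)
Definition cancellation (n : nat) (R : comNzRingType) (F : mps 2 R)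
    (f : mps n R) : Prop :=
  forall i j : 'I_n, i = 0%N :> nat -> j = 1%N :> nat ->
    psubst f (fun k => if k == i then psX R i
                       else if k == j then fgl_opp F (psX R i) else psX R k)
    = psubst f (fun k => if (k == i) || (k == j) then 0 else psX R k).

Definition Gamma_n (n : nat) (R : comNzRingType) (F : mps 2 R) :
  set (mps n R) := [set f | ps_symmetric f /\ cancellation F f].

Definition Gamma_plus_n (n : nat) (R : comNzRingType) (F : mps 2 R) :
    set (mps n R) :=
  [set f | Gamma_n F f /\
    forall i : 'I_n, i = 0%N :> nat -> exists g : mps n R,
      f - psubst f (fun k => if k == i then 0 else psX R k)
      = fgl_add F (psX R i) (psX R i) * g].

Definition set_last0 (n : nat) (R : comNzRingType) (f : mps n.+1 R) : mps n R :=
  psubst f (fun i => if unlift ord_max i is Some k then psX R k else 0).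

Definition proj_lim (R : comNzRingType) (G : forall n, set (mps n R)) :
    set (forall n, mps n R) :=
  [set f | forall n, G n (f n) /\ set_last0 (f n.+1) = f n].

Definition Gamma (R : comNzRingType) (F : mps 2 R) :=
  proj_lim (fun n => @Gamma_n n R F).
Definition Gamma_plus (R : comNzRingType) (F : mps 2 R) :=
  proj_lim (fun n => @Gamma_plus_n n R F).

(* Each coefficient involves only finitely many members of the family, so that
   every formal linear combination of the family converges coefficientwise. *)
Definition formally_summable (R : comNzRingType) (I : choiceType)
    (b : I -> forall n, mps n R) : Prop :=
  forall n (m : 'X_{1..n}), finite_set [set l | b l n m != 0].

Definition formal_sum (R : comNzRingType) (I : choiceType)
    (c : I -> R) (b : I -> forall n, mps n R) : forall n, mps n R :=
  fun n => Mps (fun m => \sum_(l \in [set: I]) c l * b l n m).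

Definition formal_basis (R : comNzRingType) (I : choiceType)
    (b : I -> forall n, mps n R) (M : set (forall n, mps n R)) : Prop :=
  [/\ forall l, M (b l),
      formally_summable b
    & forall f, M f -> exists! c : I -> R, f = formal_sum c b].

(* Main.v *)
(* The Lazard ring is a retract of a polynomial ring over Z: the universal formal
   group law lifts, degree by degree, to the polynomial ring with one variable for
   each element of L, because the obstruction in degree N is a symmetric 2-cocycle,
   hence a multiple of (x+y)^N - x^N - y^N, which a change of the coordinate
   x + b x^N removes; universality then gives the section. Hence L is torsion free
   and multiplication by a_{1,1} is injective modulo 2.

   P_la and Q_la are sums, over the injections of {1..r} into {1..n}, of fractions
   whose denominators divide the Vandermonde determinant D up to units, and D times
   such a sum is antisymmetric, hence divisible by D. Comparing lowest parts, for
   n = r the coefficient of x^la is 1 for P_la and 2^r for Q_la, and x^la is the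
   leading monomial in degree |la|.

   Conversely let f be supersymmetric of order >= d, and suppose that no x^la with
   la strict of size d occurs in f. If f had order d, take a monomial x^m of degree d
   in f with maximal sum of the m_i^2. As f is symmetric, two positive exponents agree
   (otherwise m is a rearrangement of a strict partition), and the cancellation property
   in these two variables forces the coefficient to vanish, a contradiction. So the P_la
   span degree by degree. For Gamma_+ one needs in addition that the
   coefficient of x^la is divisible by 2^r; this holds because applying all the
   operators f |-> f - f|_{x_i=0} to f gives a multiple of the product of the
   [2](x_i), which are regular modulo each other. *)

(* Regularity is read off from lowest homogeneous forms: a series whose lowest form is regular can
   be cancelled. In the denominators these forms have coefficients 1, -1, 2 or -2. Hence torsion
   freeness of L: the substitution x_i = t, x_j = inverse of t turns a denominator into a series
   with lowest form 2t or -2t. It also lets the equation with the factor (n-r)! determine [HL_sym],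
   and turns S = -S into S = 0 on x_a = x_b. The obstacle in lifting the universal law is that
   associativity must hold exactly while integrality is reached only degree by degree. So every
   stage is an exact formal group law over the rational polynomial ring, a conjugate of the previous
   one, and only its low coefficients have to be integral. The cocycle relations are then known only
   modulo the subgroup of integral polynomials that vanish in L; this is why the cocycle lemma works
   modulo a subgroup and argues prime by prime. The coefficient a_{1,1} enters through [2](x) = x(2
   + a_{1,1} x + ...): setting variables to 0 reduces the regularity of [2](x_i) modulo [2](x_k) to
   that of a_{1,1} modulo 2. *)
Require Import Defs.
From HB Require Import structures.
From mathcomp Require Import all_boot all_order all_algebra all_fingroup.
From mathcomp Require Import mpoly ring zify.
From mathcomp Require Import boolp classical_sets cardinality fsbigop.
From mathcomp Require monalg finmap.

Set Implicit Arguments.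
Unset Strict Implicit.
Unset Printing Implicit Defensive.

Import GRing.Theory.
Local Open Scope ring_scope.

Arguments mps_mul : simpl never.
Arguments psubst : simpl never.
Arguments mps_trunc : simpl never.

(** * Order and homogeneous parts of power series *)

Definition ord_ge (n : nat) (R : comNzRingType) (d : nat) (f : mps n R) : Prop :=
  forall m, (mdeg m < d)%N -> f m = 0.

Section Basics.
Variables (n : nat) (R : comNzRingType).
Implicit Types (f g h : mps n R) (m : 'X_{1..n}) (p q : {mpoly R[n]}).

Lemma mps0E m : (0 : mps n R) m = 0. Proof. by rewrite /= if_same. Qed.
Lemma mpsDE f g m : (f + g) m = f m + g m. Proof. by []. Qed.
Lemma mpsNE f m : (- f) m = - f m. Proof. by []. Qed.
Lemma mpsBE f g m : (f - g) m = f m - g m. Proof. by []. Qed.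
Lemma mps1E m : (1 : mps n R) m = (m == 0%MM)%:R.
Proof. by rewrite /=; case: eqP. Qed.
Lemma mpsXE i m : psX R i m = (U_(i)%MM == m)%:R.
Proof. by rewrite /= eq_sym; case: eqP. Qed.

Definition mps_coefm m f := f m.
Lemma mps_coefm_additive m : additive (mps_coefm m).
Proof. by []. Qed.
HB.instance Definition _ m :=
  GRing.isAdditive.Build (mps n R) R (mps_coefm m) (mps_coefm_additive m).

Lemma mps_sumE (I : Type) (r : seq I) (P : pred I) (F : I -> mps n R) m :
  (\sum_(i <- r | P i) F i) m = \sum_(i <- r | P i) F i m.
Proof. exact: (raddf_sum (mps_coefm m)). Qed.
Lemma mpsMnE f k m : (f *+ k) m = f m *+ k.
Proof. exact: (raddfMn (mps_coefm m)). Qed.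

Lemma mpsME d f g m : (mdeg m < d)%N ->
  (f * g) m = (mps_trunc d f * mps_trunc d g)@_m.
Proof. exact: mps_mulE. Qed.

Definition ps_of p : mps n R := Mps (fun m => p@_m).

Lemma ps_of_inj : injective ps_of.
Proof.
by move=> p q e; apply/mpolyP => m; apply: (congr1 (fun f : mps n R => f m) e).
Qed.

Lemma ps_of_additive : additive ps_of.
Proof. by move=> p q; apply: mpsP => m /=; rewrite mcoeffB. Qed.
HB.instance Definition _ :=
  GRing.isAdditive.Build {mpoly R[n]} (mps n R) ps_of ps_of_additive.

Lemma ps_of_multiplicative : multiplicative ps_of.
Proof.
split=> [p q|]; apply: mpsP => m; last by rewrite mps1E /= mcoeff1.
rewrite (@mpsME (mdeg m).+1) //=; apply: mcoeffM_eq => k km;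
  by rewrite mps_truncE.
Qed.
HB.instance Definition _ :=
  GRing.isMultiplicative.Build {mpoly R[n]} (mps n R) ps_of ps_of_multiplicative.

Lemma ps_ofC c : ps_of c%:MP = mps_const n c.
Proof.
by apply: mpsP => m /=; rewrite mcoeffC; case: eqP; rewrite ?mulr1 ?mulr0.
Qed.

Lemma ps_ofX i : ps_of 'X_i = psX R i.
Proof. by apply: mpsP => m; rewrite mpsXE /= mcoeffX. Qed.

Lemma ps_ofZ c p : ps_of (c *: p) = mps_const n c * ps_of p.
Proof. by rewrite -mul_mpolyC [LHS]rmorphM -ps_ofC. Qed.

Lemma mps_const_additive : additive (@mps_const n R).
Proof. by move=> a b; rewrite -!ps_ofC raddfB /= raddfB. Qed.
HB.instance Definition _ :=
  GRing.isAdditive.Build R (mps n R) (@mps_const n R) mps_const_additive.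
Lemma mps_const_multiplicative : multiplicative (@mps_const n R).
Proof. by split=> [a b|//]; rewrite -!ps_ofC rmorphM /= rmorphM. Qed.
HB.instance Definition _ :=
  GRing.isMultiplicative.Build R (mps n R) (@mps_const n R) mps_const_multiplicative.

Lemma mps_constM c f m : (mps_const n c * f) m = c * f m.
Proof.
rewrite (@mpsME (mdeg m).+1) //.
transitivity ((c%:MP * mps_trunc (mdeg m).+1 f)@_m).
  by apply: mcoeffM_eq => // k km; rewrite mps_truncE //= mcoeffC;
    case: eqP; rewrite ?mulr1 ?mulr0.
by rewrite mcoeffCM mps_truncE.
Qed.

Lemma ord_geP f g d :
  ord_ge d (f - g) <-> (forall m, (mdeg m < d)%N -> f m = g m).
Proof.
split=> h m md; last by rewrite mpsBE h ?subrr.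
by have := h m md; rewrite mpsBE => /subr0_eq.
Qed.

Lemma ord_ge0 f : ord_ge 0 f. Proof. by []. Qed.
Lemma ord_geW d d' f : (d' <= d)%N -> ord_ge d f -> ord_ge d' f.
Proof. by move=> le h m md; apply: h; apply: leq_trans le. Qed.
Lemma ord_geN d f : ord_ge d f -> ord_ge d (- f).
Proof. by move=> h m md; rewrite mpsNE h ?oppr0. Qed.
Lemma ord_geD d f g : ord_ge d f -> ord_ge d g -> ord_ge d (f + g).
Proof. by move=> hf hg m md; rewrite mpsDE hf ?hg ?addr0. Qed.
Lemma ord_geB d f g : ord_ge d f -> ord_ge d g -> ord_ge d (f - g).
Proof. by move=> hf hg; apply: ord_geD => //; apply: ord_geN. Qed.
Lemma ord_ge_zero d : ord_ge d (0 : mps n R).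
Proof. by move=> m _; rewrite mps0E. Qed.
Lemma ord_ge_sum d (I : Type) (r : seq I) (P : pred I) (F : I -> mps n R) :
  (forall i, P i -> ord_ge d (F i)) -> ord_ge d (\sum_(i <- r | P i) F i).
Proof.
move=> h; elim/big_rec: _ => [|i f Pi hf]; first exact: ord_ge_zero.
by apply: ord_geD => //; apply: h.
Qed.
Lemma ord_ge_all f : (forall d, ord_ge d f) -> f = 0.
Proof. by move=> h; apply: mpsP => m; rewrite (h (mdeg m).+1) ?mps0E. Qed.
Lemma ord_ge_eq f g : (forall d, ord_ge d (f - g)) -> f = g.
Proof. by move/ord_ge_all/subr0_eq. Qed.
Lemma ord_ge1P f : ord_ge 1 f <-> f 0%MM = 0.
Proof.
split=> [h|h m]; first by apply: h; rewrite mdeg0.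
by rewrite ltnS leqn0 mdeg_eq0 => /eqP ->.
Qed.

(** A polynomial rather than a series, so that regularity and leading monomials in [{mpoly R[n]}]
    are available for lowest forms. *)
Definition low d f : {mpoly R[n]} :=
  \sum_(k : 'X_{1..n < d.+1} | mdeg k == d) f k *: 'X_[k].

Lemma lowE d f m : (low d f)@_m = if mdeg m == d then f m else 0.
Proof.
have -> : low d f = \sum_(k : 'X_{1..n < d.+1})
    (if mdeg k == d then f k else 0) *: 'X_[k].
  rewrite /low big_mkcond; apply: eq_bigr => k _.
  by case: ifP => // _; rewrite scale0r.
case: (ltnP (mdeg m) d.+1) => md; first by rewrite (mcoeff_mpoly
   (fun k : 'X_{1..n} => if mdeg k == d then f k else 0)).
rewrite raddf_sum /= big1 => [|k _]; first by rewrite ifN // gtn_eqF.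
rewrite mcoeffZ mcoeffX; case: (bmnm k =P m) => [e|]; rewrite ?mulr0 //.
by have := leq_trans (bmdeg k) md; rewrite e ltnn.
Qed.

Lemma low_additive d : additive (low d).
Proof.
by move=> f g; apply/mpolyP => m; rewrite mcoeffB !lowE; case: eqP;
  rewrite ?subrr.
Qed.
HB.instance Definition _ d :=
  GRing.isAdditive.Build (mps n R) {mpoly R[n]} (low d) (low_additive d).

Lemma lowD d f g : low d (f + g) = low d f + low d g. Proof. exact: raddfD. Qed.
Lemma lowB d f g : low d (f - g) = low d f - low d g. Proof. exact: raddfB. Qed.
Lemma low0 d : low d (0 : mps n R) = 0. Proof. exact: raddf0. Qed.

Lemma mdeg_low d f m : m \in msupp (low d f) -> mdeg m = d.
Proof. by rewrite mcoeff_msupp lowE; case: (mdeg m =P d); rewrite ?eqxx. Qed.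

(** Both halves follow from one computation: in degree at most a + b only the parts of degree a of f
    and b of g can meet. *)
Lemma ord_ge_mul_lowP a b f g : ord_ge a f -> ord_ge b g ->
  ord_ge (a + b) (f * g) /\ low (a + b) (f * g) = low a f * low b g.
Proof.
move=> hf hg.
have key m : (mdeg m <= a + b)%N -> (f * g) m = (low a f * low b g)@_m.
  move=> md; rewrite (@mpsME (mdeg m).+1) // !mcoeffM; apply: eq_bigr => k /eqP mk.
  have md' : (mdeg (bmnm k.1) + mdeg (bmnm k.2) <= a + b)%N.
    by rewrite -mdegD -mk.
  have [le1 le2] := mdeg_addP mk.
  rewrite !mps_truncE ?ltnS // !lowE.
  have [lt1|] := ltnP (mdeg (bmnm k.1)) a.
    by rewrite hf // if_same !mul0r.
  rewrite leq_eqVlt => /orP[/eqP e1|lt1].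
    rewrite e1 eqxx; have [lt2|] := ltnP (mdeg (bmnm k.2)) b.
      by rewrite hg // if_same !mulr0.
    by move=> le; rewrite ifT // eqn_leq le andbT -(leq_add2l a) {1}e1.
  have lt2 : (mdeg (bmnm k.2) < b)%N.
    rewrite -(ltn_add2l a); apply: leq_trans md'; by rewrite ltn_add2r.
  by rewrite hg // if_same !mulr0.
split=> [m md|].
  rewrite key ?(ltnW md) // mcoeffM big1 // => k /eqP mk.
  rewrite !lowE; case: eqP => e1; rewrite ?mul0r //; case: eqP => e2;
    rewrite ?mulr0 //.
  by have := congr1 (@mdeg n) mk; rewrite mdegD e1 e2 => e; rewrite e ltnn in md.
apply/mpolyP => m; rewrite lowE; case: eqP => [e|ne].
  by rewrite key // e.
rewrite mcoeffM big1 // => k /eqP mk.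
rewrite !lowE; case: eqP => e1; rewrite ?mul0r //; case: eqP => e2;
    rewrite ?mulr0 //.
by case: ne; have := congr1 (@mdeg n) mk; rewrite mdegD e1 e2.
Qed.

Lemma ord_geM a b f g : ord_ge a f -> ord_ge b g -> ord_ge (a + b) (f * g).
Proof. by move=> hf hg; case: (ord_ge_mul_lowP hf hg). Qed.
Lemma lowM a b f g : ord_ge a f -> ord_ge b g ->
  low (a + b) (f * g) = low a f * low b g.
Proof. by move=> hf hg; case: (ord_ge_mul_lowP hf hg). Qed.

Lemma ord_geMl d f g : ord_ge d f -> ord_ge d (g * f).
Proof. by move=> hf; rewrite -[d]add0n; apply: ord_geM. Qed.
Lemma ord_geMr d f g : ord_ge d f -> ord_ge d (f * g).
Proof. by move=> hf; rewrite mulrC; apply: ord_geMl. Qed.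

Lemma ord_ge_prod (I : Type) (r : seq I) (P : pred I) (F : I -> mps n R) (d : I -> nat) :
  (forall i, P i -> ord_ge (d i) (F i)) ->
  ord_ge (\sum_(i <- r | P i) d i) (\prod_(i <- r | P i) F i).
Proof.
move=> h; elim/big_rec2: _ => // i a f Pi hf.
by apply: ord_geM => //; apply: h.
Qed.
Lemma low0_1 : low 0 (1 : mps n R) = 1.
Proof.
apply/mpolyP => m; rewrite lowE mcoeff1 mps1E mdeg_eq0.
by case: eqP.
Qed.
Lemma low0_const f : low 0 f = (f 0%MM)%:MP.
Proof.
apply/mpolyP => m; rewrite lowE mcoeffC mdeg_eq0.
by case: eqP => [->|_]; rewrite ?mulr1 ?mulr0.
Qed.
Lemma low_prod (I : Type) (r : seq I) (P : pred I) (F : I -> mps n R) (d : I -> nat) :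
  (forall i, P i -> ord_ge (d i) (F i)) ->
  low (\sum_(i <- r | P i) d i) (\prod_(i <- r | P i) F i) =
  \prod_(i <- r | P i) low (d i) (F i).
Proof.
move=> h; elim: r => [|i r IH]; first by rewrite !big_nil low0_1.
rewrite !big_cons; case: ifP => // Pi.
by rewrite lowM ?IH; [|apply: h|apply: ord_ge_prod].
Qed.
Lemma ord_geX f k : ord_ge 1 f -> ord_ge k (f ^+ k).
Proof. by move=> h; elim: k => // k IH; rewrite exprS -add1n; apply: ord_geM. Qed.
Lemma lowX f k : ord_ge 1 f -> low k (f ^+ k) = low 1 f ^+ k.
Proof.
move=> h; elim: k => [|k IH]; first exact: low0_1.
by rewrite !exprS -add1n lowM ?IH //; apply: ord_geX.
Qed.

Lemma low_eq0 d f : ord_ge d f -> (low d f = 0 <-> ord_ge d.+1 f).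
Proof.
move=> h; split=> [e m|e].
  rewrite ltnS leq_eqVlt => /orP[/eqP md|]; last exact: h.
  by have := lowE d f m; rewrite e mcoeff0 md eqxx.
by apply/mpolyP => m; rewrite lowE mcoeff0; case: eqP => // md; rewrite e ?md.
Qed.

(** Raise the order of g one degree at a time: the lowest form of f g is the product of the lowest
    forms, and that of f can be cancelled. *)
Lemma ord_ge_cancel a d f g : ord_ge a f -> GRing.lreg (low a f) ->
  ord_ge (a + d) (f * g) -> ord_ge d g.
Proof.
move=> hf reg; elim: d => // d IH h.
have hg : ord_ge d g by apply: IH; apply: ord_geW h; rewrite leq_add2l.
apply/(low_eq0 hg)/reg; rewrite mulr0 -lowM //.
by apply/low_eq0; rewrite -?addnS //; apply: ord_geM.
Qed.

Lemma lreg_low a f : ord_ge a f -> GRing.lreg (low a f) -> GRing.lreg f.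
Proof.
move=> hf reg; apply: mulrI0_lreg => g fg0; apply: ord_ge_all => d.
apply: (ord_ge_cancel hf reg); rewrite fg0; exact: ord_ge_zero.
Qed.

Lemma ps_trunc_ord d f : ord_ge d (f - ps_of (mps_trunc d f)).
Proof. by apply/ord_geP => m md /=; rewrite mps_truncE. Qed.

Lemma low_psX i : low 1 (psX R i) = 'X_i.
Proof.
apply/mpolyP => m; rewrite lowE mpsXE mcoeffX.
case: (U_(i)%MM =P m) => [<-|]; first by rewrite mdeg1.
by rewrite if_same.
Qed.
Lemma ord_psX (i : 'I_n) : ord_ge 1 (psX R i).
Proof. by apply/ord_ge1P; rewrite mpsXE mnm1_eq0. Qed.

(** Principal ideals with regular lowest form are closed. Two approximate quotients valid to order a
    + d agree to order d, so the coefficient of x^m in the quotient can be read off from the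
    approximation of order a + |m| + 1. *)
Lemma ideal_closed f g a : ord_ge a f -> GRing.lreg (low a f) ->
  (forall d, exists h, ord_ge d (g - f * h)) -> exists h, g = f * h.
Proof.
move=> hf reg H; have [F HF] := choice H.
exists (Mps (fun m => F (a + (mdeg m).+1)%N m)).
apply: ord_ge_eq => d.
set h := Mps _.
have hd : ord_ge d (F (a + d)%N - h).
  apply/ord_geP => m md /=.
  have : ord_ge (mdeg m).+1 (F (a + d)%N - F (a + (mdeg m).+1)%N).
    apply: (ord_ge_cancel hf reg).
    have -> : f * (F (a + d)%N - F (a + (mdeg m).+1)%N) =
      (g - f * F (a + (mdeg m).+1)%N) - (g - f * F (a + d)%N).
      by rewrite mulrBr opprB [RHS]addrC addrA subrK.
    apply: ord_geB; first exact: HF.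
    by apply: ord_geW (HF _); rewrite leq_add2l.
  by move/ord_geP => /(_ m); apply.
have -> : g - f * h = (g - f * F (a + d)%N) + f * (F (a + d)%N - h).
  by rewrite mulrBr addrA subrK.
apply: ord_geD; last exact: ord_geMl.
by apply: ord_geW (HF _); rewrite leq_addl.
Qed.

End Basics.
Arguments ps_of {n R} p.
Arguments low {n R} d f.
Hint Resolve ord_psX ord_ge0 ord_ge_zero : core.

(** * Substitution *)

Definition nilf (n p : nat) (R : comNzRingType) (g : 'I_n -> mps p R) : Prop :=
  forall i, ord_ge 1 (g i).

Section Subst.
Variables (n p : nat) (R : comNzRingType).
Implicit Types (g : 'I_n -> mps p R) (f : mps n R).

Lemma ord_mmap1 g a : nilf g -> ord_ge (mdeg a) (mmap1 g a).
Proof.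
move=> gz; rewrite mdegE /mmap1; apply: ord_ge_prod => i _.
exact: (ord_geX (gz i)).
Qed.

Lemma ord_mmap g d (q : {mpoly R[n]}) : nilf g ->
  ord_ge d (ps_of q) -> ord_ge d (mmap (@mps_const p R) g q).
Proof.
move=> gz qd; rewrite (mmapE _ (leqnn _)); apply: ord_ge_sum => a _.
have [lt|le] := ltnP (mdeg a) d; last exact/ord_geMl/(ord_geW le)/ord_mmap1.
by have := qd _ lt; rewrite /= => ->; rewrite raddf0 mul0r; apply: ord_ge_zero.
Qed.

(** Reduces substitution into series to substitution into polynomials, from which its ring laws are
    inherited. *)
Lemma psubst_mmap g f m : psubst f g m =
  mmap (@mps_const p R) g (mps_trunc (mdeg m).+1 f) m.
Proof.
rewrite /mps_trunc raddf_sum /= mps_sumE; apply: eq_bigr => a _.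
by rewrite mmapZ mmapX mps_constM.
Qed.

Lemma psubst_approx g f d q : nilf g -> ord_ge d (f - ps_of q) ->
  ord_ge d (psubst f g - mmap (@mps_const p R) g q).
Proof.
move=> gz fq; apply/ord_geP => m md; rewrite psubst_mmap.
have : ord_ge (mdeg m).+1 (ps_of (mps_trunc (mdeg m).+1 f - q)).
  rewrite raddfB /= -(subrK f (_ (mps_trunc _ _))) -addrA.
  apply: ord_geD; last exact: ord_geW fq.
  by rewrite -opprB; apply/ord_geN/ps_trunc_ord.
by move/(ord_mmap gz); rewrite raddfB /= => /ord_geP /(_ m); apply.
Qed.

Lemma psubst_of g q : nilf g -> psubst (ps_of q) g = mmap (@mps_const p R) g q.
Proof.
move=> gz; apply: ord_ge_eq => d; apply: psubst_approx => //.
by rewrite subrr; apply: ord_ge_zero.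
Qed.

Lemma psubst_is_additive g : additive (fun f => psubst f g).
Proof.
move=> f h; apply: mpsP => m; rewrite /= -sumrB; apply: eq_bigr => a _.
by rewrite mulrBl.
Qed.

Lemma psubst_is_multiplicative g : nilf g ->
  multiplicative (fun f => psubst f g).
Proof.
move=> gz; split=> [f h|]; last first.
  by rewrite -(rmorph1 (@ps_of n R)) psubst_of // rmorph1.
apply: ord_ge_eq => d.
set q := mps_trunc d f; set q' := mps_trunc d h.
pose M := mmap (@mps_const p R) g.
have fq : ord_ge d (psubst f g - M q) by apply: psubst_approx => //; apply: ps_trunc_ord.
have hq : ord_ge d (psubst h g - M q') by apply: psubst_approx => //; apply: ps_trunc_ord.
have fhq : ord_ge d (psubst (f * h) g - M (q * q')).
  apply: psubst_approx => //; rewrite rmorphM /=.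
  have -> : f * h - ps_of q * ps_of q' =
     (f - ps_of q) * h + ps_of q * (h - ps_of q').
    by rewrite mulrBl mulrBr addrA subrK.
  by apply: ord_geD; [apply: ord_geMr|apply: ord_geMl]; apply: ps_trunc_ord.
rewrite -(subrK (M (q * q')) (psubst (f * h) g)) -addrA.
apply: ord_geD => //; rewrite /M rmorphM /= -/M -opprB; apply: ord_geN.
have -> : psubst f g * psubst h g - M q * M q' =
   (psubst f g - M q) * psubst h g + M q * (psubst h g - M q').
  by rewrite mulrBl mulrBr addrA subrK.
by apply: ord_geD; [apply: ord_geMr|apply: ord_geMl].
Qed.

Lemma psubstB g f h : psubst (f - h) g = psubst f g - psubst h g.
Proof. exact: (psubst_is_additive g f h). Qed.
Lemma psubst0r g : psubst 0 g = 0.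
Proof. by rewrite -(subrr 0) psubstB !subrr. Qed.
Lemma psubstN g f : psubst (- f) g = - psubst f g.
Proof. by rewrite -(add0r (- f)) psubstB psubst0r add0r. Qed.
Lemma psubstD g f h : psubst (f + h) g = psubst f g + psubst h g.
Proof. by have := psubstB g f (- h); rewrite psubstN !opprK. Qed.
Lemma psubst_sum g (I : Type) (r : seq I) (P : pred I) (F : I -> mps n R) :
  psubst (\sum_(i <- r | P i) F i) g = \sum_(i <- r | P i) psubst (F i) g.
Proof. exact: (big_morph _ (psubstD g) (psubst0r g)). Qed.

Section NilArg.
Variables (g : 'I_n -> mps p R) (gz : nilf g).
Lemma psubstM f h : psubst (f * h) g = psubst f g * psubst h g.
Proof. have [mm _] := psubst_is_multiplicative gz; exact: mm. Qed.
Lemma psubst1 : psubst 1 g = 1.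
Proof. have [_ m1] := psubst_is_multiplicative gz; exact: m1. Qed.
Lemma psubst_prod (I : Type) (r : seq I) (P : pred I) (F : I -> mps n R) :
  psubst (\prod_(i <- r | P i) F i) g = \prod_(i <- r | P i) psubst (F i) g.
Proof. exact: (big_morph _ psubstM psubst1). Qed.
Lemma psubstXn f k : psubst (f ^+ k) g = psubst f g ^+ k.
Proof. by elim: k => [|k IH]; rewrite ?expr0 ?psubst1 // !exprS psubstM IH. Qed.
End NilArg.

Lemma psubst_ext g g' f : g =1 g' -> psubst f g = psubst f g'.
Proof. by move=> e; congr psubst; apply/funext. Qed.

Lemma psubst_ord g f d : nilf g -> ord_ge d f -> ord_ge d (psubst f g).
Proof.
move=> gz fd; have := @psubst_approx g f d 0 gz.
by rewrite !raddf0 !addr0; apply.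
Qed.

Lemma psubstX g i : nilf g -> psubst (psX R i) g = g i.
Proof. by move=> gz; rewrite -ps_ofX psubst_of // mmapX mmap1U. Qed.

Lemma psubstC g c : nilf g -> psubst (mps_const n c) g = mps_const p c.
Proof. by move=> gz; rewrite -ps_ofC psubst_of // mmapC. Qed.

Lemma mmap1_zero (a : 'X_{1..n}) :
  mmap1 (fun _ => 0 : mps p R) a = if a == 0%MM then 1 else 0.
Proof.
case: eqP => [->|ne]; first exact: mmap11.
have [i ai] : exists i, a i != 0%N.
  apply/existsP; apply: contra_notT ne; rewrite negb_exists => /forallP h.
  by apply/mnmP => i; rewrite mnm0E; apply/eqP; have := h i; rewrite negbK.
by rewrite /mmap1 (bigD1 i) //= expr0n (negPf ai) mul0r.
Qed.

Lemma psubst0 f : psubst f (fun=> 0) = mps_const p (f 0%MM).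
Proof.
have z : nilf (fun _ : 'I_n => 0 : mps p R) by move=> i; apply: ord_ge_zero.
rewrite -(psubstC _ z); apply: ord_ge_eq => d.
rewrite -psubstB.
case: d => // d m md /=; rewrite big1 // => a _.
rewrite -/(mmap1 (fun _ => 0 : mps p R) _) mmap1_zero.
by case: (bmnm a =P 0%MM) => [->|_]; rewrite ?subrr ?mul0r ?mps0E ?mulr0.
Qed.

Lemma psubst_low g f d : nilf g -> ord_ge d f ->
  low d (psubst f g) = mmap (@mpolyC p R) (fun i => low 1 (g i)) (low d f).
Proof.
move=> gz fd.
have e : ord_ge d.+1 (f - ps_of (low d f)).
  move=> m; rewrite mpsBE /= lowE ltnS leq_eqVlt => /orP[->|lt].
    by rewrite subrr.
  by rewrite fd // ifN ?subr0 // ltn_eqF.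
have h := psubst_approx gz e.
have := (low_eq0 (ord_geW (leqnSn d) h)).2 h.
rewrite raddfB => /subr0_eq ->.
rewrite /mmap raddf_sum; apply: eq_big_seq => k /mdeg_low kd.
transitivity (((low d f)@_k)%:MP * low d (mmap1 g k)).
  apply/mpolyP => m; rewrite mcoeffCM [LHS](lowE d _ m) [X in _ = _ * X]lowE.
  by case: (mdeg m == d); [apply: mps_constM|rewrite mulr0].
congr (_ * _); rewrite -kd mdegE /mmap1 low_prod => [|i _].
  by apply: eq_bigr => i _; exact: lowX.
exact: (ord_geX (gz i)).
Qed.
End Subst.

Section Compose.
Variables (R : comNzRingType).

(** Polynomials are dense for the order topology, and both maps are continuous. *)
Lemma psubst_cont_eq n p (Phi Psi : mps n R -> mps p R) :
    additive Phi -> additive Psi ->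
    (forall d f, ord_ge d f -> ord_ge d (Phi f)) ->
    (forall d f, ord_ge d f -> ord_ge d (Psi f)) ->
    (forall q, Phi (ps_of q) = Psi (ps_of q)) ->
  Phi =1 Psi.
Proof.
move=> aP aS cP cS e f; apply: ord_ge_eq => d.
set q := mps_trunc d f.
have -> : Phi f - Psi f = Phi (f - ps_of q) - Psi (f - ps_of q).
  by rewrite aP aS e opprB addrA subrK.
by apply: ord_geB; [apply: cP|apply: cS]; apply: ps_trunc_ord.
Qed.

Lemma nilf_comp n p k (g : 'I_n -> mps p R) (h : 'I_p -> mps k R) :
  nilf g -> nilf h -> nilf (fun i => psubst (g i) h).
Proof. by move=> gz hz i; apply: psubst_ord. Qed.

Lemma psubst_comp n p k (f : mps n R) (g : 'I_n -> mps p R) (h : 'I_p -> mps k R) :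
  nilf g -> nilf h -> psubst (psubst f g) h = psubst f (fun i => psubst (g i) h).
Proof.
move=> gz hz; have ghz := nilf_comp gz hz.
move: f; apply: psubst_cont_eq => [a b|a b|d f fd|d f fd|q].
- by rewrite !psubstB.
- by rewrite psubstB.
- by apply: psubst_ord => //; apply: psubst_ord.
- exact: psubst_ord.
rewrite !psubst_of // /mmap psubst_sum; apply: eq_bigr => a _.
rewrite psubstM // psubstC // /mmap1 psubst_prod //; congr (_ * _).
by apply: eq_bigr => i _; rewrite psubstXn.
Qed.

Lemma nilf_psX n : nilf (@psX n R).
Proof. by move=> i; apply: ord_psX. Qed.

Lemma psubst_id n (f : mps n R) : psubst f (@psX n R) = f.
Proof.
have z := @nilf_psX n.
move: f; apply: psubst_cont_eq => // [a b|d f fd|q].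
- by rewrite psubstB.
- exact: psubst_ord.
rewrite psubst_of // [in RHS](mpolyE q) raddf_sum; apply: eq_bigr => a _.
rewrite [RHS]ps_ofZ; congr (_ * _).
by rewrite mpolyXE_id [RHS]rmorph_prod; apply: eq_bigr => i _; rewrite [RHS]rmorphXn -ps_ofX.
Qed.

(** Telescoping: in each term one factor is a difference, of order N+1, and the other |a| - 1
    factors have order at least 1. *)
Lemma mmap1_close n p N (g g' : 'I_n -> mps p R) a : nilf g -> nilf g' ->
    (forall i, ord_ge N.+1 (g i - g' i)) ->
  ord_ge (N + mdeg a) (mmap1 g a - mmap1 g' a).
Proof.
move=> gz gz' e.
have [k] := ubnP (mdeg a); elim: k a => // k IH a; rewrite ltnS => ak.
have [->|/eqP ne] := eqVneq a 0%MM; first by rewrite !mmap11 subrr.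
have [i ai] : exists i, a i != 0%N.
  apply/existsP; apply: contra_notT ne; rewrite negb_exists => /forallP h.
  by apply/mnmP => i; rewrite mnm0E; apply/eqP; have := h i; rewrite negbK.
have le : (U_(i) <= a)%MM by rewrite lep1mP.
have ae := submK le; move: ak; rewrite -ae => ak.
set b := (a - U_(i))%MM in ak *.
have ab : (mdeg b < k)%N by move: ak; rewrite mdegD mdeg1 addn1.
have cmm (x : mps p R) (gg : 'I_n -> mps p R) j : GRing.comm x (gg j) by apply: mulrC.
rewrite !commr_mmap1_M => [|j x|j x]; try exact: mulrC.
rewrite !mmap1U.
have -> : mmap1 g b * g i - mmap1 g' b * g' i =
  (mmap1 g b - mmap1 g' b) * g i + mmap1 g' b * (g i - g' i).
  by rewrite mulrBl mulrBr addrA subrK.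
rewrite mdegD mdeg1; apply: ord_geD.
  by rewrite addnA; apply: ord_geM (gz i); apply: IH.
by rewrite addnC -addnA add1n; apply: ord_geM => //; apply: ord_mmap1.
Qed.

Lemma psubst_close n p d N (f : mps n R) (g g' : 'I_n -> mps p R) :
    nilf g -> nilf g' -> (forall i, ord_ge N.+1 (g i - g' i)) -> ord_ge d f ->
  ord_ge (N + d) (psubst f g - psubst f g').
Proof.
move=> gz gz' e fd.
pose M (h : 'I_n -> mps p R) := mmap (@mps_const p R) h (mps_trunc (N + d) f).
have A h : nilf h -> ord_ge (N + d) (psubst f h - M h).
  by move=> hz; apply: psubst_approx => //; apply: ps_trunc_ord.
have -> : psubst f g - psubst f g' =
   (psubst f g - M g) + (M g - M g') - (psubst f g' - M g').
  by move: (psubst f g) (psubst f g') (M g) (M g') => a b c h; ring.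
apply: ord_geB; last exact: A.
apply: ord_geD; first exact: A.
rewrite /M !(mmapE _ (leqnn _)) -sumrB; apply: ord_ge_sum => a _.
rewrite -mulrBr; have [lt|le] := ltnP (mdeg a) d; last first.
  apply: ord_geMl. apply: ord_geW (mmap1_close gz gz' e).
  by rewrite leq_add2l.
rewrite mps_truncE ?fd ?raddf0 ?mul0r //.
by apply: leq_trans lt _; apply: leq_addl.
Qed.

End Compose.

(** * Division by linear forms *)

Lemma lreg_mpoly (n : nat) (R : comNzRingType) (p : {mpoly R[n]}) : p != 0 ->
  (forall m, p@_m != 0 -> GRing.lreg p@_m) -> GRing.lreg p.
Proof. by move=> p0 h; apply/lreg_mleadc/h; rewrite mleadc_eq0. Qed.

Section Vars.
Variables (n : nat) (R : comNzRingType).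
Implicit Types (f g : mps n R) (i j : 'I_n).

Definition zvar i k : mps n R := if k == i then 0 else psX R k.
Definition evar i j k : mps n R := if k == i then psX R j else psX R k.
Definition zsub i f := psubst f (zvar i).
Definition esub i j f := psubst f (evar i j).

Lemma nilf_zvar i : nilf (zvar i).
Proof. by move=> k; rewrite /zvar; case: ifP. Qed.
Lemma nilf_evar i j : nilf (evar i j).
Proof. by move=> k; rewrite /evar; case: ifP. Qed.
Lemma nilf_perm (w : 'S_n) : nilf (fun i => psX R (w i)).
Proof. by move=> k. Qed.

Lemma ps_of_mono m : ps_of 'X_[m] = mmap1 (@psX n R) m.
Proof.
rewrite mpolyXE_id [LHS]rmorph_prod; apply: eq_bigr => i _.
by rewrite [LHS]rmorphXn -ps_ofX.
Qed.

Lemma mmap1_psX_coef a m : (mmap1 (@psX n R) a) m = (a == m)%:R.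
Proof. by rewrite -ps_of_mono /= mcoeffX. Qed.

Lemma psperm_coef (w : 'S_n) f m : psperm w f m = f [multinom m (w k) | k < n].
Proof.
rewrite /psperm psubst_mmap.
have -> : mmap (@mps_const n R) (fun i => psX R (w i)) (mps_trunc (mdeg m).+1 f)
    = ps_of (msym w (mps_trunc (mdeg m).+1 f)).
  rewrite /msym /mmap raddf_sum; apply: eq_bigr => a _.
  rewrite mul_mpolyC [RHS]ps_ofZ; congr (_ * _).
  rewrite /mmap1 [RHS]rmorph_prod; apply: eq_bigr => i _.
  by rewrite [RHS]rmorphXn -ps_ofX.
by rewrite /= mcoeff_sym mps_truncE // mdeg_mperm.
Qed.

Lemma psubst_coef p (f : mps n R) (g : 'I_n -> mps p R) m :
  psubst f g m = \sum_(a : 'X_{1..n < (mdeg m).+1}) f a * mmap1 g a m.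
Proof. by []. Qed.

Lemma psubst_coef1 p (f : mps n R) (g : 'I_n -> mps p R) m (a0 : 'X_{1..n}) :
    nilf g -> (forall a, a != a0 -> f a * mmap1 g a m = 0) ->
  psubst f g m = f a0 * mmap1 g a0 m.
Proof.
move=> gz h; rewrite psubst_coef; have [lt|le] := ltnP (mdeg a0) (mdeg m).+1.
  rewrite (bigD1 (BMultinom lt)) //= big1 ?addr0 // => a ne; apply: h.
  by apply: contraNneq ne => e; apply/eqP/val_inj.
rewrite (ord_mmap1 gz) ?mulr0 // big1 // => a _; apply: h.
by apply: contraTneq (bmdeg a) => ->; rewrite -leqNgt.
Qed.

Lemma zsub_coef i f m : zsub i f m = if m i == 0%N then f m else 0.
Proof.
have mE a : mmap1 (zvar i) a m = (if a i == 0%N then (a == m)%:R else 0 : R).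
  case: eqP => [ai|/eqP ai].
    rewrite -mmap1_psX_coef; congr (mps_coef _ m).
    rewrite /mmap1; apply: eq_bigr => k _; rewrite /zvar; case: eqP => // ->.
    by rewrite ai !expr0.
  have zi : zvar i i = 0 by rewrite /zvar eqxx.
  have -> : mmap1 (zvar i) a = 0.
    by rewrite /mmap1 (bigD1 i) //= zi expr0n (negPf ai) mul0r.
  exact: mps0E.
rewrite /zsub (@psubst_coef1 _ _ _ _ m); last 2 first.
- exact: nilf_zvar.
- move=> a ne; rewrite mE (negPf ne); case: ifP => _; exact: mulr0.
by rewrite mE eqxx; case: ifP; rewrite ?mulr1 ?mulr0.
Qed.

Lemma psX_mul_coef i f m : (psX R i * f) (U_(i) + m)%MM = f m.
Proof.
rewrite (@mpsME _ _ (mdeg (U_(i) + m)).+1) //.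
set d := (mdeg _).+1.
transitivity ((mps_trunc d f * 'X_i)@_(U_(i) + m)%MM).
  rewrite mulrC; apply: mcoeffM_eq => // k km.
  by rewrite mps_truncE // mpsXE mcoeffX.
by rewrite mcoeffMX mps_truncE // ltnS mdegD leq_addl.
Qed.

Lemma zsubM i f g : zsub i (f * g) = zsub i f * zsub i g.
Proof. by rewrite /zsub psubstM //; apply: nilf_zvar. Qed.
Lemma zsubX i j : zsub i (psX R j) = if j == i then 0 else psX R j.
Proof. by rewrite /zsub psubstX //; apply: nilf_zvar. Qed.
Lemma zsubK i f : zsub i (zsub i f) = zsub i f.
Proof. by apply: mpsP => m; rewrite !zsub_coef; case: (m i == 0%N). Qed.

Lemma div_psX i f : zsub i f = 0 -> exists g, f = psX R i * g.
Proof.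
move=> f0; exists (Mps (fun m => f (U_(i) + m)%MM)); apply: mpsP => m.
have [mi|mi] := eqVneq (m i) 0%N; last first.
  have le : (U_(i) <= m)%MM by rewrite lep1mP.
  by rewrite -(submK le) addmC psX_mul_coef.
have z h : zsub i h = 0 -> h m = 0.
  by move=> e; have := zsub_coef i h m; rewrite e mps0E mi eqxx.
by rewrite !z // zsubM zsubX eqxx mul0r.
Qed.

Lemma lreg_psX i : GRing.lreg (psX R i).
Proof.
apply: mulrI0_lreg => g e; apply: mpsP => m.
by rewrite -(psX_mul_coef i) e mps0E mps0E.
Qed.

Lemma zsub_psX_mul i f : zsub i (psX R i * f) = 0.
Proof. by rewrite zsubM zsubX eqxx mul0r. Qed.

Definition shvar (c : R) i j k : mps n R :=
  if k == i then psX R i + mps_const n c * psX R j else psX R k.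
Lemma nilf_shvar c i j : nilf (shvar c i j).
Proof.
move=> k; rewrite /shvar; case: ifP => // _; apply: ord_geD => //.
exact: ord_geMl.
Qed.

Lemma shvarK i j f (c c' : R) : i != j -> c + c' = 0 ->
  psubst (psubst f (shvar c i j)) (shvar c' i j) = f.
Proof.
move=> ij cc; rewrite psubst_comp; try exact: nilf_shvar.
rewrite -[RHS]psubst_id; apply: psubst_ext => k.
have z := nilf_shvar c' i j.
rewrite {1}/shvar; case: eqP => [->|/eqP ki].
  rewrite psubstD (psubstM z) (psubstC _ z) !(psubstX _ z) /shvar eqxx.
  rewrite [j == i]eq_sym (negPf ij) -addrA -mulrDl -rmorphD /= [c' + c]addrC cc.
  by rewrite rmorph0 mul0r addr0.
by rewrite psubstX // /shvar (negPf ki).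
Qed.

(* The automorphism x_i -> x_i + x_j turns x_i - x_j into a variable. *)
Lemma factor_thm i j f : i != j -> esub i j f = 0 ->
  exists g, f = (psX R i - psX R j) * g.
Proof.
move=> ij f0.
have z1 := nilf_shvar 1 i j; have z2 := nilf_shvar (-1) i j.
have : zsub i (psubst f (shvar 1 i j)) = 0.
  rewrite -f0 /zsub psubst_comp //; last exact: nilf_zvar.
  apply: psubst_ext => k; have z := nilf_zvar i.
  rewrite /shvar /evar; case: eqP => [_|/eqP ki].
    rewrite psubstD psubstM // psubstC // !psubstX // /zvar eqxx eq_sym.
    by rewrite (negPf ij) add0r rmorph1 mul1r.
  by rewrite psubstX // /zvar (negPf ki).
move/div_psX => [g e]; exists (psubst g (shvar (-1) i j)).
rewrite -[LHS](shvarK f (c := 1) (c' := -1) ij) ?subrr // e psubstM // psubstX //.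
by rewrite {1}/shvar eqxx rmorphN1 mulN1r.
Qed.

Lemma lreg_ord1 f : ord_ge 1 f -> low 1 f != 0 ->
  (forall m, (low 1 f)@_m != 0 -> GRing.lreg (low 1 f)@_m) -> GRing.lreg f.
Proof. by move=> f1 fn h; apply: (lreg_low f1); apply: lreg_mpoly. Qed.

Lemma lreg_lin2 i j f (a b : R) : i != j -> ord_ge 1 f ->
    low 1 f = a *: 'X_i + b *: 'X_j ->
    GRing.lreg a -> GRing.lreg b -> GRing.lreg f.
Proof.
move=> ij f1 e ra rb.
have ca m : (low 1 f)@_m = if m == U_(i)%MM then a else if m == U_(j)%MM then b else 0.
  rewrite e mcoeffD !mcoeffZ !mcoeffX ![U_(_)%MM == m]eq_sym.
  case: (m =P U_(i)%MM) => [->|_]; last by case: eqP; rewrite mulr0 ?mulr1 ?mulr0 add0r.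
  by rewrite eq_mnm1 (negPf ij) mulr1 mulr0 addr0.
apply: lreg_ord1 => // [|m].
  apply/eqP => /(congr1 (mcoeff U_(i)%MM)); rewrite ca eqxx mcoeff0.
  by move/eqP; rewrite (negPf (lreg_neq0 ra)).
by rewrite ca; do 2!case: ifP => // _; rewrite eqxx.
Qed.

Lemma lreg_lin1 i f (a : R) : ord_ge 1 f -> low 1 f = a *: 'X_i ->
    GRing.lreg a -> GRing.lreg f.
Proof.
move=> f1 e ra.
have ca m : (low 1 f)@_m = if m == U_(i)%MM then a else 0.
  rewrite e mcoeffZ mcoeffX eq_sym; case: eqP; rewrite ?mulr1 ?mulr0 //.
apply: lreg_ord1 => // [|m].
  apply/eqP => /(congr1 (mcoeff U_(i)%MM)); rewrite ca eqxx mcoeff0.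
  by move/eqP; rewrite (negPf (lreg_neq0 ra)).
by rewrite ca; case: ifP => // _; rewrite eqxx.
Qed.

Lemma lreg_psXB i j : i != j -> GRing.lreg (psX R i - psX R j).
Proof.
move=> ij; apply: (@lreg_lin2 i j _ 1 (-1)) => //; last 2 first.
- exact: lreg1.
- exact/lregN/lreg1.
- exact: ord_geB.
by rewrite raddfB /= !low_psX scale1r scaleN1r.
Qed.

Lemma lregMn k f : (forall a : R, a *+ k = 0 -> a = 0) -> f *+ k = 0 -> f = 0.
Proof.
by move=> h e; apply: mpsP => m; rewrite mps0E; apply: h; rewrite -mpsMnE e mps0E.
Qed.

End Vars.

Lemma set_last0_coef (n : nat) (R : comNzRingType) (f : mps n.+1 R) m :
  set_last0 f m = f (mnmwiden m).
Proof.
rewrite /set_last0; set g := fun i => _.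
have gz : nilf g by move=> i; rewrite /g; case: unlift => [k|].
have mE a : mmap1 g a m = (a == mnmwiden m)%:R.
  have gl : g ord_max = 0 by rewrite /g unlift_none.
  have gw (i : 'I_n) : g (widen_ord (leqnSn n) i) = psX R i.
    rewrite /g; have -> : widen_ord (leqnSn n) i = lift ord_max i.
      by apply: val_inj; rewrite /= /bump leqNgt ltn_ord.
    by rewrite liftK.
  have -> : mmap1 g a =
      (\prod_(i < n) psX R i ^+ a (widen_ord (leqnSn n) i)) * 0 ^+ a ord_max.
    by rewrite /mmap1 big_ord_recr -gl; congr (_ * _); apply: eq_bigr => i _; rewrite gw.
  have [a0|a0] := eqVneq (a ord_max) 0%N; last first.
    rewrite expr0n (negPf a0) mulr0 mps0E; case: eqP => // e.
    by move: a0; rewrite e mnmwiden_ordmax eqxx.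
  rewrite a0 expr0 mulr1.
  pose b := [multinom a (widen_ord (leqnSn n) i) | i < n].
  have -> : a = mnmwiden b.
    apply/mnmP => i; case: (unliftP ord_max i) => [k ->|->]; last first.
      by rewrite mnmwiden_ordmax.
    have -> : lift ord_max k = widen_ord (leqnSn n) k.
      by apply: val_inj; rewrite /= /bump leqNgt ltn_ord.
    by rewrite mnmwiden_widen mnmE.
  rewrite (inj_eq (@inj_mnmwiden n)) -mmap1_psX_coef; congr (mps_coef _ m).
  by rewrite /mmap1; apply: eq_bigr => i _; rewrite mnmwiden_widen.
rewrite (@psubst_coef1 _ _ _ _ _ _ (mnmwiden m)) //; last first.
  by move=> a ne; rewrite mE (negPf ne) mulr0.
by rewrite mE eqxx mulr1.
Qed.

(** * Formal group laws *)

(** Contraction principle: the iterates of 0 stabilise degree by degree. It supplies formal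
    inverses, compositional inverses and reciprocals. *)
Lemma ps_fixpoint (n : nat) (R : comNzRingType) (Phi : mps n R -> mps n R) :
    (forall y, ord_ge 1 y -> ord_ge 1 (Phi y)) ->
    (forall d y y', ord_ge 1 y -> ord_ge 1 y' -> ord_ge d (y - y') ->
       ord_ge d.+1 (Phi y - Phi y')) ->
  exists2 y, ord_ge 1 y & Phi y = y.
Proof.
move=> h1 hc; pose s k := iter k Phi 0.
have s1 k : ord_ge 1 (s k) by case: k => //= k; elim: k => [|k IH]; apply: h1.
have sS k : ord_ge k (s k.+1 - s k).
  by elim: k => // k IH; apply: hc => //; apply: (s1 k.+1).
have sD k l : ord_ge k (s (k + l)%N - s k).
  elim: l => [|l IH]; first by rewrite addn0 subrr.
  rewrite addnS -(subrK (s (k + l)%N) (s _)) -addrA.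
  by apply: ord_geD => //; apply: ord_geW (sS _); apply: leq_addr.
pose y : mps n R := Mps (fun m => s (mdeg m).+1 m).
have yE k : ord_ge k (y - s k).
  apply/ord_geP => m mk; have := sD (mdeg m).+1 (k - (mdeg m).+1)%N.
  by rewrite subnKC // => /ord_geP /(_ m (leqnn _)) /= ->.
have y1 : ord_ge 1 y.
  rewrite -(subrK (s 1%N) y); apply: ord_geD => //; apply: yE.
exists y => //; apply: ord_ge_eq => d.
rewrite -(subrK (s d.+1) (Phi y)) -addrA; apply: ord_geD.
  by apply: (ord_geW (leqnSn d)); apply: hc => //; apply: (s1 d).
by rewrite -opprB; apply/ord_geN/(ord_geW (leqnSn d)).
Qed.

Section Pair.
Variables (n : nat) (R : comNzRingType).
Implicit Types a b : mps n R.

Definition ppair a b : 'I_2 -> mps n R := fun k => if k == ord0 then a else b.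

Lemma fgl_addE (F : mps 2 R) a b : fgl_add F a b = psubst F (ppair a b).
Proof. by []. Qed.

Lemma nilf_ppair a b : ord_ge 1 a -> ord_ge 1 b -> nilf (ppair a b).
Proof. by move=> a1 b1 k; rewrite /ppair; case: ifP. Qed.

Lemma ppair_close d a b a' b' : ord_ge d (a - a') -> ord_ge d (b - b') ->
  forall k, ord_ge d (ppair a b k - ppair a' b' k).
Proof. by move=> ha hb k; rewrite /ppair; case: ifP. Qed.

End Pair.

Lemma inord0_2 : inord 0 = ord0 :> 'I_2.
Proof. by apply: val_inj; rewrite /= inordK. Qed.
Lemma inord1_2 : inord 1 = lift ord0 ord0 :> 'I_2.
Proof. by apply: val_inj; rewrite /= inordK. Qed.

Lemma fgl_add_subst (n p : nat) (R : comNzRingType) (F : mps 2 R) (a b : mps n R)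
    (h : 'I_n -> mps p R) : ord_ge 1 a -> ord_ge 1 b -> nilf h ->
  psubst (fgl_add F a b) h = fgl_add F (psubst a h) (psubst b h).
Proof.
move=> a1 b1 hz; rewrite fgl_addE psubst_comp //; last exact: nilf_ppair.
by apply: psubst_ext => k; rewrite /ppair; case: ifP.
Qed.

Definition fgl_unit (R : comNzRingType) (F : mps 2 R) : Prop :=
  let u : mps 1 R := psX R ord0 in fgl_add F u 0 = u /\ fgl_add F 0 u = u.

Section Unit.
Variables (R : comNzRingType) (F : mps 2 R).
Hypothesis HU : fgl_unit F.

Lemma faddr0 n (a : mps n R) : ord_ge 1 a -> fgl_add F a 0 = a.
Proof.
move=> a1; have [+ _] := HU.
have z : nilf (fun _ : 'I_1 => a) by [].
move/(congr1 (fun f => psubst f (fun=> a))).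
by rewrite fgl_add_subst // psubstX // psubst0r.
Qed.

Lemma fadd0r n (a : mps n R) : ord_ge 1 a -> fgl_add F 0 a = a.
Proof.
move=> a1; have [_ +] := HU.
have z : nilf (fun _ : 'I_1 => a) by [].
move/(congr1 (fun f => psubst f (fun=> a))).
by rewrite fgl_add_subst // psubstX // psubst0r.
Qed.

Let X0 : mps 2 R := psX R ord0.
Let X1 : mps 2 R := psX R (lift ord0 ord0).

(** The unit laws make F - x - y vanish on both axes, so it is divisible by x and then by y. *)
Lemma fgl_decomp : exists F', F = X0 + X1 + X0 * X1 * F'.
Proof.
have X0o : ord_ge 1 X0 by apply: ord_psX.
have X1o : ord_ge 1 X1 by apply: ord_psX.
have e0 : zsub ord0 F = X1.
  rewrite -[RHS]fadd0r // fgl_addE; apply: psubst_ext => k.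
  rewrite /zvar /ppair; case: (unliftP ord0 k) => [l ->|->] //=.
  by rewrite /X1 (ord1 l).
have e1 : zsub (lift ord0 ord0) F = X0.
  rewrite -[RHS]faddr0 // fgl_addE; apply: psubst_ext => k.
  rewrite /zvar /ppair; case: (unliftP ord0 k) => [l ->|->] //=.
  by rewrite (ord1 l) eqxx.
have [|g e] := @div_psX _ _ ord0 (F - X0 - X1).
  by rewrite /zsub !psubstB -!/(zsub _ _) e0 !zsubX eqxx /= subr0 subrr.
have [|g' e'] := @div_psX _ _ (lift ord0 ord0) g.
  apply: (@lreg_psX _ _ ord0); rewrite mulr0.
  have := congr1 (zsub (lift ord0 ord0)) e; rewrite zsubM zsubX /= => <-.
  by rewrite /zsub !psubstB -!/(zsub _ _) e1 !zsubX eqxx /= subrr subr0.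
exists g'; rewrite -mulrA -e' -e.
by ring.
Qed.

Definition fgl_rest : mps 2 R := xget 0 [set F' | F = X0 + X1 + X0 * X1 * F']%classic.

Lemma fgl_restE : F = X0 + X1 + X0 * X1 * fgl_rest.
Proof.
have [F' e] := fgl_decomp.
exact: (@xgetPex _ 0 [set F' | F = X0 + X1 + X0 * X1 * F']%classic (ex_intro _ F' e)).
Qed.

Section Add.
Variable n : nat.
Implicit Types a b c : mps n R.

Lemma fadd_decomp a b : ord_ge 1 a -> ord_ge 1 b ->
  fgl_add F a b = a + b + a * b * psubst fgl_rest (ppair a b).
Proof.
move=> a1 b1; have z := nilf_ppair a1 b1.
by rewrite fgl_addE {1}fgl_restE !psubstD !psubstM // !psubstX.
Qed.

Lemma ord_fadd a b : ord_ge 1 a -> ord_ge 1 b -> ord_ge 1 (fgl_add F a b).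
Proof.
move=> a1 b1; rewrite fadd_decomp //; apply: ord_geD; first exact: ord_geD.
by rewrite -mulrA; apply: ord_geMr.
Qed.

Lemma low_fadd a b : ord_ge 1 a -> ord_ge 1 b ->
  low 1 (fgl_add F a b) = low 1 a + low 1 b.
Proof.
move=> a1 b1; rewrite fadd_decomp // !raddfD /= [X in _ + X](low_eq0 _).2 ?addr0 //.
- apply: (ord_geW (leqnSn 1)); apply: ord_geMr; exact: (ord_geM a1 b1).
- by apply: ord_geMr; apply: (ord_geM a1 b1).
Qed.

(** For small perturbations formal addition behaves like ordinary addition: the cross term a b
    F'(a,b) gains one order, since each difference in it is multiplied by a series of order at least
    1. *)
Lemma fadd_close d a b a' b' : ord_ge 1 a -> ord_ge 1 b -> ord_ge 1 a' -> ord_ge 1 b' ->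
    ord_ge d.+1 (a - a') -> ord_ge d.+1 (b - b') ->
  ord_ge d.+2 ((fgl_add F a b - fgl_add F a' b') - ((a - a') + (b - b'))).
Proof.
move=> a1 b1 a1' b1' ha hb; rewrite !fadd_decomp //.
set r := psubst fgl_rest _; set r' := psubst fgl_rest _.
have hr : ord_ge d (r - r').
  rewrite -[d]addn0; apply: psubst_close => //; try exact: nilf_ppair.
  exact: ppair_close.
have -> : a + b + a * b * r - (a' + b' + a' * b' * r') - (a - a' + (b - b')) =
   (a - a') * (b * r) + a' * ((b - b') * r + b' * (r - r')).
  by ring.
rewrite -addn1; apply: ord_geD.
  by apply: ord_geM => //; apply: ord_geMr.
rewrite addnC; apply: ord_geM => //; apply: ord_geD; first exact: ord_geMr.
by rewrite -[d.+1]add1n; apply: ord_geM.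
Qed.
End Add.
End Unit.

Section Group.
Variables (R : comNzRingType) (F : mps 2 R).
Hypothesis HF : is_fgl F.

Lemma fgl_unitP : fgl_unit F. Proof. by case: HF. Qed.
Let HU := fgl_unitP.

Lemma faddC n (a b : mps n R) : ord_ge 1 a -> ord_ge 1 b ->
  fgl_add F a b = fgl_add F b a.
Proof.
move=> a1 b1; have [_ + _] := HF; have z := nilf_ppair a1 b1.
move/(congr1 (fun f => psubst f (ppair a b))); rewrite !fgl_add_subst // !psubstX //.
by rewrite inord0_2 inord1_2 /ppair /=.
Qed.

Definition ptriple n (a b c : mps n R) : 'I_3 -> mps n R :=
  fun k => if val k == 0%N then a else if val k == 1%N then b else c.

Lemma faddA n (a b c : mps n R) : ord_ge 1 a -> ord_ge 1 b -> ord_ge 1 c ->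
  fgl_add F (fgl_add F a b) c = fgl_add F a (fgl_add F b c).
Proof.
move=> a1 b1 c1; have [_ _ +] := HF.
have z : nilf (ptriple a b c) by move=> k; rewrite /ptriple; do 2!case: ifP => // _.
move/(congr1 (fun f => psubst f (ptriple a b c))).
set u := psX R (inord 0); set v := psX R (inord 1); set w := psX R (inord 2).
have [u1 v1 w1] : [/\ ord_ge 1 u, ord_ge 1 v & ord_ge 1 w] by split; apply: ord_psX.
have uv := ord_fadd HU u1 v1; have vw := ord_fadd HU v1 w1.
rewrite (fgl_add_subst F uv w1 z) (fgl_add_subst F u1 vw z).
rewrite (fgl_add_subst F u1 v1 z) (fgl_add_subst F v1 w1 z).
by rewrite !psubstX // /ptriple /= !inordK.
Qed.

Lemma fgl_inv_ex : exists i : mps 1 R,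
  i 0%MM = 0 /\ fgl_add F (psX R ord0) i = 0.
Proof.
set x := psX R ord0.
(* A fixed point is exactly a solution of x + y + x y F'(x,y) = 0. *)
pose Phi (y : mps 1 R) := - x - x * y * psubst (fgl_rest F) (ppair x y).
have x1 : ord_ge 1 x by apply: ord_psX.
have [| |y y1 yE] := @ps_fixpoint 1 R Phi.
- move=> y y1; apply: ord_geB; first exact: ord_geN.
  by rewrite -mulrA; apply: ord_geMr.
- move=> d y y' y1 y1' yy.
  have -> : Phi y - Phi y' = x * (y' * (psubst (fgl_rest F) (ppair x y')
      - psubst (fgl_rest F) (ppair x y)) - (y - y') * psubst (fgl_rest F) (ppair x y)).
    by rewrite /Phi; ring.
  rewrite -[d.+1]add1n; apply: ord_geM => //; apply: ord_geB; last exact: ord_geMr.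
  case: d yy => [|d] yy; first by [].
  rewrite -[d.+1]add1n; apply: ord_geM => //.
  rewrite -[d]addn0; apply: psubst_close => //; try exact: nilf_ppair.
  apply: ppair_close; rewrite ?subrr //.
  by rewrite -opprB; apply: ord_geN.
exists y; split; first exact/ord_ge1P.
by rewrite fadd_decomp // -{1}yE /Phi; ring.
Qed.

Lemma fgl_invP : fgl_inv F 0%MM = 0 /\ fgl_add F (psX R ord0) (fgl_inv F) = 0.
Proof.
have [i Pi] := fgl_inv_ex.
exact: (@xgetPex _ 0 [set i : mps 1 R | i 0%MM = 0 /\ fgl_add F (psX R ord0) i = 0]%classic
   (ex_intro _ i Pi)).
Qed.

Section Opp.
Variable n : nat.
Implicit Types a b c : mps n R.

Lemma ord_fopp a : ord_ge 1 a -> ord_ge 1 (fgl_opp F a).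
Proof.
move=> a1; apply: psubst_ord; first by move=> i.
by apply/ord_ge1P; case: fgl_invP.
Qed.

Lemma faddN a : ord_ge 1 a -> fgl_add F a (fgl_opp F a) = 0.
Proof.
move=> a1; have [i0 +] := fgl_invP; have z : nilf (fun _ : 'I_1 => a) by [].
move/(congr1 (fun f => psubst f (fun=> a))); rewrite psubst0r fgl_add_subst //.
  by rewrite psubstX.
exact/ord_ge1P.
Qed.

Lemma fopp_uniq a b : ord_ge 1 a -> ord_ge 1 b -> fgl_add F a b = 0 -> b = fgl_opp F a.
Proof.
move=> a1 b1 e; have o1 := ord_fopp a1.
have := faddA b1 a1 o1; rewrite faddN // faddr0 // => <-.
by rewrite [fgl_add F b a]faddC // e fadd0r.
Qed.

Lemma foppK a : ord_ge 1 a -> fgl_opp F (fgl_opp F a) = a.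
Proof.
move=> a1; have o1 := ord_fopp a1.
by apply/esym/fopp_uniq => //; rewrite faddC // faddN.
Qed.

Lemma low_fopp a : ord_ge 1 a -> low 1 (fgl_opp F a) = - low 1 a.
Proof.
move=> a1; have o1 := ord_fopp a1.
have := low_fadd HU a1 o1; rewrite faddN // raddf0 => e.
by apply/eqP; rewrite -addr_eq0 addrC -e.
Qed.

Lemma fopp_subst p a (h : 'I_n -> mps p R) : ord_ge 1 a -> nilf h ->
  psubst (fgl_opp F a) h = fgl_opp F (psubst a h).
Proof.
by move=> a1 hz; rewrite /fgl_opp psubst_comp.
Qed.

Lemma fopp0 : fgl_opp F (0 : mps n R) = 0.
Proof. by apply/esym/fopp_uniq => //; rewrite faddr0. Qed.

Definition fsub a b := fgl_add F a (fgl_opp F b).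

Lemma ord_fsub a b : ord_ge 1 a -> ord_ge 1 b -> ord_ge 1 (fsub a b).
Proof. by move=> a1 b1; apply: ord_fadd => //; apply: ord_fopp. Qed.
Lemma low_fsub a b : ord_ge 1 a -> ord_ge 1 b ->
  low 1 (fsub a b) = low 1 a - low 1 b.
Proof.
by move=> a1 b1; rewrite low_fadd ?low_fopp //; apply: ord_fopp.
Qed.
Lemma fsub_subst p a b (h : 'I_n -> mps p R) : ord_ge 1 a -> ord_ge 1 b -> nilf h ->
  psubst (fsub a b) h = fgl_add F (psubst a h) (fgl_opp F (psubst b h)).
Proof.
move=> a1 b1 hz; rewrite fgl_add_subst ?fopp_subst //; exact: ord_fopp.
Qed.

(** Makes a +_F b congruent to a -_F b modulo [2](b); this is what puts Q into the subring defined
    by divisibility. *)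
Lemma fadd_fsub a b : ord_ge 1 a -> ord_ge 1 b ->
  fgl_add F a b = fgl_add F (fsub a b) (fgl_add F b b).
Proof.
move=> a1 b1; have o1 := ord_fopp b1; have o2 := ord_fadd HU b1 b1.
rewrite /fsub faddA // -[fgl_add F (fgl_opp F b) _]faddA //.
by rewrite [fgl_add F (fgl_opp F b) b]faddC // faddN // fadd0r.
Qed.

End Opp.
End Group.

(** * Symmetric 2-cocycles *)

(** A - s is congruent to -s modulo p^w, and s is not divisible by p^w, so the valuations agree. *)
Lemma logn_sub_pfactor p w A s : prime p -> (p ^ w %| A)%N -> (0 < s < p ^ w)%N ->
  (s < A)%N -> logn p (A - s) = logn p s.
Proof.
move=> pp pA /andP[s0 sp] sA.
have D k : (k <= w)%N -> (p ^ k %| A - s)%N = (p ^ k %| s)%N.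
  move=> kw; apply: dvdn_subr; first exact: ltnW.
  exact: dvdn_trans (dvdn_exp2l p kw) pA.
have nw : ~~ (p ^ w %| s)%N by apply/negP => /(dvdn_leq s0); rewrite leqNgt sp.
have As0 : (0 < A - s)%N by rewrite subn_gt0.
apply/eqP; rewrite eqn_leq; apply/andP; split.
  rewrite -pfactor_dvdn // -D; first by rewrite pfactor_dvdn.
  rewrite leqNgt; apply/negP => lt; move: nw; rewrite -D // pfactor_dvdn //.
  by rewrite (ltnW lt).
rewrite -pfactor_dvdn // D; first by rewrite pfactor_dvdn.
rewrite leqNgt; apply/negP => lt; move: nw; rewrite pfactor_dvdn //.
by rewrite (ltnW lt).
Qed.

(** In the quotient of falling factorials the i-th factors above and below are A - (a+i) and p^w -
    (a+i); both have the valuation of a+i. *)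
Lemma ndvd_bin_pfactor p w A a : prime p -> (p ^ w %| A)%N -> (0 < a <= p ^ w)%N ->
  (p ^ w <= A)%N -> ~~ (p %| 'C(A - a, p ^ w - a))%N.
Proof.
move=> pp pA /andP[a0 aw] wA; set k := (p ^ w - a)%N.
have kA : (k <= A - a)%N by apply: leq_sub2r.
have C0 : (0 < 'C(A - a, k))%N by rewrite bin_gt0.
have /and3P[_ _ /eqP e] : [&& (0 < (A - a) ^_ k)%N, (0 < k ^_ k)%N &
     logn p ((A - a) ^_ k) == logn p (k ^_ k)].
  rewrite !ffact_prod; elim/big_ind2: _ => [|x y x' y'|i _].
  - by rewrite eqxx.
  - move=> /and3P[x0 y0 /eqP e] /and3P[x0' y0' /eqP e'].
    by rewrite !muln_gt0 x0 y0 x0' y0' !lognM // e e' eqxx.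
  have ik := ltn_ord i; have kA' : (i < A - a)%N by apply: leq_trans ik kA.
  rewrite !subn_gt0 ik kA' /= {1 2}/k -!subnDA.
  have s1 : (0 < a + i)%N by rewrite addn_gt0 a0.
  have s2 : (a + i < p ^ w)%N by rewrite -ltn_subRL.
  have s12 : (0 < a + i < p ^ w)%N by rewrite s1 s2.
  have s3 : (a + i < A)%N by apply: leq_trans wA.
  by rewrite (logn_sub_pfactor pp pA s12 s3) (logn_sub_pfactor pp (dvdnn _) s12 s2).
move: e; rewrite -bin_ffact ffactnn lognM // ?fact_gt0 //.
rewrite -[X in _ = X]add0n => /addIn /eqP; apply: contraTN => pC.
by rewrite -lt0n -pfactor_dvdn.
Qed.

(** With u the valuation of m, the identity m C(m-1, p^u - 1) = p^u C(m, p^u) has the same power of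
    p in front on both sides, which reduces the claim to the previous lemma. *)
Lemma ndvd_bin_logn p m : prime p -> (0 < m)%N ->
  ~~ (p %| 'C(m, p ^ logn p m))%N.
Proof.
move=> pp m0; set u := logn p m.
have pm : (p ^ u %| m)%N by apply: pfactor_dvdnn.
have um : (p ^ u <= m)%N by apply: dvdn_leq.
have pu0 : (0 < p ^ u)%N by rewrite expn_gt0 prime_gt0.
have nd : ~~ (p %| 'C(m - 1, p ^ u - 1))%N by apply: ndvd_bin_pfactor; rewrite ?pu0.
have e := mul_bin_diag m (p ^ u).-1; rewrite prednK // in e.
move: nd; rewrite !subn1; apply: contra => pC.
have : (p ^ u.+1 %| m * 'C(m.-1, (p ^ u).-1))%N.
  by rewrite e expnS mulnC dvdn_mul.
have C0 : (0 < 'C(m.-1, (p ^ u).-1))%N by rewrite bin_gt0 -ltnS !prednK.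
rewrite pfactor_dvdn ?muln_gt0 ?m0 // lognM // -/u -addn1 leq_add2l => h.
by rewrite -[p]expn1 pfactor_dvdn.
Qed.

Lemma mul_bin_sub N m i : (i <= m <= N)%N ->
  ('C(m, i) * 'C(N, m) = 'C(N, i) * 'C(N - i, m - i))%N.
Proof.
move=> /andP[im mN]; have iN := leq_trans im mN.
have f0 : (0 < i`! * (m - i)`! * (N - m)`!)%N by rewrite !muln_gt0 !fact_gt0.
apply/eqP; rewrite -(eqn_pmul2r f0); apply/eqP.
have e1 := bin_fact im; have e2 := bin_fact mN; have e3 := bin_fact iN.
have e4 := bin_fact (leq_sub2r i mN).
have e5 : (N - i - (m - i) = N - m)%N by rewrite subnBA // subnK.
rewrite e5 in e4.
transitivity N`!; rewrite ?[RHS]/=.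
  by rewrite -e2 -e1; ring.
by rewrite -e3 -e4; ring.
Qed.

Section Cocycle.
Variables (K : lmodType rat) (I : K -> Prop).
Hypotheses (I0 : I 0) (IB : forall a b, I a -> I b -> I (a - b)).
Variables (N : nat) (D : nat -> K).
Hypothesis Dsym : forall m, (0 < m < N)%N -> D m = D (N - m).
Hypothesis Drel : forall i m, (0 < i)%N -> (i < m)%N -> (m < N)%N ->
  I (D m *+ 'C(m, i) - D i *+ 'C(N - i, m - i)).

Let IN a : I a -> I (- a). Proof. by move=> h; rewrite -sub0r; apply: IB. Qed.
Let ID a b : I a -> I b -> I (a + b).
Proof. by move=> ha hb; rewrite -[b]opprK; apply/IB/IN. Qed.
Let IMn a k : I a -> I (a *+ k).
Proof. by move=> ha; elim: k => // k IH; rewrite mulrS; apply: ID. Qed.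

(** If [I] were 0, the relations [Drel] would say that b is constant on 0 < i < N. Modulo a subgroup
    they only control multiples of the differences. *)
Let b i : K := ('C(N, i))%:R^-1 *: D i.
Let bE i : (i <= N)%N -> b i *+ 'C(N, i) = D i.
Proof.
move=> iN; rewrite -scaler_nat scalerA mulfV ?scale1r //.
by rewrite Num.Theory.pnatr_eq0 -lt0n bin_gt0.
Qed.

(** Membership in the localisation of [I] at p. *)
Let loc p x := exists2 q, ~~ (p %| q)%N & I (x *+ q).

Lemma locB p x y : prime p -> loc p x -> loc p y -> loc p (x - y).
Proof.
move=> pp [q pq Ix] [r pr Iy]; exists (q * r)%N.
  by rewrite Euclid_dvdM // negb_or pq.
by rewrite mulrnBl; apply: IB; [|rewrite mulnC]; rewrite mulrnA; apply: IMn.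
Qed.
Lemma locMn p x k : loc p x -> loc p (x *+ k).
Proof. by move=> [q pq Ix]; exists q => //; rewrite mulrnAC; apply: IMn. Qed.
Lemma locMnV p x k : prime p -> ~~ (p %| k)%N -> loc p (x *+ k) -> loc p x.
Proof.
move=> pp pk [q pq Ix]; exists (k * q)%N; last by rewrite mulrnA.
by rewrite Euclid_dvdM // negb_or pk.
Qed.
Lemma loc0 p : prime p -> loc p 0.
Proof. by move=> pp; exists 1%N; rewrite ?mul0rn // dvdn1 neq_ltn prime_gt1 // orbT. Qed.

Lemma rel_b i m : (0 < i)%N -> (i < m)%N -> (m < N)%N ->
  I ((b m - b i) *+ ('C(m, i) * 'C(N, m))).
Proof.
move=> i0 im mN; have := Drel i0 im mN.
have iN : (i <= N)%N by apply: leq_trans (ltnW im) (ltnW mN).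
have h : (i <= m <= N)%N by rewrite (ltnW im) (ltnW mN).
by rewrite -(bE (ltnW mN)) -(bE iN) -!mulrnA -(mul_bin_sub h) mulnC -mulrnBl.
Qed.

Lemma b_sym m : (0 < m < N)%N -> b (N - m) = b m.
Proof. by move=> h; case/andP: (h) => _ /ltnW mN; rewrite /b -Dsym // bin_sub. Qed.

Section Prime.
Variable (p : nat).
Hypothesis pp : prime p.
Hypothesis N2 : (1 < N)%N.

(** The reference index p^w has to lie strictly below N, so w is the valuation v of N, or v - 1 when
    N = p^v. By the last clause an m of larger valuation can be traded for N - m. *)
Lemma wexists : exists w, [/\ (p ^ w %| N)%N, (p ^ w < N)%N &
   forall m, (0 < m < N)%N -> (w < logn p m)%N -> ~~ (p ^ w.+1 %| N)%N].
Proof.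
have N0 : (0 < N)%N by apply: ltnW.
set v := logn p N; have pN : (p ^ v %| N)%N by apply: pfactor_dvdnn.
have := dvdn_leq N0 pN; rewrite leq_eqVlt => /orP[/eqP e|lt]; last first.
  exists v; split=> // m _ _; rewrite pfactor_dvdn // ltnn //.
have v0 : (0 < v)%N by case: (v) e => // e; move: N2; rewrite -e.
exists v.-1; split.
- by apply: dvdn_trans pN; apply: dvdn_exp2l; apply: leq_pred.
- by rewrite -e ltn_exp2l ?prime_gt1 // prednK.
move=> m /andP[m0 mN]; rewrite prednK // => h.
have : (p ^ v %| m)%N by rewrite pfactor_dvdn.
by move/(dvdn_leq m0); rewrite e leqNgt mN.
Qed.

(** Take b0 = b(p^w) and compare b(m) and b(p^w) with b(p^u), where u is the valuation of m. The
    binomials C(m, p^u) and C(N - p^u, p^w - p^u) that intervene are prime to p. If u > w, the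
    symmetry of D replaces m by N - m. *)
Lemma loc_all : exists b0, forall m, (0 < m < N)%N -> loc p ((b m - b0) *+ 'C(N, m)).
Proof.
have [w [wN wlt wmax]] := wexists.
have ppos u : (0 < p ^ u)%N by rewrite expn_gt0 prime_gt0.
have C1 m : (0 < m < N)%N -> (logn p m <= w)%N ->
    loc p ((b m - b (p ^ w)) *+ 'C(N, m)).
  move=> /andP[m0 mN] uw; set u := logn p m in uw *.
  have pm : (p ^ u %| m)%N by apply: pfactor_dvdnn.
  have um : (p ^ u <= m)%N by apply: dvdn_leq.
  have nC : ~~ (p %| 'C(m, p ^ u))%N by apply: ndvd_bin_logn.
  have s1 : loc p ((b m - b (p ^ u)) *+ 'C(N, m)).
    move: um; rewrite leq_eqVlt => /orP[/eqP ->|lt].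
      by rewrite subrr mul0rn; apply: loc0.
    exists 'C(m, p ^ u) => //; rewrite -mulrnA mulnC; exact: rel_b.
  have s2 : loc p ((b (p ^ w) - b (p ^ u)) *+ 'C(N, m)).
    move: uw; rewrite leq_eqVlt => /orP[/eqP ->|lt].
      by rewrite subrr mul0rn; apply: loc0.
    have lt' : (p ^ u < p ^ w)%N by rewrite ltn_exp2l ?prime_gt1.
    apply: (locMnV pp nC); rewrite -mulrnA mulnC mul_bin_sub ?um ?(ltnW mN) //.
    rewrite mulrnA; apply: locMn.
    exists 'C(N - p ^ u, p ^ w - p ^ u).
      by apply: ndvd_bin_pfactor; rewrite ?ppos ?(ltnW lt') ?(ltnW wlt).
    by rewrite -mulrnA -mul_bin_sub ?(ltnW lt') ?(ltnW wlt) //; apply: rel_b.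
  have -> : (b m - b (p ^ w)) *+ 'C(N, m) = (b m - b (p ^ u)) *+ 'C(N, m) -
     (b (p ^ w) - b (p ^ u)) *+ 'C(N, m).
    by rewrite -mulrnBl opprB addrA subrK.
  exact: locB.
exists (b (p ^ w)) => m mN; case: (leqP (logn p m) w) => [|lt]; first exact: C1.
have /andP[m0 mN'] := mN.
have h : (0 < N - m < N)%N by rewrite subn_gt0 mN' ltn_subrL m0 (ltn_trans m0).
rewrite -b_sym // -bin_sub ?(ltnW mN') //; apply: C1 => //.
rewrite leqNgt -pfactor_dvdn; last by case/andP: h.
- rewrite dvdn_subl ?(ltnW mN') //; first exact: wmax mN lt.
  by rewrite pfactor_dvdn.
by [].
Qed.

Let J q := exists b0, forall m, (0 < m < N)%N -> I (D m *+ q - b0 *+ 'C(N, m)).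

Lemma J_prime : exists2 q, ~~ (p %| q)%N & J q.
Proof.
have [b0 hb] := loc_all.
have [|Q hQ] := @choice nat nat (fun m q => (0 < m < N)%N ->
   ~~ (p %| q)%N /\ I ((b m - b0) *+ 'C(N, m) *+ q)).
  move=> m; case: (boolP (0 < m < N)%N) => [/hb[q pq Iq]|_]; last by exists 0%N.
  by exists q.
(* One multiplier prime to p that serves all m at once. *)
exists (\prod_(m < N | (0 < m)%N) Q m)%N.
  elim/big_ind: _ => [|x y px py|m m0].
  - by rewrite dvdn1 neq_ltn prime_gt1 // orbT.
  - by rewrite Euclid_dvdM // negb_or px.
  by case: (hQ m) => //; rewrite m0 /=.
set q := (\prod_(_ < _ | _) _)%N; exists (b0 *+ q) => m mN.
have /andP[m0 mN'] := mN.
have -> : D m *+ q - b0 *+ q *+ 'C(N, m) = (b m - b0) *+ 'C(N, m) *+ q.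
  by rewrite -(bE (ltnW mN')) !mulrnBl [b0 *+ q *+ _]mulrnAC.
have [_ h] := hQ m mN.
rewrite /q (bigD1 (Ordinal mN')) //= mulrnA; exact: IMn.
Qed.
End Prime.

Let J q := exists b0, forall m, (0 < m < N)%N -> I (D m *+ q - b0 *+ 'C(N, m)).

(* [J] is an ideal of Z that is contained in no maximal ideal. *)
Lemma cocycle : exists b0, forall m, (0 < m < N)%N -> I (D m - b0 *+ 'C(N, m)).
Proof.
have [N2|Nle] := ltnP 1 N; last first.
  exists 0 => m /andP[m0 mN]; by move: (leq_trans mN Nle); rewrite ltnS leqNgt m0.
have JB q r k l : J q -> J r -> (r * l <= q * k)%N -> J (q * k - r * l).
  move=> [x hx] [y hy] le; exists (x *+ k - y *+ l) => m mN.
  have -> : D m *+ (q * k - r * l) - (x *+ k - y *+ l) *+ 'C(N, m) =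
     (D m *+ q - x *+ 'C(N, m)) *+ k - (D m *+ r - y *+ 'C(N, m)) *+ l.
    rewrite mulrnBr // !mulrnBl !mulrnA.
    rewrite [x *+ k *+ _]mulrnAC [y *+ l *+ _]mulrnAC !opprB.
    by rewrite -!addrA; congr (_ + _); rewrite addrCA [RHS]addrCA; congr (_ + _); rewrite addrC.
  by apply: IB; apply: IMn; [apply: hx|apply: hy].
suff [b0 h] : J 1%N by exists b0 => m /h; rewrite mulr1n.
have [q q0 Jq] : exists2 q, (0 < q)%N & J q.
  have [q pq Jq] := @J_prime 2 isT N2; exists q => //.
  by case: q pq {Jq} => //; rewrite dvdn0.
have [k] := ubnP q; elim: k q q0 Jq => // k IH q q0 Jq; rewrite ltnS => qk.
have [q1|q1] := eqVneq q 1%N; first by rewrite -q1.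
have qgt : (1 < q)%N by rewrite ltn_neqAle eq_sym q1.
(* A prime p dividing q does not divide r, so the gcd of q and r is a strictly smaller member of
   J. *)
have pp := pdiv_prime qgt; have [r pr Jr] := J_prime pp N2.
have lt : (gcdn q r < q)%N.
  rewrite ltn_neqAle dvdn_leq ?dvdn_gcdl // andbT; apply: contraNneq pr => e.
  by apply: dvdn_trans (pdiv_dvd q) _; rewrite -e dvdn_gcdr.
apply: (IH (gcdn q r)); last exact: leq_trans lt qk.
  by rewrite gcdn_gt0 q0.
case: (egcdnP r q0) => kq kr e _.
have -> : gcdn q r = (q * kq - r * kr)%N by rewrite [(q * kq)%N]mulnC [(r * kr)%N]mulnC e addKn.
by apply: JB => //; rewrite [(q * kq)%N]mulnC [(r * kr)%N]mulnC e leq_addr.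
Qed.

End Cocycle.

(** * Lifting a formal group law *)

Section MapMps.
Variables (R S : comNzRingType) (phi : {rmorphism R -> S}).

Lemma map_mpsM n (f g : mps n R) : map_mps phi (f * g) = map_mps phi f * map_mps phi g.
Proof.
apply: mpsP => m; rewrite [LHS]/=.
transitivity (phi (mps_mul f g m)) => //.
rewrite /mps_mul /= rmorph_sum; apply: eq_bigr => k _; exact: rmorphM.
Qed.
Lemma map_mpsC n (c : R) : map_mps phi (mps_const n c) = mps_const n (phi c).
Proof. by apply: mpsP => m /=; case: ifP; rewrite ?rmorph0. Qed.
Lemma map_mps1 n : map_mps phi (1 : mps n R) = 1.
Proof. by rewrite [LHS]map_mpsC rmorph1. Qed.
Lemma map_mps0 n : map_mps phi (0 : mps n R) = 0.
Proof. by rewrite [LHS]map_mpsC rmorph0. Qed.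
Lemma map_mpsX n (i : 'I_n) : map_mps phi (psX R i) = psX S i.
Proof. by apply: mpsP => m /=; case: ifP; rewrite ?rmorph0 ?rmorph1. Qed.
Lemma map_mps_prod n (I : Type) (r : seq I) (P : pred I) (G : I -> mps n R) :
  map_mps phi (\prod_(i <- r | P i) G i) = \prod_(i <- r | P i) map_mps phi (G i).
Proof. exact: (big_morph _ (@map_mpsM n) (@map_mps1 n)). Qed.
Lemma map_mpsXn n (f : mps n R) k : map_mps phi (f ^+ k) = map_mps phi f ^+ k.
Proof. by elim: k => [|k IH]; rewrite ?expr0 ?map_mps1 // !exprS map_mpsM IH. Qed.

Lemma map_psubst n p (f : mps n R) (g : 'I_n -> mps p R) :
  map_mps phi (psubst f g) = psubst (map_mps phi f) (fun i => map_mps phi (g i)).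
Proof.
apply: mpsP => m; transitivity (phi (psubst f g m)) => //.
rewrite !psubst_coef rmorph_sum.
apply: eq_bigr => a _; rewrite rmorphM; congr (_ * _).
rewrite /mmap1 -[LHS]/(map_mps phi _ m) map_mps_prod; congr (mps_coef _ m).
by apply: eq_bigr => i _; rewrite map_mpsXn.
Qed.

Lemma map_fgl_add n (F : mps 2 R) (a b : mps n R) :
  map_mps phi (fgl_add F a b) = fgl_add (map_mps phi F) (map_mps phi a) (map_mps phi b).
Proof. by rewrite [LHS]map_psubst; apply: psubst_ext => k; case: ifP. Qed.

Lemma is_fgl_inj (F : mps 2 R) : injective phi -> is_fgl (map_mps phi F) -> is_fgl F.
Proof.
move=> inj.
have minj n (f g : mps n R) : map_mps phi f = map_mps phi g -> f = g.
  move=> e; apply: mpsP => m; apply: inj; exact: (congr1 (fun h : mps n S => h m) e).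
by case=> -[h1 h2] h3 h4; split; [split|..]; apply: minj;
  rewrite !map_fgl_add !map_mpsX ?map_mps0.
Qed.
End MapMps.

Section Close.
Variables (R : comNzRingType).

Lemma fgl_add_approx n d (f f' : mps 2 R) (a b a' b' : mps n R) :
  ord_ge d (f - f') -> ord_ge 1 f' -> ord_ge 1 a -> ord_ge 1 b ->
  ord_ge 1 a' -> ord_ge 1 b' -> ord_ge d (a - a') -> ord_ge d (b - b') ->
  ord_ge d (fgl_add f a b - fgl_add f' a' b').
Proof.
move=> hf f1 a1 b1 a1' b1' ha hb.
have -> : fgl_add f a b - fgl_add f' a' b' =
   psubst (f - f') (ppair a b) + (psubst f' (ppair a b) - psubst f' (ppair a' b')).
  by rewrite psubstB !fgl_addE addrA subrK.
apply: ord_geD; first by apply: psubst_ord hf; apply: nilf_ppair.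
case: d ha hb {hf} => [|d] ha hb; first by [].
rewrite -addn1; apply: psubst_close f1; try exact: nilf_ppair.
exact: ppair_close.
Qed.

Lemma ord1_approx n (f f' : mps n R) : ord_ge 1 (f - f') -> ord_ge 1 f' -> ord_ge 1 f.
Proof. by move=> h h'; rewrite -(subrK f' f); apply: ord_geD. Qed.

Lemma ord_fgl_add n (f : mps 2 R) (a b : mps n R) :
  ord_ge 1 f -> ord_ge 1 a -> ord_ge 1 b -> ord_ge 1 (fgl_add f a b).
Proof. by move=> f1 a1 b1; apply: psubst_ord => //; apply: nilf_ppair. Qed.

Lemma ord1_fgl (F : mps 2 R) : fgl_unit F -> ord_ge 1 F.
Proof.
move=> HU; rewrite (fgl_restE HU) -mulrA; apply: ord_geD; last exact: ord_geMr.
exact: ord_geD.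
Qed.

(** Each axiom equates expressions that depend continuously on F, so the axioms pass to limits. *)
Lemma is_fgl_limit (F : mps 2 R) :
  (forall d, exists2 F', is_fgl F' & ord_ge d (F - F')) -> is_fgl F.
Proof.
move=> h.
have F1 : ord_ge 1 F.
  have [F' HF' d1] := h 1%N; apply: ord1_approx d1 _; exact/ord1_fgl/fgl_unitP.
have S0 n d : ord_ge d ((0 : mps n R) - 0) by rewrite subrr.
have SX n d (i : 'I_n) : ord_ge d (psX R i - psX R i) by rewrite subrr.
have Z1 : ord_ge 1 (0 : mps 1 R) by [].
split; [split|..]; apply: ord_ge_eq => d; have [F' HF' dd] := h d;
  have F1' := ord1_fgl (fgl_unitP HF').
- set u := psX R ord0; have u1 : ord_ge 1 u by apply: ord_psX.
  have := fgl_add_approx dd F1' u1 Z1 u1 Z1 (SX _ _ _) (S0 _ _).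
  by rewrite (faddr0 (fgl_unitP HF')).
- set u := psX R ord0; have u1 : ord_ge 1 u by apply: ord_psX.
  have := fgl_add_approx dd F1' Z1 u1 Z1 u1 (S0 _ _) (SX _ _ _).
  by rewrite (fadd0r (fgl_unitP HF')).
- set u := psX R (inord 0); set v := psX R (inord 1).
  have [u1 v1] : ord_ge 1 u /\ ord_ge 1 v by split; apply: ord_psX.
  have e1 := fgl_add_approx dd F1' u1 v1 u1 v1 (SX _ _ _) (SX _ _ _).
  have e2 := fgl_add_approx dd F1' v1 u1 v1 u1 (SX _ _ _) (SX _ _ _).
  by have := ord_geB e1 e2; rewrite (faddC HF' v1 u1) opprB addrA subrK.
set u := psX R (inord 0); set v := psX R (inord 1); set w := psX R (inord 2).
have [u1 v1 w1] : [/\ ord_ge 1 u, ord_ge 1 v & ord_ge 1 w] by split; apply: ord_psX.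
have o1 := ord_fgl_add F1 u1 v1; have o2 := ord_fgl_add F1 v1 w1.
have o1' := ord_fgl_add F1' u1 v1; have o2' := ord_fgl_add F1' v1 w1.
have e1 := fgl_add_approx dd F1' u1 v1 u1 v1 (SX _ _ _) (SX _ _ _).
have e2 := fgl_add_approx dd F1' v1 w1 v1 w1 (SX _ _ _) (SX _ _ _).
have e3 := fgl_add_approx dd F1' o1 w1 o1' w1 e1 (SX _ _ _).
have e4 := fgl_add_approx dd F1' u1 o2 u1 o2' (SX _ _ _) e2.
by have := ord_geB e3 e4; rewrite (faddA HF') // opprB addrA subrK.
Qed.
End Close.

(** * Change of coordinate in a formal group law *)

Section Conj.
Variables (R : comNzRingType).
Let x : mps 1 R := psX R ord0.
Let x1 : ord_ge 1 x. Proof. exact: ord_psX. Qed.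
Definition ap n (f : mps 1 R) (a : mps n R) := psubst f (fun=> a).

Let nil1 n (a : mps n R) : ord_ge 1 a -> nilf (fun _ : 'I_1 => a).
Proof. by move=> a1 i. Qed.

Lemma ap_comp n (f g : mps 1 R) (a : mps n R) : ord_ge 1 g -> ord_ge 1 a ->
  ap (ap f g) a = ap f (ap g a).
Proof. by move=> g1 a1; rewrite /ap psubst_comp. Qed.
Lemma ap_x n (a : mps n R) : ord_ge 1 a -> ap x a = a.
Proof. by move=> a1; rewrite /ap psubstX. Qed.
Lemma ap_id (f : mps 1 R) : ap f x = f.
Proof. by rewrite -[RHS]psubst_id; apply: psubst_ext => i; rewrite (ord1 i). Qed.
Lemma ord_ap n d (f : mps 1 R) (a : mps n R) : ord_ge d f -> ord_ge 1 a -> ord_ge d (ap f a).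
Proof. by move=> f1 a1; apply: psubst_ord. Qed.

(** A right inverse solves th = x - rho(th), a contraction because rho has order at least 2. It is
    also a left inverse: th has a right inverse th' in turn, and associativity of composition gives
    x + rho = th'. *)
Lemma comp_inverse d rho : ord_ge d.+2 rho -> exists2 th, ord_ge 1 th &
  [/\ ap (x + rho) th = x, ap th (x + rho) = x & ord_ge d.+3 (th - (x - rho))].
Proof.
have right e r : ord_ge e.+2 r -> exists2 th, ord_ge 1 th &
    ap (x + r) th = x /\ ord_ge e.+3 (th - (x - r)).
  move=> hr; pose Phi y := x - ap r y.
  have close k y y' : ord_ge 1 y -> ord_ge 1 y' -> ord_ge k.+1 (y - y') ->
      ord_ge (k + e.+2) (ap r y - ap r y').
    by move=> y1 y1' yy; apply: psubst_close hr => //; apply: nil1.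
  have r1 : ord_ge 1 r by apply: ord_geW hr.
  have [| |th th1 thE] := @ps_fixpoint 1 R Phi.
  - by move=> y y1; apply: ord_geB => //; apply: ord_ap.
  - move=> k y y' y1 y1' yy.
    have -> : Phi y - Phi y' = - (ap r y - ap r y') by rewrite /Phi; ring.
    case: k yy => [|k] yy.
      by apply: ord_geN; apply: ord_geB; apply: ord_ap.
    apply: ord_geN; apply: ord_geW (close _ _ _ _ y1 y1' yy).
    by rewrite !addnS !ltnS leq_addr.
  exists th => //.
  have e1 : ap (x + r) th = x by rewrite /ap psubstD psubstX // -{1}thE /Phi subrK.
  split=> //; rewrite -{1}thE /Phi.
  have -> : x - ap r th - (x - r) = - (ap r th - ap r x) by rewrite ap_id; ring.
  apply: ord_geN; rewrite -[e.+3]add1n; apply: close => //.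
  have -> : th - x = - ap r th by rewrite -{1}thE /Phi; ring.
  by apply: ord_geN; apply: (ord_geW (d := e.+2)) => //; apply: psubst_ord => //; apply: nil1.
move=> hr; have [th th1 [e1 e2]] := right d rho hr.
have hr1 : ord_ge 1 (x + rho).
  by apply: ord_geD => //; apply: ord_geW hr.
have h2 : ord_ge d.+2 (th - x).
  have -> : th - x = (th - (x - rho)) - rho by ring.
  by apply: ord_geB => //; apply: ord_geW e2.
have [th' th1' [e1' _]] := right d _ h2.
have ee : x + (th - x) = th by ring.
exists th => //; split => //.
have -> : x + rho = th'; last by rewrite ee in e1'.
rewrite ee in e1'.
transitivity (ap (x + rho) (ap th th')); first by rewrite e1' ap_id.
by rewrite -ap_comp // e1 ap_x.
Qed.
End Conj.

Definition mk2 (i j : nat) : 'X_{1..2} := [multinom if k == ord0 then i else j | k < 2].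
Definition mk3 (i j l : nat) : 'X_{1..3} :=
  [multinom if val k == 0%N then i else if val k == 1%N then j else l | k < 3].

Notation i1of2 := (lift ord0 ord0 : 'I_2).

Lemma mk2E i j : (mk2 i j ord0 = i) * (mk2 i j i1of2 = j).
Proof. by rewrite !mnmE. Qed.
Lemma mk2_surj (m : 'X_{1..2}) : m = mk2 (m ord0) (m i1of2).
Proof.
apply/mnmP => k; rewrite mnmE; case: (unliftP ord0 k) => [l ->|->] //=.
by rewrite (ord1 l).
Qed.
Lemma mdeg_mk2 i j : mdeg (mk2 i j) = (i + j)%N.
Proof. by rewrite mdegE !big_ord_recl big_ord0 !mnmE addn0. Qed.
Lemma mmap1_mk2 (S : comNzRingType) (g : 'I_2 -> S) i j :
  mmap1 g (mk2 i j) = g ord0 ^+ i * g i1of2 ^+ j.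
Proof. by rewrite /mmap1 !big_ord_recl big_ord0 !mnmE mulr1. Qed.
Lemma mk2_eq i j i' j' : (mk2 i j == mk2 i' j') = (i == i') && (j == j').
Proof.
apply/eqP/andP => [e|[/eqP -> /eqP ->] //].
have [a b] := mk2E i j; have [a' b'] := mk2E i' j'.
have ei : i = i' by rewrite -[LHS]a e.
have ej : j = j' by rewrite -[LHS]b e.
by rewrite ei ej !eqxx.
Qed.

Notation i1of3 := (lift ord0 ord0 : 'I_3).
Notation i2of3 := (lift ord0 (lift ord0 ord0) : 'I_3).
Lemma mk3E i j l : (mk3 i j l ord0 = i) * (mk3 i j l i1of3 = j) * (mk3 i j l i2of3 = l).
Proof. by rewrite !mnmE. Qed.
Lemma mdeg_mk3 i j l : mdeg (mk3 i j l) = (i + j + l)%N.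
Proof. by rewrite mdegE !big_ord_recl big_ord0 !mnmE addn0 addnA. Qed.
Lemma mmap1_mk3 (S : comNzRingType) (g : 'I_3 -> S) i j l :
  mmap1 g (mk3 i j l) = g ord0 ^+ i * g i1of3 ^+ j * g i2of3 ^+ l.
Proof. by rewrite /mmap1 !big_ord_recl big_ord0 !mnmE mulr1 mulrA. Qed.
Lemma mk3_eq i j l i' j' l' :
  (mk3 i j l == mk3 i' j' l') = [&& i == i', j == j' & l == l'].
Proof.
apply/eqP/and3P => [e|[/eqP -> /eqP -> /eqP ->] //].
have [[a b] c] := mk3E i j l; have [[a' b'] c'] := mk3E i' j' l'.
have ei : i = i' by rewrite -[LHS]a e.
have ej : j = j' by rewrite -[LHS]b e.
have el : l = l' by rewrite -[LHS]c e.
by rewrite ei ej el !eqxx.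
Qed.

(** Associativity of g(f a + f b), stripped of power series so that only the cancellation f(g a) = a
    is visible. *)
Lemma transport_assoc (T : Type) (P : T -> Prop) (add : T -> T -> T) (f g : T -> T) :
    (forall a, P a -> P (f a)) -> (forall a b, P a -> P b -> P (add a b)) ->
    (forall a b c, P a -> P b -> P c -> add (add a b) c = add a (add b c)) ->
    (forall a, P a -> f (g a) = a) ->
  forall a b c, P a -> P b -> P c ->
  g (add (f (g (add (f a) (f b)))) (f c)) = g (add (f a) (f (g (add (f b) (f c))))).
Proof. by move=> hf hadd hA fg a b c Pa Pb Pc; rewrite !fg ?hA; auto. Qed.

Section Conj.
Variables (R : comNzRingType).
Let X0 : mps 2 R := psX R ord0.
Let X1 : mps 2 R := psX R i1of2.

Lemma binom_coef2 N i : (i <= N)%N -> ((X0 + X1) ^+ N) (mk2 i (N - i)) = ('C(N, i))%:R.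
Proof.
move=> iN; have h : (N - i < N.+1)%N by rewrite ltnS leq_subr.
rewrite exprDn mps_sumE (bigD1 (Ordinal h)) //= big1 => [|t ne].
  by rewrite addr0 mpsMnE -mmap1_mk2 mmap1_psX_coef subKn // eqxx bin_sub.
rewrite mpsMnE -mmap1_mk2 mmap1_psX_coef mk2_eq andbC.
case: eqP => [e|]; last by rewrite mul0rn.
by case/eqP: ne; apply: val_inj.
Qed.

Lemma pow_coef2 (k : 'I_2) N i : (0 < i < N)%N -> (psX R k ^+ N) (mk2 i (N - i)) = 0.
Proof.
move=> /andP[i0 iN].
have ne1 : (0 == i)%N = false by case: i i0 {iN}.
have ne2 : (0 == N - i)%N = false by rewrite eq_sym subn_eq0 leqNgt iN.
case: (unliftP ord0 k) => [l ->|->]; first rewrite (ord1 l) -[_ ^+ _]mul1r -(expr0 X0).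
  by rewrite -mmap1_mk2 mmap1_psX_coef mk2_eq ne1.
by rewrite -[_ ^+ _]mulr1 -(expr0 X1) -mmap1_mk2 mmap1_psX_coef mk2_eq ne2 andbF.
Qed.

(** With N = d+2, take G'(x,y) = psi^-1(G(psi x, psi y)) for psi = x + c x^N. Modulo order N+1 the
    inner substitution adds c(x^N + y^N), and psi^-1 = x - c x^N subtracts c(x+y)^N. *)
Lemma conj_fgl (G : mps 2 R) d (c : R) : is_fgl G -> exists2 G', is_fgl G' &
  ord_ge d.+3 (G' - G - mps_const 2 c * (X0 ^+ d.+2 + X1 ^+ d.+2 - (X0 + X1) ^+ d.+2)).
Proof.
move=> HG; have HU := fgl_unitP HG.
pose x := psX R (ord0 : 'I_1); have x1 : ord_ge 1 x by apply: ord_psX.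
pose rho := mps_const 1 c * x ^+ d.+2.
have hr : ord_ge d.+2 rho.
  by apply: ord_geMl; apply: ord_geX.
have [th th1 [e1 e2 e3]] := comp_inverse hr.
have [psi psiE] : exists psi, psi = psX R ord0 + rho by exists (psX R ord0 + rho).
rewrite -psiE in e1 e2.
have psi1 : ord_ge 1 psi by rewrite psiE; apply: ord_geD => //; apply: ord_geW hr.
have [o0 o1] : ord_ge 1 X0 /\ ord_ge 1 X1 by split; apply: ord_psX.
have p0 := ord_ap psi1 o0; have p1 := ord_ap psi1 o1.
have [g gE] : exists g, g = fgl_add G (ap psi X0) (ap psi X1) by eexists.
have g1 : ord_ge 1 g by rewrite gE; apply: ord_fadd.
have [G' G'def] : exists G', G' = ap th g by exists (ap th g).
have G'E n (a b : mps n R) : ord_ge 1 a -> ord_ge 1 b ->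
    fgl_add G' a b = ap th (fgl_add G (ap psi a) (ap psi b)).
  move=> a1 b1; have z := nilf_ppair a1 b1.
  rewrite fgl_addE G'def gE /ap psubst_comp //; last by move=> _; rewrite -gE.
  apply: psubst_ext => _.
  rewrite fgl_add_subst //.
  have apE (f : mps 1 R) y : ord_ge 1 y -> psubst (ap f y) (ppair a b) = ap f (psubst y (ppair a b)).
    by move=> y1; rewrite /ap psubst_comp.
  by rewrite !apE // !psubstX.
have thpsi n (a : mps n R) : ord_ge 1 a -> ap th (ap psi a) = a.
  by move=> a1; rewrite -ap_comp // e2 ap_x.
have psith n (a : mps n R) : ord_ge 1 a -> ap psi (ap th a) = a.
  by move=> a1; rewrite -ap_comp // e1 ap_x.
have oth n (a : mps n R) (a1 : ord_ge 1 a) := ord_ap psi1 a1.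
have oadd n (a b : mps n R) (a1 : ord_ge 1 a) (b1 : ord_ge 1 b) := ord_fadd HU (oth _ _ a1) (oth _ _ b1).
have ap0 : ap psi (0 : mps 1 R) = 0.
  rewrite /ap psubst0; have /ord_ge1P -> := psi1; exact: rmorph0.
exists G'.
  split.
  - move=> u; have u1 : ord_ge 1 u by apply: ord_psX.
    have z1 : ord_ge 1 (0 : mps 1 R) by [].
    by split; rewrite G'E // ap0 ?faddr0 ?fadd0r ?thpsi //; apply: oth.
  - move=> u v.
    have [u1 v1] : ord_ge 1 u /\ ord_ge 1 v by split; apply: ord_psX.
    rewrite (G'E _ _ _ u1 v1) (G'E _ _ _ v1 u1); congr ap.
    exact: (faddC HG (oth _ _ u1) (oth _ _ v1)).
  move=> u v w.
  have [u1 v1 w1] : [/\ ord_ge 1 u, ord_ge 1 v & ord_ge 1 w] by split; apply: ord_psX.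
  have o1' := oadd _ _ _ u1 v1; have o2' := oadd _ _ _ v1 w1.
  have t1' := ord_ap th1 o1'; have t2' := ord_ap th1 o2'.
  rewrite (G'E _ _ _ u1 v1) (G'E _ _ _ v1 w1) (G'E _ _ _ t1' w1) (G'E _ _ _ u1 t2').
  exact: (transport_assoc (P := @ord_ge 3 R 1) (add := fgl_add G) (f := ap psi) (g := ap th)
     (@oth 3) (fun a b a1 b1 => ord_fadd HU a1 b1)
     (fun a b c a1 b1 c1 => faddA HG a1 b1 c1) (@psith 3) u1 v1 w1).
have apr n (a : mps n R) : ord_ge 1 a -> ap rho a = mps_const n c * a ^+ d.+2.
  move=> a1; have z : nilf (fun _ : 'I_1 => a) by [].
  by rewrite /ap /rho (psubstM z) (psubstC _ z) (psubstXn z) (psubstX _ z).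
have app n (a : mps n R) : ord_ge 1 a -> ap psi a = a + mps_const n c * a ^+ d.+2.
  move=> a1; have z : nilf (fun _ : 'I_1 => a) by [].
  by rewrite -(apr _ _ a1) psiE /ap psubstD (psubstX _ z).
have oa n (a : mps n R) : ord_ge 1 a -> ord_ge d.+2 (mps_const n c * a ^+ d.+2).
  by move=> a1; apply: ord_geMl; apply: ord_geX.
have hg : ord_ge d.+3 (g - G - mps_const 2 c * (X0 ^+ d.+2 + X1 ^+ d.+2)).
  have GE : fgl_add G X0 X1 = G.
    rewrite fgl_addE -[RHS]psubst_id; apply: psubst_ext => k; rewrite /ppair.
    by case: (unliftP ord0 k) => [l ->|->] //=; rewrite (ord1 l).
  have app1 := app _ _ o0; have app2 := app _ _ o1.
  have h0 : ord_ge d.+2 (ap psi X0 - X0) by rewrite app1 addrC addKr; apply: oa.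
  have h1 : ord_ge d.+2 (ap psi X1 - X1) by rewrite app2 addrC addKr; apply: oa.
  have := fadd_close HU p0 p1 o0 o1 h0 h1; rewrite GE -gE app1 app2.
  set y0 := mps_const 2 c * X0 ^+ _; set y1 := mps_const 2 c * X1 ^+ _.
  by rewrite mulrDr -/y0 -/y1 [X0 + y0]addrC [X1 + y1]addrC !addrK.
have hth : ord_ge d.+3 (G' - (g - mps_const 2 c * g ^+ d.+2)).
  have z : nilf (fun _ : 'I_1 => g) by [].
  have := psubst_ord z e3; rewrite G'def !psubstB (psubstX _ z).
  by rewrite -/(ap rho g) (apr _ _ g1).
have hpow : ord_ge d.+3 (g ^+ d.+2 - (X0 + X1) ^+ d.+2).
  have lg : ord_ge 2 (g - (X0 + X1)).
    have l1 : ord_ge 1 (g - (X0 + X1)) by apply: ord_geB => //; apply: ord_geD.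
    have lz (a : mps 2 R) : ord_ge 1 a -> low 1 (mps_const 2 c * a ^+ d.+2) = 0.
      move=> a1; have o2 : ord_ge 2 (mps_const 2 c * a ^+ d.+2) by apply: ord_geW (oa _ _ a1).
      exact/low_eq0/o2/(ord_geW (leqnSn 1) o2).
    have lpsi (a : mps 2 R) : ord_ge 1 a -> low 1 (ap psi a) = low 1 a.
      by move=> a1; rewrite (app _ _ a1) lowD (lz _ a1) addr0.
    apply/(low_eq0 l1).
    by rewrite gE lowB (low_fadd HU p0 p1) (lpsi _ o0) (lpsi _ o1) -lowD subrr.
  have z1 : nilf (fun _ : 'I_1 => g) by [].
  have z2 : nilf (fun _ : 'I_1 => X0 + X1) by move=> _; apply: ord_geD.
  have xo : ord_ge d.+2 (x ^+ d.+2) by apply: ord_geX.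
  have := psubst_close (N := 1) z1 z2 (fun=> lg) xo.
  by rewrite (psubstXn z1) (psubstXn z2) (psubstX _ z1) (psubstX _ z2).
have -> : G' - G - mps_const 2 c * (X0 ^+ d.+2 + X1 ^+ d.+2 - (X0 + X1) ^+ d.+2) =
  (G' - (g - mps_const 2 c * g ^+ d.+2)) + (g - G - mps_const 2 c * (X0 ^+ d.+2 + X1 ^+ d.+2))
  - mps_const 2 c * (g ^+ d.+2 - (X0 + X1) ^+ d.+2).
  move: (X0 ^+ _) (X1 ^+ _) ((X0 + X1) ^+ _) (g ^+ _) (mps_const 2 c) => p q s u k; ring.
by apply: ord_geB; [apply: ord_geD|apply: ord_geMl].
Qed.

End Conj.

Local Opaque psubst mps_mul.

(** * The associativity defect and its linearisation *)

Section Assoc.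
Variables (R : comNzRingType).
Let x : mps 3 R := psX R ord0.
Let y : mps 3 R := psX R i1of3.
Let z : mps 3 R := psX R i2of3.
Let x1 : ord_ge 1 x. Proof. exact: ord_psX. Qed.
Let y1 : ord_ge 1 y. Proof. exact: ord_psX. Qed.
Let z1 : ord_ge 1 z. Proof. exact: ord_psX. Qed.

Definition assoc (f : mps 2 R) : mps 3 R :=
  fgl_add f (fgl_add f x y) z - fgl_add f x (fgl_add f y z).
(** The lowest-order change of [assoc] when f is added to a formal group law; its vanishing is the
    2-cocycle condition. *)
Definition cobound (f : mps 2 R) : mps 3 R :=
  psubst f (ppair (x + y) z) + psubst f (ppair x y)
  - (psubst f (ppair x (y + z)) + psubst f (ppair y z)).

Lemma assoc_fgl F : is_fgl F -> assoc F = 0.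
Proof. by move=> HF; rewrite /assoc (faddA HF x1 y1 z1) subrr. Qed.

(** As E has order at least d+2, its arguments matter only modulo order 2, where s and t can replace
    them. *)
Lemma fgl_add_perturb n (G E : mps 2 R) d (u u' v v' s t : mps n R) :
  fgl_unit G -> ord_ge d.+2 E -> ord_ge 1 u -> ord_ge 1 u' -> ord_ge 1 v ->
  ord_ge 1 v' -> ord_ge 1 s -> ord_ge 1 t ->
  ord_ge d.+2 (u' - u) -> ord_ge d.+2 (v' - v) ->
  ord_ge 2 (u' - s) -> ord_ge 2 (v' - t) ->
  ord_ge d.+3 (fgl_add (G + E) u' v' -
     (fgl_add G u v + (u' - u) + (v' - v) + psubst E (ppair s t))).
Proof.
move=> HU oE u1 u1' v1 v1' s1 t1 hu hv hs ht.
have h1 := fadd_close HU u1' v1' u1 v1 hu hv.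
have h2 : ord_ge d.+3 (psubst E (ppair u' v') - psubst E (ppair s t)).
  apply: (psubst_close (N := 1)) oE; try exact: nilf_ppair.
  exact: ppair_close.
have -> : fgl_add (G + E) u' v' = fgl_add G u' v' + psubst E (ppair u' v').
  by rewrite !fgl_addE psubstD.
have := ord_geD h1 h2; congr ord_ge.
move: (fgl_add G u' v') (fgl_add G u v) (psubst E _) (psubst E _) => a b e e'.
ring.
Qed.

Lemma fadd_close_add n (G : mps 2 R) (a b : mps n R) : fgl_unit G ->
  ord_ge 1 a -> ord_ge 1 b -> ord_ge 2 (fgl_add G a b - (a + b)).
Proof.
move=> HU a1 b1; have l1 : ord_ge 1 (fgl_add G a b - (a + b)).
  by apply: ord_geB; [apply: ord_fadd|apply: ord_geD].
by apply/(low_eq0 l1); rewrite lowB (low_fadd HU a1 b1) lowD subrr.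
Qed.

Lemma assoc_perturb G E d : is_fgl G -> ord_ge d.+2 E ->
  ord_ge d.+3 (assoc (G + E) - cobound E).
Proof.
move=> HG oE; have HU := fgl_unitP HG.
have S0 e (a : mps 3 R) : ord_ge e (a - a) by rewrite subrr.
have oE1 : ord_ge 1 E by apply: ord_geW oE.
have side (a b : mps 3 R) : ord_ge 1 a -> ord_ge 1 b ->
   [/\ ord_ge 1 (fgl_add G a b), ord_ge 1 (fgl_add (G + E) a b),
       fgl_add (G + E) a b - fgl_add G a b = psubst E (ppair a b),
       ord_ge d.+2 (fgl_add (G + E) a b - fgl_add G a b)
     & ord_ge 2 (fgl_add (G + E) a b - (a + b))].
  move=> a1 b1; have zz := nilf_ppair a1 b1.
  have e1 : fgl_add (G + E) a b = fgl_add G a b + psubst E (ppair a b).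
    by rewrite !fgl_addE psubstD.
  have oEp := psubst_ord zz oE; have oG := ord_fadd HU a1 b1.
  rewrite e1; split=> //.
  - by apply: ord_geD => //; apply: ord_geW oEp.
  - by rewrite addrC addKr.
  - by rewrite addrC addKr.
  have -> : fgl_add G a b + psubst E (ppair a b) - (a + b) =
    (fgl_add G a b - (a + b)) + psubst E (ppair a b).
    by rewrite addrAC.
  apply: ord_geD; first exact: fadd_close_add.
  by apply: ord_geW oEp.
have xy1 := ord_geD x1 y1; have yz1 := ord_geD y1 z1.
have [u1 u1' eqU hu hs] := side _ _ x1 y1.
have [v1 v1' eqV hv ht] := side _ _ y1 z1.
have L := fgl_add_perturb HU oE u1 u1' z1 z1 xy1 z1 hu (S0 _ z) hs (S0 _ z).
have Rr := fgl_add_perturb HU oE x1 x1 v1 v1' x1 yz1 (S0 _ x) hv (S0 _ x) ht.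
rewrite eqU subrr addr0 in L; rewrite eqV subrr addr0 in Rr.
have := ord_geB L Rr; congr ord_ge; rewrite /assoc /cobound (faddA HG x1 y1 z1).
move: (fgl_add (G + E) _ z) (fgl_add (G + E) x _) (fgl_add G x _) => a b c.
move: (psubst E _) (psubst E _) (psubst E _) (psubst E _) => p q r s.
ring.
Qed.

Lemma coef3_xy p q i j l : ((x + y) ^+ p * z ^+ q) (mk3 i j l) =
  (if (p == i + j)%N && (q == l) then ('C(p, i))%:R else 0 : R).
Proof.
rewrite exprDn big_distrl mps_sumE /=.
have tE (t : 'I_p.+1) : ((x ^+ (p - t) * y ^+ t) *+ 'C(p, t) * z ^+ q) (mk3 i j l)
   = (if [&& (p - t == i)%N, val t == j & q == l] then ('C(p, t))%:R else 0 : R).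
  rewrite mulrnAl mpsMnE -mmap1_mk3 mmap1_psX_coef mk3_eq.
  by case: ifP; rewrite ?mul0rn.
rewrite (eq_bigr _ (fun t _ => tE t)); case: ifP => [/andP[/eqP pe /eqP ->]|ne].
  have h : (j < p.+1)%N by rewrite pe ltnS leq_addl.
  rewrite (bigD1 (Ordinal h)) //= big1 => [|t tn].
    by rewrite pe addnK !eqxx addr0 -(bin_sub (leq_addl i j)) addnK.
  by rewrite ifN //; apply/and3P => -[_ /eqP tj _]; case/eqP: tn; apply: val_inj.
apply: big1 => t _; rewrite ifN //; apply/and3P => -[/eqP e1 /eqP e2 /eqP e3].
move/negP: ne; apply; rewrite e3 eqxx andbT -e1 -e2 subnK //.
by rewrite -ltnS ltn_ord.
Qed.

Lemma coef3_yz p q i j l : (x ^+ p * (y + z) ^+ q) (mk3 i j l) =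
  (if (p == i) && (q == j + l)%N then ('C(q, j))%:R else 0 : R).
Proof.
rewrite exprDn big_distrr mps_sumE /=.
have tE (t : 'I_q.+1) : (x ^+ p * ((y ^+ (q - t) * z ^+ t) *+ 'C(q, t))) (mk3 i j l)
   = (if [&& p == i, (q - t == j)%N & val t == l] then ('C(q, t))%:R else 0 : R).
  rewrite mulrnAr mulrA mpsMnE -mmap1_mk3 mmap1_psX_coef mk3_eq.
  by case: ifP; rewrite ?mul0rn.
rewrite (eq_bigr _ (fun t _ => tE t)); case: ifP => [/andP[/eqP -> /eqP qe]|ne].
  have h : (l < q.+1)%N by rewrite qe ltnS leq_addl.
  rewrite (bigD1 (Ordinal h)) //= big1 => [|t tn].
    by rewrite qe addnK !eqxx addr0 -(bin_sub (leq_addl j l)) addnK.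
  by rewrite ifN //; apply/and3P => -[_ _ /eqP tj]; case/eqP: tn; apply: val_inj.
apply: big1 => t _; rewrite ifN //; apply/and3P => -[/eqP e1 /eqP e2 /eqP e3].
move/negP: ne; apply; rewrite e1 eqxx /= -e2 -e3 subnK //.
by rewrite -ltnS ltn_ord.
Qed.

(** With i and l positive, f(x,y), which is free of z, and f(y,z), which is free of x, do not
    contribute; the other two terms are expanded by the binomial theorem. *)
Lemma cobound_coef f i j l : (0 < i)%N -> (0 < l)%N ->
  cobound f (mk3 i j l) =
  f (mk2 (i + j) l) *+ 'C(i + j, i) - f (mk2 i (j + l)) *+ 'C(j + l, j).
Proof.
move=> i0 l0.
have xy1 := ord_geD x1 y1; have yz1 := ord_geD y1 z1.
have kill k (a b : mps 3 R) (m : 'X_{1..3}) : ord_ge 1 a -> ord_ge 1 b -> zsub k a = a -> zsub k b = b ->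
    m k != 0%N -> psubst f (ppair a b) m = 0.
  move=> a1 b1 ea eb mk; have := zsub_coef k (psubst f (ppair a b)) m.
  rewrite (negPf mk) => <-; congr (mps_coef _ m); rewrite /zsub psubst_comp.
  - by apply: psubst_ext => t; rewrite /ppair; case: ifP.
  - exact: nilf_ppair.
  - exact: nilf_zvar.
rewrite /cobound !mpsBE !mpsDE.
rewrite (kill i2of3 x y) ?zsubX ?mk3E -?lt0n // addr0.
rewrite (kill ord0 y z) ?zsubX ?mk3E -?lt0n // addr0.
congr (_ - _).
  rewrite (@psubst_coef1 _ _ _ _ _ _ (mk2 (i + j) l)); last 2 first.
  - exact: nilf_ppair.
  - move=> a ne; rewrite [a in mmap1 _ a]mk2_surj mmap1_mk2 /ppair /= coef3_xy.
    rewrite [a]mk2_surj mk2_eq in ne.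
    by rewrite (negPf ne) mulr0.
  by rewrite mmap1_mk2 /ppair /= coef3_xy !eqxx /= mulr_natr.
rewrite (@psubst_coef1 _ _ _ _ _ _ (mk2 i (j + l))); last 2 first.
- exact: nilf_ppair.
- move=> a ne; rewrite [a in mmap1 _ a]mk2_surj mmap1_mk2 /ppair /= coef3_yz.
  rewrite [a]mk2_surj mk2_eq in ne.
  by rewrite (negPf ne) mulr0.
by rewrite mmap1_mk2 /ppair /= coef3_yz !eqxx /= mulr_natr.
Qed.

End Assoc.

Section UnitCoef.
Variables (R : comNzRingType) (F : mps 2 R).
Hypothesis HU : fgl_unit F.

Lemma fgl_coef_r n : F (mk2 n 0) = (n == 1%N)%:R.
Proof.
have e1 : zsub i1of2 F = psX R ord0.
  have X0o : ord_ge 1 (psX R (ord0 : 'I_2)) by apply: ord_psX.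
  rewrite -[RHS](faddr0 HU X0o) fgl_addE; apply: psubst_ext => k.
  rewrite /zvar /ppair; case: (unliftP ord0 k) => [l ->|->] //=.
  by rewrite (ord1 l) eqxx.
have := zsub_coef i1of2 F (mk2 n 0); rewrite mk2E eqxx e1 => <-.
rewrite mpsXE [U_(_)%MM]mk2_surj mk2_eq !mnmE /= eqxx andbT.
by rewrite eq_sym.
Qed.
Lemma fgl_coef_l n : F (mk2 0 n) = (n == 1%N)%:R.
Proof.
have e1 : zsub ord0 F = psX R i1of2.
  have X1o : ord_ge 1 (psX R i1of2) by apply: ord_psX.
  rewrite -[RHS](fadd0r HU X1o) fgl_addE; apply: psubst_ext => k.
  rewrite /zvar /ppair; case: (unliftP ord0 k) => [l ->|->] //=.
  by rewrite (ord1 l).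
have := zsub_coef ord0 F (mk2 0 n); rewrite mk2E eqxx e1 => <-.
rewrite mpsXE [U_(_)%MM]mk2_surj mk2_eq !mnmE /= .
by rewrite eq_sym.
Qed.
End UnitCoef.

Lemma fgl_coef_sym (R : comNzRingType) (F : mps 2 R) i j : is_fgl F ->
  F (mk2 i j) = F (mk2 j i).
Proof.
move=> HF; have [o0 o1] : ord_ge 1 (psX R (ord0 : 'I_2)) /\ ord_ge 1 (psX R i1of2).
  by split; apply: ord_psX.
have := faddC HF o0 o1; rewrite !fgl_addE.
have -> : psubst F (ppair (psX R ord0) (psX R i1of2)) = F.
  rewrite -[RHS]psubst_id; apply: psubst_ext => k; rewrite /ppair.
  by case: (unliftP ord0 k) => [l ->|->] //=; rewrite (ord1 l).
have -> : psubst F (ppair (psX R i1of2) (psX R ord0)) = psperm (tperm ord0 i1of2) F.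
  apply: psubst_ext => k; rewrite /ppair.
  by case: (unliftP ord0 k) => [l ->|->] /=; rewrite ?(ord1 l) ?tpermL ?tpermR.
move/(congr1 (fun f : mps 2 R => f (mk2 i j))); rewrite psperm_coef => ->.
congr (mps_coef F _); rewrite [LHS]mk2_surj [RHS]mk2_surj !mnmE /=.
by rewrite tpermL tpermR .
Qed.

(** * The lift, degree by degree *)

Section Lift.
Variables (L T : comNzRingType) (K : comAlgType rat).
Variables (j : {rmorphism T -> K}) (pi : {rmorphism T -> L}) (sigma : L -> T).
Hypotheses (jinj : injective j) (piK : cancel sigma pi).
Variables (F : mps 2 L) (al : T).
Hypotheses (HF : is_fgl F) (pial : pi al = F (mk2 1 1)).

Let lifts (y : K) (l : L) : Prop := exists2 t, y = j t & pi t = l.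
(** G satisfies the axioms exactly, with coefficients in the larger ring K; only those of degree at
    most n must come from T and lift those of F. *)
Let stage n (G : mps 2 K) : Prop :=
  is_fgl G /\ forall m, (mdeg m <= n)%N -> lifts (G m) (F m).

Lemma lift_step d G : stage d.+1 G -> exists2 G', stage d.+2 G' & ord_ge d.+2 (G' - G).
Proof.
case=> HG hG.
have [tau htau] : exists tau : 'X_{1..2} -> T,
    forall m, (mdeg m <= d.+1)%N -> G m = j (tau m) /\ pi (tau m) = F m.
  have [|tau h] := @choice 'X_{1..2} T
      (fun m t => (mdeg m <= d.+1)%N -> G m = j t /\ pi t = F m).
    move=> m; case: (leqP (mdeg m) d.+1) => [le|_]; last by exists 0.
    by have [t e1 e2] := hG m le; exists t.
  by exists tau.
(* A lift of F to T that agrees with G up to degree d+1; it need not satisfy the axioms. *)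
pose GT : mps 2 T := Mps (fun m => if (mdeg m <= d.+1)%N then tau m else sigma (F m)).
have piGT : map_mps pi GT = F.
  by apply: mpsP => m /=; case: ifP => [/htau[]|].
pose E : mps 2 K := map_mps j GT - G.
have oE : ord_ge d.+2 E.
  by move=> m; rewrite ltnS => md; rewrite /E mpsBE /= md (htau m md).1 subrr.
have jGT : map_mps j GT = G + E by rewrite /E addrC subrK.
pose I (y : K) := exists2 t, y = j t & pi t = 0.
have I0 : I 0 by exists 0; rewrite rmorph0.
have IB a b : I a -> I b -> I (a - b).
  by move=> [t -> h] [t' -> h']; exists (t - t'); rewrite rmorphB // h h' subr0.
(* The associativity defect of [GT] dies under [pi], because F is associative; in degree d+2 this
   defect is the coboundary of E. *)
have Icob m : mdeg m = d.+2 -> I (cobound E m).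
  move=> md; have := assoc_perturb HG oE; rewrite -jGT => /ord_geP /(_ m).
  rewrite md => /(_ (leqnn _)) <-; exists (assoc GT m).
    rewrite /assoc !mpsBE rmorphB; congr (_ - _).
      by rewrite -[RHS]/(map_mps j _ m) !map_fgl_add !map_mpsX.
    by rewrite -[RHS]/(map_mps j _ m) !map_fgl_add !map_mpsX.
  have : assoc (map_mps pi GT) m = 0 by rewrite piGT (assoc_fgl HF) mps0E.
  move=> <-; rewrite /assoc !mpsBE rmorphB; congr (_ - _).
    by rewrite -[LHS]/(map_mps pi _ m) !map_fgl_add !map_mpsX.
  by rewrite -[LHS]/(map_mps pi _ m) !map_fgl_add !map_mpsX.
pose D i := E (mk2 i (d.+2 - i)).
have Dsym m : (0 < m < d.+2)%N -> D m = D (d.+2 - m)%N.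
  move=> /andP[m0 mN]; rewrite /D subKn 1?ltnW // /E !mpsBE (fgl_coef_sym _ _ HG).
  by rewrite /= !mdeg_mk2 (fgl_coef_sym _ _ HF) addnC subnK ?subnKC ?ltnn // ltnW.
have Drel i m : (0 < i)%N -> (i < m)%N -> (m < d.+2)%N ->
    I (D m *+ 'C(m, i) - D i *+ 'C(d.+2 - i, m - i)).
  move=> i0 im mN; have := Icob (mk3 i (m - i) (d.+2 - m)).
  rewrite mdeg_mk3 subnKC 1?ltnW // subnKC 1?ltnW // => /(_ erefl).
  rewrite cobound_coef // ?subn_gt0 // subnKC 1?ltnW //.
  have -> : (m - i + (d.+2 - m) = d.+2 - i)%N.
    by rewrite addnC addnBA ?subnK // ltnW.
  by [].
have [b hb] := cocycle I0 IB Dsym Drel.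
(* With the constant -b the mixed coefficients of degree N = d+2 grow by b C(N,m), that is, by those
   of E up to an element of [I]. *)
have [G' HG' close] := conj_fgl d (- b) HG.
set S := psX K ord0 ^+ _ + _ - _ in close.
have oS : ord_ge d.+2 S.
  have p k : ord_ge d.+2 (psX K (k : 'I_2) ^+ d.+2).
    by apply: ord_geX; apply: ord_psX.
  apply: ord_geB; first by apply: ord_geD; apply: p.
  by apply: ord_geX; apply: ord_geD; apply: ord_psX.
have oG : ord_ge d.+2 (G' - G).
  have -> : G' - G = (G' - G - mps_const 2 (- b) * S) + mps_const 2 (- b) * S.
    by rewrite subrK.
  apply: ord_geD; last exact: ord_geMl.
  by apply: ord_geW close.
exists G' => //; split=> // m; rewrite leq_eqVlt => /orP[/eqP md|md]; last first.
  have /ord_geP /(_ m md) -> := oG; exact: hG.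
move: md; rewrite [m]mk2_surj; move: (m _) (m _) => q p {m}; rewrite mdeg_mk2 => pq.
have [p0|p0] := posnP p.
  rewrite p0 (fgl_coef_l (fgl_unitP HG')) (fgl_coef_l (fgl_unitP HF)).
  by exists (q == 1%N)%:R; rewrite rmorph_nat.
have [q0|q0] := posnP q.
  rewrite q0 (fgl_coef_r (fgl_unitP HG')) (fgl_coef_r (fgl_unitP HF)).
  by exists (p == 1%N)%:R; rewrite rmorph_nat.
have pN : (0 < p < d.+2)%N by rewrite p0 -pq -addn1 leq_add2l.
have qE : q = (d.+2 - p)%N by rewrite -pq addKn.
have [t te t0] := hb p pN.
have /ord_geP /(_ (mk2 p q)) := close; rewrite mdeg_mk2 pq => /(_ (leqnn _)).
have eS : S (mk2 p q) = - ('C(d.+2, p))%:R.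
  rewrite /S mpsBE mpsDE qE [X in _ - X]binom_coef2; last by case/andP: pN => _ /ltnW.
  by rewrite [X in X + _ - _]pow_coef2 // [X in _ + X - _]pow_coef2 // add0r sub0r.
rewrite mps_constM eS mpsBE mulrNN => e.
have jE : j (GT (mk2 p q)) = E (mk2 p q) + G (mk2 p q) by rewrite /E mpsBE subrK.
(* The new coefficient is G + b C(N,p) = G + E - j t = j(GT - t), and t is in the kernel of [pi]. *)
exists (GT (mk2 p q) - t).
  rewrite rmorphB -te jE /D -qE -mulr_natr -e.
  by move: (G' _) (G _) (E _) => u v w; ring.
by rewrite rmorphB t0 subr0 -[in RHS]piGT.
Qed.

(** The law x + y + al x y is associative for every al, so the prescribed lift of a_{1,1} can be
    realised exactly. *)
Lemma lift_base : exists2 G, stage 2 G & G (mk2 1 1) = j al.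
Proof.
pose X0 : mps 2 K := psX K ord0; pose X1 : mps 2 K := psX K i1of2.
pose G := X0 + X1 + mps_const 2 (j al) * (X0 * X1).
have GE n (a b : mps n K) : ord_ge 1 a -> ord_ge 1 b ->
    fgl_add G a b = a + b + mps_const n (j al) * (a * b).
  move=> a1 b1; have z := nilf_ppair a1 b1.
  by rewrite fgl_addE /G !psubstD !(psubstM z) (psubstC _ z) !(psubstX _ z).
have oG n (a b : mps n K) : ord_ge 1 a -> ord_ge 1 b -> ord_ge 1 (fgl_add G a b).
  move=> a1 b1; rewrite (GE _ _ _ a1 b1).
  by apply: ord_geD; [apply: ord_geD|apply/ord_geMl/ord_geMr].
have HG : is_fgl G.
  split.
  - move=> u; have u1 : ord_ge 1 u by apply: ord_psX.
    have z1 : ord_ge 1 (0 : mps 1 K) by [].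
    by rewrite (GE _ _ _ u1 z1) (GE _ _ _ z1 u1); split; ring.
  - move=> u v; have [u1 v1] : ord_ge 1 u /\ ord_ge 1 v by split; apply: ord_psX.
    by rewrite (GE _ _ _ u1 v1) (GE _ _ _ v1 u1); ring.
  move=> u v w; have [u1 v1 w1] : [/\ ord_ge 1 u, ord_ge 1 v & ord_ge 1 w] by split; apply: ord_psX.
  rewrite (GE _ _ _ (oG _ _ _ u1 v1) w1) (GE _ _ _ u1 (oG _ _ _ v1 w1)).
  by rewrite (GE _ _ _ u1 v1) (GE _ _ _ v1 w1); ring.
have G11 : G (mk2 1 1) = j al.
  rewrite /G mpsDE mpsDE mps_constM.
  have -> : X0 * X1 = mmap1 (@psX 2 K) (mk2 1 1) by rewrite mmap1_mk2 !expr1.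
  have -> : X0 = mmap1 (@psX 2 K) (mk2 1 0) by rewrite mmap1_mk2 expr1 expr0 mulr1.
  have -> : X1 = mmap1 (@psX 2 K) (mk2 0 1) by rewrite mmap1_mk2 expr1 expr0 mul1r.
  by rewrite !mmap1_psX_coef !mk2_eq /= !add0r mulr1.
exists G => //; split=> // m; rewrite [m]mk2_surj; move: (m _) (m _) => q p {m}.
rewrite mdeg_mk2.
have [->|p0] := posnP p.
  rewrite (fgl_coef_l (fgl_unitP HG)) (fgl_coef_l (fgl_unitP HF)).
  by exists (q == 1%N)%:R; rewrite rmorph_nat.
have [->|q0] := posnP q.
  rewrite (fgl_coef_r (fgl_unitP HG)) (fgl_coef_r (fgl_unitP HF)).
  by exists (p == 1%N)%:R; rewrite rmorph_nat.
case: p p0 => [|[|p]] // _; case: q q0 => [|[|q]] // _; rewrite ?addnS //.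
by rewrite G11; exists al.
Qed.

(** The iteration starts from the law of [lift_base], and each step changes only degrees at least 3;
    hence the coefficient of xy stays al in the limit. *)
Lemma fgl_lift : exists G : mps 2 T,
  [/\ is_fgl G, map_mps pi G = F & G (mk2 1 1) = al].
Proof.
have [st hst] : exists st : nat -> mps 2 K -> mps 2 K, forall d G, stage d.+1 G ->
    stage d.+2 (st d G) /\ ord_ge d.+2 (st d G - G).
  have [|st h] := @choice (nat * mps 2 K) (mps 2 K) (fun x G' => stage x.1.+1 x.2 ->
     stage x.1.+2 G' /\ ord_ge x.1.+2 (G' - x.2)).
    move=> [d G] /=; have [s|ns] := EM (stage d.+1 G); last by exists 0.
    by have [G' h1 h2] := lift_step s; exists G'.
  by exists (fun d G => st (d, G)) => d G; apply: (h (d, G)).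
have [G0 s0 e0] := lift_base.
pose G := fix G k := if k is k'.+1 then st k'.+1 (G k') else G0.
have sG k : stage k.+2 (G k) by elim: k => // k IH; case: (hst k.+1 _ IH).
have cG k l : ord_ge k.+3 (G (k + l)%N - G k).
  elim: l => [|l IH]; first by rewrite addn0 subrr.
  rewrite addnS; have [_ h] := hst _ _ (sG (k + l)%N).
  have -> : G (k + l).+1 - G k = (G (k + l).+1 - G (k + l)%N) + (G (k + l)%N - G k).
    by rewrite addrA subrK.
  by apply: ord_geD => //; apply: ord_geW h; rewrite !ltnS leq_addr.
pose H : mps 2 K := Mps (fun m => G (mdeg m) m).
have HE k : ord_ge k.+3 (H - G k).
  apply/ord_geP => m; rewrite ltnS => mk /=.
  have [le|/ltnW le] := leqP k (mdeg m).
    by have := cG k (mdeg m - k)%N; rewrite subnKC // => /ord_geP /(_ m); apply.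
  have := cG (mdeg m) (k - mdeg m)%N; rewrite subnKC // => /ord_geP /(_ m) -> //.
  by rewrite !ltnS; apply/ltnW/ltnW.
have HH : is_fgl H.
  apply: is_fgl_limit => d; exists (G d); first by case: (sG d).
  by apply: ord_geW (HE d); do 3!apply: ltnW.
have [|tau htau] := @choice 'X_{1..2} T (fun m t => H m = j t /\ pi t = F m).
  move=> m; have [_ /(_ m) [|t e1 e2]] := sG (mdeg m); last by exists t.
  by do 2!apply: leqW.
exists (Mps tau); split.
- apply: (is_fgl_inj jinj); congr is_fgl: HH.
  by apply: mpsP => m; rewrite (htau m).1.
- by apply: mpsP => m; rewrite -(htau m).2.
apply: jinj; rewrite -e0 -[LHS]/(j (tau _)) -(htau _).1.
by have /ord_geP := HE 0%N; apply; rewrite mdeg_mk2.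
Qed.
End Lift.

(** * The Lazard ring *)

Module FreeRing.
Import finmap.finmap monalg.

Section FreeRing.
Variable L : comNzRingType.

Notation zpoly := {malg int[{cmonom L}]}.
Notation qpoly := {malg rat[{cmonom L}]}.

Definition qmon (k : {cmonom L}) : qpoly := << k >>%R.
Lemma qmonM : mmorphism qmon.
Proof. by split=> [k l|] //; rewrite /qmon malgM_def fgmulUU mulr1. Qed.
HB.instance Definition _ := isMultiplicative.Build _ _ qmon qmonM.

Definition zq : zpoly -> qpoly := mmap (malgC \o intr) qmon.

Lemma zq_coef g k : mcoeff k (zq g) = (mcoeff k g)%:~R.
Proof.
rewrite /zq /mmap (raddf_sum (mcoeff k)) /= [in RHS](monalgE g) raddf_sum /= rmorph_sum.
apply: eq_bigr => l _; rewrite mul_malgC mcoeffZ /qmon !mcoeffU.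
by case: (l == k); rewrite ?mulr1 ?mulr0.
Qed.

Lemma zq_inj : injective zq.
Proof.
move=> g h e; apply/malgP => k; apply: (@intr_inj rat).
by rewrite -!zq_coef e.
Qed.

Definition evmon (k : {cmonom L}) : L := \prod_(i <- finsupp k) i ^+ k i.

Lemma evmonEw (d : {fset L}) (k : {cmonom L}) : (finsupp k `<=` d)%fset ->
  evmon k = \prod_(i <- d) i ^+ k i.
Proof.
move=> le; rewrite /evmon (big_fset_incl _ le) => // x _.
by rewrite -cmE_eq0 => /eqP ->.
Qed.

Lemma evmonM : mmorphism evmon.
Proof.
split=> [k l|]; last by rewrite /evmon mdom1 big_seq_fset0.
have sk : (finsupp k `<=` finsupp k `|` finsupp l)%fset by apply: fsubsetUl.
have sl : (finsupp l `<=` finsupp k `|` finsupp l)%fset by apply: fsubsetUr.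
have skl : (finsupp (mmul k l) `<=` finsupp k `|` finsupp l)%fset.
  by rewrite mdomD; apply: fsubset_refl.
rewrite (evmonEw sk) (evmonEw sl) (evmonEw skl) -big_split /=.
by apply: eq_bigr => i _; rewrite cmM exprD.
Qed.
HB.instance Definition _ := isMultiplicative.Build _ _ evmon evmonM.

Definition zev : zpoly -> L := mmap intr evmon.
Definition zvarX (x : L) : zpoly := << ucm x >>%R.

Lemma zevK : cancel zvarX zev.
Proof.
move=> x; rewrite /zev /zvarX mmapU mul1r /evmon mdomU big_seq_fset1.
by rewrite cmUU expr1.
Qed.

Lemma zpoly_torsion (g : zpoly) k : g *+ k.+1 = 0 -> g = 0.
Proof.
move=> e; apply/malgP => m; have := congr1 (mcoeff m) e.
rewrite mcoeffMn mcoeff0 => /eqP.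
by rewrite Num.Theory.mulrn_eq0 /= => /eqP.
Qed.

Lemma zvarX_mul_coef x (g : zpoly) k : mcoeff (mmul (ucm x) k) (zvarX x * g) = mcoeff k g.
Proof.
rewrite /zvarX malgM_def fgmulUg raddf_sum /= [in RHS](monalgE g) raddf_sum /=.
apply: eq_bigr => l _; rewrite !mcoeffU mul1r; congr (_ *+ nat_of_bool _).
apply/eqP/eqP => [/eqP/cmP h|-> //]; apply/eqP/cmP => i.
by have := h i; rewrite !cmM => /addnI.
Qed.

Lemma zvarX_reg2 x (g h : zpoly) : zvarX x * g = h *+ 2 -> exists g', g = g' *+ 2.
Proof.
move=> e.
have c k : exists c : int, mcoeff k g = c *+ 2.
  by exists (mcoeff (mmul (ucm x) k) h); rewrite -mcoeffMn -e zvarX_mul_coef.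
have [c' hc] := choice c.
exists (\sum_(k <- msupp g) << c' k *g k >>); rewrite {1}[g]monalgE -sumrMnl.
by apply: eq_bigr => k _; rewrite hc monalgUMn.
Qed.

End FreeRing.
Notation zpoly L := {malg int[{cmonom L}]}.
Notation qpoly L := {malg rat[{cmonom L}]}.

Section Lazard.
Variables (L : comNzRingType) (F : mps 2 L).
Hypothesis HL : is_lazard F.

Lemma lazard_retract : exists (phi : {rmorphism L -> zpoly L}),
  cancel phi (@zev L) /\ phi (F (mk2 1 1)) = zvarX (F (mk2 1 1)).
Proof.
have [HF univ] := HL.
have [G [HG piG G11]] := @fgl_lift L (zpoly L) (qpoly L)
  (@zq L) (@zev L) (@zvarX L) (@zq_inj L)
  (@zevK L) F (zvarX (F (mk2 1 1))) HF (zevK _).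
have [phi phiF _] := univ _ _ HG.
exists phi; split; last by rewrite -G11 -phiF.
(* Both the identity and [zev \o phi] fix F, so uniqueness in the universal property of L itself
   identifies them. *)
have [psi psiF uniq] := univ L F HF.
pose id1 : {rmorphism L -> L} := idfun.
pose c1 : {rmorphism L -> L} := @zev L \o phi.
have e1 : map_mps id1 F = F by apply: mpsP.
have e2 : map_mps c1 F = F.
  by apply: mpsP => m; rewrite -[in RHS]piG -phiF.
by move=> l; rewrite -[LHS]/(c1 l) (uniq _ e2) -(uniq _ e1).
Qed.

Lemma lazard_torsion_free (x : L) k : x *+ k.+1 = 0 -> x = 0.
Proof.
have [phi [can _]] := lazard_retract => e.
have e' : phi x *+ k.+1 = 0 by rewrite -(rmorph0 phi) -e [RHS]rmorphMn.
by apply: (can_inj can); rewrite rmorph0; apply: zpoly_torsion e'.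
Qed.

Lemma lazard_a11_regular (x y : L) : F (mk2 1 1) * x = y *+ 2 -> exists x', x = x' *+ 2.
Proof.
have [phi [can al]] := lazard_retract => e.
have := congr1 phi e; rewrite rmorphM rmorphMn al => /zvarX_reg2 [g hg].
by exists (zev g); rewrite -[LHS]can hg; apply: (raddfMn (mmap intr (@evmon L))).
Qed.
End Lazard.

End FreeRing.

(** * Sums of fractions *)

Section FSum.
Variables (A : comNzRingType) (I : finType).
Implicit Types (P Q : pred I) (num den a : I -> A).

(* [f] is the sum of the [num i / den i]: any common multiple [V] of the denominators
   takes the place of inverses, so that no total ring of fractions is needed. *)
Definition is_fsum P num den (f : A) : Prop :=
  forall V (e : I -> A), (forall i, P i -> den i * e i = V) ->
    f * V = \sum_(i | P i) num i * e i.

(** One regular common multiple is enough: if den_i e_i = V and den_i e0_i = V0, then e_i V0 = e0_i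
    V, and V0 can be cancelled. *)
Lemma fsum_intro P num den f V0 (e0 : I -> A) : GRing.lreg V0 ->
    (forall i, P i -> den i * e0 i = V0) -> f * V0 = \sum_(i | P i) num i * e0 i ->
  is_fsum P num den f.
Proof.
move=> V0r he0 hf V e he; apply: V0r.
transitivity (f * V0 * V); first by ring.
rewrite hf mulr_suml mulr_sumr; apply: eq_bigr => i Pi.
by rewrite -{1}(he i Pi) -(he0 i Pi); ring.
Qed.

Lemma prod_cofactor P den i : P i ->
  den i * \prod_(j | P j && (j != i)) den j = \prod_(j | P j) den j.
Proof. by move=> Pi; rewrite [RHS](bigD1 i). Qed.

Lemma lreg_factor (x y : A) : GRing.lreg (x * y) -> GRing.lreg y.
Proof. by move=> h u v e; apply: h; rewrite -!mulrA e. Qed.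

Lemma lreg_prod (J : Type) (r : seq J) (P : pred J) (G : J -> A) :
  (forall i, P i -> GRing.lreg (G i)) -> GRing.lreg (\prod_(i <- r | P i) G i).
Proof.
move=> h; elim/big_rec: _ => [|i x Pi]; first exact: lreg1.
by apply: lregM; apply: h.
Qed.

Lemma fsum_uniq P num den f g : (forall i, P i -> GRing.lreg (den i)) ->
  is_fsum P num den f -> is_fsum P num den g -> f = g.
Proof.
move=> hr hf hg; have r := lreg_prod (r := index_enum I) hr.
by apply: r; rewrite mulrC (hf _ _ (@prod_cofactor P den)) -(hg _ _ (@prod_cofactor P den)) mulrC.
Qed.

Lemma fsum_drop P Q num den f : (forall i, P i -> GRing.lreg (den i)) ->
  (forall i, P i -> ~~ Q i -> num i = 0) ->
  is_fsum P num den f -> is_fsum (fun i => P i && Q i) num den f.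
Proof.
move=> hr h0 hf; apply: (fsum_intro (lreg_prod (r := index_enum I) hr)
   (e0 := fun i => \prod_(j | P j && (j != i)) den j)).
  by move=> i /andP[Pi _]; apply: prod_cofactor.
rewrite (hf _ _ (@prod_cofactor P den)) (bigID Q) /= [X in _ + X]big1 ?addr0 // => i /andP[Pi Qi].
by rewrite h0 // mul0r.
Qed.

Lemma fsum_cancel P num den num' den' a f : (forall i, P i -> GRing.lreg (den i)) ->
  (forall i, P i -> num i = a i * num' i) -> (forall i, P i -> den i = a i * den' i) ->
  is_fsum P num den f -> is_fsum P num' den' f.
Proof.
move=> hr hn hd hf; apply: (fsum_intro (lreg_prod (r := index_enum I) hr)
   (e0 := fun i => a i * \prod_(j | P j && (j != i)) den j)).
  by move=> i Pi; rewrite mulrA [den' i * _]mulrC -hd //; apply: prod_cofactor.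
rewrite (hf _ _ (@prod_cofactor P den)); apply: eq_bigr => i Pi.
by rewrite hn // mulrA [num' i * _]mulrC.
Qed.

Lemma fsum_ext P num den num' den' f :
  (forall i, P i -> num i = num' i) -> (forall i, P i -> den i = den' i) ->
  is_fsum P num den f -> is_fsum P num' den' f.
Proof.
move=> hn hd hf V e he; rewrite (hf V e).
  by apply: eq_bigr => i Pi; rewrite hn.
by move=> i Pi; rewrite hd // he.
Qed.

End FSum.

Lemma fsum_morph (A B : comNzRingType) (I : finType) (P : pred I) (num den : I -> A)
    f (s : A -> B) :
    {morph s : x y / x * y} -> s 1 = 1 -> {morph s : x y / x + y} -> s 0 = 0 ->
    (forall i, P i -> GRing.lreg (s (den i))) ->
  is_fsum P num den f -> is_fsum P (s \o num) (s \o den) (s f).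
Proof.
move=> sM s1 sD s0 hr hf.
have sP (J : Type) (r : seq J) (Q : pred J) (G : J -> A) :
  s (\prod_(i <- r | Q i) G i) = \prod_(i <- r | Q i) s (G i).
  exact: (big_morph s sM s1).
apply: (fsum_intro (lreg_prod (r := index_enum I) hr)
   (e0 := fun i => s (\prod_(j | P j && (j != i)) den j))).
  by move=> i Pi; rewrite sP; apply: (prod_cofactor (s \o den)).
rewrite -sP -sM (hf _ _ (@prod_cofactor _ _ P den)) (big_morph s sD s0).
by apply: eq_bigr => i _; rewrite sM.
Qed.

Lemma fsum_reindex (A : comNzRingType) (I J : finType) (P : pred I) (Q : pred J)
    (num den : I -> A) (h : J -> I) f : injective h ->
    (forall j, P (h j) = Q j) -> (forall i, P i -> exists j, h j = i) ->
  is_fsum P num den f -> is_fsum Q (num \o h) (den \o h) f.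
Proof.
move=> hI hP hK hf V e he.
pose h' i := [pick j | h j == i].
have hh' j : h' (h j) = Some j.
  by rewrite /h'; case: pickP => [k /eqP/hI -> //|/(_ j)]; rewrite eqxx.
rewrite (hf V (fun i => if h' i is Some j then e j else 0)); last first.
  by move=> i Pi; have [j ji] := hK i Pi; rewrite -ji hh'; apply: he; rewrite -hP ji.
rewrite (reindex_omap h h') /=; last first.
  by move=> i Pi; have [j <-] := hK i Pi; rewrite hh'.
by apply: eq_big => [j|j _]; rewrite hh' ?eqxx ?andbT ?hP.
Qed.

Section Injections.
Variables (r n : nat).
Implicit Types (phi : {ffun 'I_r -> 'I_n}) (w : 'S_n).

(* For [phi] the restriction of a permutation [w], the [y] avoided up to [i] are the
   [w j] with [i < j]; see [injprod_restr]. *)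
Definition avoids phi (i : 'I_r) (y : 'I_n) := [forall k : 'I_r, (k <= i)%N ==> (phi k != y)].
Definition injprod (A : comNzRingType) phi (F2 : 'I_n -> 'I_n -> A) :=
  \prod_(i < r) \prod_(y | avoids phi i y) F2 (phi i) y.

Lemma avoids_neq phi i y : avoids phi i y -> phi i != y.
Proof. by move/forallP/(_ i); rewrite leqnn. Qed.

Lemma eq_injprod (A : comNzRingType) phi (F2 G2 : 'I_n -> 'I_n -> A) :
  (forall a b, a != b -> F2 a b = G2 a b) -> injprod phi F2 = injprod phi G2.
Proof.
by move=> h; apply: eq_bigr => i _; apply: eq_bigr => y /avoids_neq/h.
Qed.

Lemma injprodM (A : comNzRingType) phi (F2 G2 : 'I_n -> 'I_n -> A) :
  injprod phi (fun a b => F2 a b * G2 a b) = injprod phi F2 * injprod phi G2.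
Proof. by rewrite /injprod -big_split; apply: eq_bigr => i _; rewrite -big_split. Qed.

Definition pact w phi : {ffun 'I_r -> 'I_n} := [ffun i => w (phi i)].

Lemma avoids_act w phi i y : avoids (pact w phi) i (w y) = avoids phi i y.
Proof. by apply: eq_forallb => k; rewrite ffunE (inj_eq perm_inj). Qed.

Lemma injprod_act (A : comNzRingType) w phi (F2 : 'I_n -> 'I_n -> A) :
  injprod (pact w phi) F2 = injprod phi (fun a b => F2 (w a) (w b)).
Proof.
apply: eq_bigr => i _; rewrite (reindex_inj (@perm_inj _ w)) /=.
by apply: eq_big => [y|y _]; rewrite ?avoids_act // ffunE.
Qed.

Lemma pact_inj w phi : injectiveb (pact w phi) = injectiveb phi.
Proof.
apply/injectiveP/injectiveP => h i k.
  by move=> e; apply: h; rewrite !ffunE e.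
by rewrite !ffunE => /perm_inj /h.
Qed.

Lemma pactK w phi : pact w^-1 (pact w phi) = phi.
Proof. by apply/ffunP => i; rewrite !ffunE permK. Qed.
Lemma pactKV w phi : pact w (pact w^-1 phi) = phi.
Proof. by apply/ffunP => i; rewrite !ffunE permKV. Qed.

Hypothesis rn : (r <= n)%N.
Definition restr w : {ffun 'I_r -> 'I_n} := [ffun i => w (widen_ord rn i)].

Lemma restr_inj w : injectiveb (restr w).
Proof.
apply/injectiveP => i k; rewrite !ffunE => /perm_inj e.
by apply: val_inj; apply: (congr1 val e).
Qed.

Lemma injprod_restr (A : comNzRingType) w (F2 : 'I_n -> 'I_n -> A) :
  \prod_(i < n | (i < r)%N) \prod_(j < n | (i < j)%N) F2 (w i) (w j) =
  injprod (restr w) F2.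
Proof.
rewrite big_ord_narrow; apply: eq_bigr => i _.
rewrite [RHS](reindex_inj (@perm_inj _ w)) /=.
apply: eq_big => [j|j _]; last by rewrite ffunE.
apply/idP/forallP => [ij k|h].
  apply/implyP => ki; rewrite ffunE (inj_eq perm_inj) -val_eqE /=.
  by rewrite neq_ltn (leq_ltn_trans ki ij).
rewrite ltnNge; apply/negP => ji.
have jr : (j < r)%N by apply: leq_ltn_trans ji (ltn_ord i).
have := h (Ordinal jr); rewrite /= ji /= ffunE (inj_eq perm_inj) -val_eqE /=.
by rewrite eqxx.
Qed.

(** List the values of phi, then the missing elements; the resulting sequence is the extension. *)
Lemma restr_onto phi : injectiveb phi -> exists w, restr w = phi.
Proof.
move=> /injectiveP inj.
pose s := codom phi ++ [seq y <- enum 'I_n | y \notin codom phi].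
have us : uniq s.
  rewrite cat_uniq filter_uniq ?enum_uniq // andbT.
  rewrite map_inj_uniq ?enum_uniq //=; apply/hasPn => y.
  by rewrite mem_filter => /andP[].
have ss : size s = n.
  have /perm_size -> : perm_eq s (enum 'I_n); last by rewrite size_enum_ord.
  apply: uniq_perm => //; first exact: enum_uniq.
  move=> y; rewrite mem_cat mem_filter !mem_enum /= andbT inE.
  by case: (y \in codom phi).
pose g (i : 'I_n) := nth i s i.
have ginj : injective g.
  move=> i k; rewrite /g (set_nth_default i k) ?ss // => /eqP.
  by rewrite nth_uniq ?ss // => /eqP; apply: val_inj.
exists (perm ginj); apply/ffunP => i; rewrite ffunE permE /g /=.
rewrite nth_cat size_codom card_ord ltn_ord.
rewrite /codom /image_mem (nth_map i) ?size_enum_ord //.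
by rewrite nth_ord_enum.
Qed.

(** The permutations with a given restriction form a coset of the group that fixes the first r
    letters. This count absorbs the factor 1/(n-r)! of the definition. *)
Lemma card_restr phi : injectiveb phi -> #|[pred w | restr w == phi]| = ((n - r)`!)%N.
Proof.
move=> /restr_onto[w0 w0E].
pose A := [set j : 'I_n | (r <= j)%N].
have -> : ((n - r)`!)%N = #|[set u : 'S_n | perm_on A u]|.
  have -> : (n - r)%N = #|A|.
    have := cardsC A; rewrite card_ord.
    suff -> : #|~: A| = r by move=> e; apply/eqP; rewrite -(eqn_add2r r) subnK // e.
    rewrite -sum1_card.
    transitivity (\sum_(j < n | (j < r)%N) 1)%N.
      by apply: eq_bigl => j; rewrite !inE -ltnNge.
    by rewrite (big_ord_narrow rn) sum1_card card_ord.
  by rewrite -card_perm cardsE.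
rewrite -(card_imset _ (mulIg w0)); apply: eq_card => w; rewrite !inE.
apply/eqP/imsetP => [wE|[u]]; last first.
  rewrite inE => Au ->; apply/ffunP => i; rewrite ffunE permM.
  rewrite (out_perm Au) ?inE /= -?ltnNge ?ltn_ord //.
  by have := congr1 (fun f : {ffun _} => f i) w0E; rewrite ffunE.
exists (w * w0^-1)%g; last by rewrite mulgKV.
rewrite inE /perm_on; apply/fintype.subsetP => j; rewrite !inE; apply: contraR.
rewrite -ltnNge => jr; rewrite permM.
have := congr1 (fun f : {ffun _} => f (Ordinal jr)) (etrans wE (esym w0E)).
rewrite !ffunE; have -> : widen_ord rn (Ordinal jr) = j by apply: val_inj.
by move=> ->; rewrite permK.
Qed.

Lemma sum_restr (A : comNzRingType) (G : {ffun 'I_r -> 'I_n} -> A) :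
  \sum_(w : 'S_n) G (restr w) = (\sum_(phi : {ffun 'I_r -> 'I_n} | injectiveb phi) G phi) *+ (n - r)`!.
Proof.
rewrite (partition_big restr (fun phi : {ffun _ -> _} => injectiveb phi)) => [|w _]; last exact: restr_inj.
rewrite -sumrMnl; apply: eq_bigr => phi inj.
rewrite (eq_bigr (fun=> G phi)) => [|w /eqP -> //].
by rewrite sumr_const -(card_restr inj).
Qed.
End Injections.

(** * The Vandermonde determinant *)

Lemma mps_inverse (n : nat) (R : comNzRingType) (g : mps n R) : g 0%MM = 1 ->
  exists2 v, g * v = 1 & v 0%MM = 1.
Proof.
move=> g0; pose h := g - 1.
have h1 : ord_ge 1 h by apply/ord_ge1P; rewrite /h mpsBE g0 mps1E eqxx subrr.
pose Phi y := - h - h * y.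
have [| |y y1 yE] := @ps_fixpoint n R Phi.
- by move=> y y1; apply: ord_geB; [apply: ord_geN|apply: ord_geMl].
- move=> d y y' y1 y1' yy.
  have -> : Phi y - Phi y' = - (h * (y - y')) by rewrite /Phi; ring.
  by apply: ord_geN; rewrite -[d.+1]add1n; apply: ord_geM.
exists (1 + y); last by have /ord_ge1P := y1; rewrite mpsDE mps1E eqxx => ->; rewrite addr0.
have -> : g = 1 + h by rewrite /h; ring.
rewrite mulrDr mulr1 mulrDl mul1r -{1}yE /Phi; ring.
Qed.

Section Diff.
Variables (n : nat) (R : comNzRingType) (F : mps 2 R).
Hypothesis HF : is_fgl F.
Let X (i : 'I_n) : mps n R := psX R i.
Let X1 i : ord_ge 1 (X i). Proof. exact: ord_psX. Qed.

(** x_i -_F x_j vanishes on x_i = x_j, so it is (x_i - x_j) g; comparing linear terms, g has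
    constant coefficient 1 and is invertible. *)
Lemma fsub_factor i j : i != j -> exists c, X j - X i = fsub F (X i) (X j) * c.
Proof.
move=> ij; have z := nilf_evar R i j.
have e0 : esub i j (fsub F (X i) (X j)) = 0.
  rewrite /esub (fsub_subst HF (X1 i) (X1 j) z) !(psubstX _ z) /evar eqxx.
  by rewrite eq_sym (negPf ij) (faddN HF).
have [g gE] := factor_thm ij e0.
have g0 : g 0%MM = 1.
  have := low_fsub HF (X1 i) (X1 j); rewrite gE.
  have o : ord_ge 1 (X i - X j) by apply: ord_geB.
  rewrite -[X in low X (_ * _) = _]addn0 (lowM o) // lowB !low_psX.
  move/(congr1 (mcoeff U_(i)%MM)).
  rewrite low0_const mulrC mcoeffCM mcoeffB !mcoeffX eqxx eq_mnm1 eq_sym (negPf ij) subr0 mulr1.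
  by [].
have [v gv _] := mps_inverse g0.
exists (- v); rewrite gE mulrN -mulrA gv mulr1; exact/esym/opprB.
Qed.

Definition vdm := \prod_(p : 'I_n * 'I_n | (p.1 < p.2)%N) (X p.2 - X p.1).

Lemma vdm_nested : vdm = \prod_(i < n) \prod_(j < n | (i < j)%N) (X j - X i).
Proof. by rewrite pair_big_dep. Qed.

(** The permutation acts on the columns of the Vandermonde matrix, whence the sign. *)
Lemma psperm_vdm (w : 'S_n) :
  \prod_(i < n) \prod_(j < n | (i < j)%N) (X (w j) - X (w i)) = (-1) ^+ w * vdm.
Proof.
pose a : 'rV[mps n R]_n := \row_j X j; pose b : 'rV[mps n R]_n := \row_j X (w j).
have E1 := det_Vandermonde a; have E2 := det_Vandermonde b.
have -> : \prod_(i < n) \prod_(j < n | (i < j)%N) (X (w j) - X (w i)) = \det (Vandermonde n b).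
  by rewrite E2; apply: eq_bigr => i _; apply: eq_bigr => j _; rewrite !mxE.
have -> : vdm = \det (Vandermonde n a).
  by rewrite vdm_nested E1; apply: eq_bigr => i _; apply: eq_bigr => j _; rewrite !mxE.
have -> : Vandermonde n b = col_perm w (Vandermonde n a).
  by apply/matrixP => i j; rewrite !mxE.
rewrite col_permE det_mulmx det_perm odd_permV mulrC; congr (_ * _).
Qed.

Lemma psperm_vdmE (w : 'S_n) : psperm w vdm = (-1) ^+ w * vdm.
Proof.
rewrite -psperm_vdm vdm_nested /psperm; have z := nilf_perm R w.
rewrite (psubst_prod z); apply: eq_bigr => i _; rewrite (psubst_prod z).
by apply: eq_bigr => j _; rewrite psubstB !(psubstX _ z).
Qed.

Lemma lreg_vdm : GRing.lreg vdm.
Proof.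
apply: lreg_prod => p lt; apply: lreg_psXB.
by rewrite -val_eqE neq_ltn lt orbT.
Qed.

(** After one pair of variables is identified, every other factor of the Vandermonde determinant is
    still a difference of two distinct variables. *)
Lemma esub_lreg (p q : 'I_n * 'I_n) : (p.1 < p.2)%N -> (q.1 < q.2)%N -> p != q ->
  GRing.lreg (esub p.2 p.1 (X q.2 - X q.1)).
Proof.
case: p q => [a b] [c d] /= ab cd ne; have z := nilf_evar R b a.
rewrite /esub psubstB !(psubstX _ z) /evar.
have dc : d != c by rewrite -val_eqE neq_ltn cd orbT.
have ba : b != a by rewrite -val_eqE neq_ltn ab orbT.
case: (d =P b) => [db|_]; case: (c =P b) => [cb|_]; apply: lreg_psXB => //.
- by rewrite db cb eqxx in dc.
- by apply: contraNneq ne => ac; rewrite xpair_eqE ac db !eqxx.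
- by apply: contraTneq cd => e; rewrite e cb -leqNgt ltnW.
Qed.

(** The linear factors are split off one at a time: those already removed stay regular on x_a = x_b,
    so the remaining quotient still vanishes there. *)
Lemma vdm_div S : (forall a b, a != b -> esub a b S = 0) -> exists g, S = vdm * g.
Proof.
move=> hS; rewrite /vdm -big_filter.
have : all (fun p : 'I_n * 'I_n => (p.1 < p.2)%N)
    [seq p <- index_enum _ | ((p : 'I_n * 'I_n).1 < p.2)%N] by apply: filter_all.
have : uniq [seq p <- index_enum _ | ((p : 'I_n * 'I_n).1 < p.2)%N].
  by rewrite filter_uniq // index_enum_uniq.
elim: [seq _ <- _ | _] => [|p s IH] /=; first by exists S; rewrite big_nil mul1r.
case/andP=> ps us /andP[pp sp]; have [g gE] := IH us sp.
have z := nilf_evar R p.2 p.1.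
have ne : p.2 != p.1 by rewrite -val_eqE neq_ltn pp orbT.
have e0 : esub p.2 p.1 g = 0.
  have := hS _ _ ne; rewrite gE /esub (psubstM z) (psubst_prod z).
  have r : GRing.lreg (\prod_(q <- s) psubst (X q.2 - X q.1) (evar R p.2 p.1)).
    rewrite big_seq; apply: lreg_prod => q qs.
    apply: (@esub_lreg p q) => //; first exact: (allP sp).
    by apply: contraNneq ps => ->.
  by move=> e; apply: r; rewrite e mulr0.
have [g' g'E] := factor_thm ne e0.
by exists g'; rewrite gE g'E big_cons -/(X _) -/(X _) mulrCA mulrA.
Qed.

(** Cancels the Vandermonde determinant modulo h: on x_a = x_b the equation becomes 0 = h Y with h
    still regular, so Y absorbs the factor. *)
Lemma vdm_div_ideal h G Y : (forall a b, a != b -> GRing.lreg (esub a b h)) ->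
  vdm * G = h * Y -> exists Y', G = h * Y'.
Proof.
move=> hh; rewrite /vdm -big_filter.
have : all (fun p : 'I_n * 'I_n => (p.1 < p.2)%N)
    [seq p <- index_enum _ | ((p : 'I_n * 'I_n).1 < p.2)%N] by apply: filter_all.
elim: [seq _ <- _ | _] Y => [|p s IH] Y /=.
  by rewrite big_nil mul1r => _ ->; exists Y.
case/andP=> pp sp; rewrite big_cons -mulrA => e.
have z := nilf_evar R p.2 p.1.
have ne : p.2 != p.1 by rewrite -val_eqE neq_ltn pp orbT.
have eY : esub p.2 p.1 Y = 0.
  apply: (hh _ _ ne); rewrite mulr0 /esub -(psubstM z) -e (psubstM z) psubstB.
  by rewrite !(psubstX _ z) /evar eqxx eq_sym (negPf ne) subrr mul0r.
have [Y' Y'E] := factor_thm ne eY.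
apply: (IH Y' sp); apply: (lreg_psXB ne).
by rewrite -/(X _) -/(X _) e Y'E mulrCA.
Qed.

End Diff.

(** * Hall-Littlewood sums *)

Section HL.
Variables (R : comNzRingType) (F : mps 2 R).
Hypothesis HF : is_fgl F.
Let HU := fgl_unitP HF.
Hypothesis tf : forall (a : R) k, a *+ k.+1 = 0 -> a = 0.
Variables (r : nat) (t : 'I_r -> mps 1 R).
Hypothesis t1 : forall i, ord_ge 1 (t i).

Let r2 : GRing.lreg (1 *+ 2 : R).
Proof. by apply: mulrI0_lreg => a; rewrite mulr_natl => /tf. Qed.
Let r1 : GRing.lreg (1 : R). Proof. exact: lreg1. Qed.
Let rm1 : GRing.lreg (- 1 : R). Proof. exact/lregN/lreg1. Qed.

Definition dbl n (i : 'I_n) : mps n R := fgl_add F (psX R i) (psX R i).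

Lemma ord_dbl n (i : 'I_n) : ord_ge 1 (dbl i).
Proof. by apply: (ord_fadd HU); apply: ord_psX. Qed.
Lemma low_dbl n (i : 'I_n) : low 1 (dbl i) = (1 *+ 2 : R) *: 'X_i.
Proof. by rewrite (low_fadd HU (ord_psX R i) (ord_psX R i)) low_psX -mulr2n -scaler_nat. Qed.
Lemma lreg_dbl n (i : 'I_n) : GRing.lreg (dbl i).
Proof. exact: (lreg_lin1 (ord_dbl i) (low_dbl i)). Qed.

(** The factors t_i cover P and Q at once; an arbitrary family y in place of the variables keeps
    every specialisation in the same form. *)
Definition fnum n p (y : 'I_n -> mps p R) (phi : {ffun 'I_r -> 'I_n}) : mps p R :=
  (\prod_(i < r) ap (t i) (y (phi i))) * injprod phi (fun a b => fgl_add F (y a) (y b)).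
Definition fden n p (y : 'I_n -> mps p R) (phi : {ffun 'I_r -> 'I_n}) : mps p R :=
  injprod phi (fun a b => fsub F (y a) (y b)).
Definition admissible n p (y : 'I_n -> mps p R) :=
  nilf y /\ forall a b, a != b -> GRing.lreg (fsub F (y a) (y b)).

Section Family.
Variables (n p : nat).
Implicit Types (y : 'I_n -> mps p R) (phi : {ffun 'I_r -> 'I_n}).

Lemma lreg_fden y phi : admissible y -> GRing.lreg (fden y phi).
Proof.
move=> [_ h]; apply: lreg_prod => i _; apply: lreg_prod => b /avoids_neq; exact: h.
Qed.

Lemma psubst_injprod k (F2 : 'I_n -> 'I_n -> mps p R) phi (g : 'I_p -> mps k R) : nilf g ->
  psubst (injprod phi F2) g = injprod phi (fun a b => psubst (F2 a b) g).
Proof.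
move=> z; rewrite (psubst_prod z); apply: eq_bigr => i _; by rewrite (psubst_prod z).
Qed.

Lemma psubst_ap k (f : mps 1 R) (a : mps p R) (g : 'I_p -> mps k R) : ord_ge 1 a -> nilf g ->
  psubst (ap f a) g = ap f (psubst a g).
Proof. by move=> a1 z; rewrite /ap psubst_comp. Qed.

Lemma psubst_fnum k y (g : 'I_p -> mps k R) phi : nilf y -> nilf g ->
  psubst (fnum y phi) g = fnum (fun a => psubst (y a) g) phi.
Proof.
move=> yz z; rewrite /fnum (psubstM z) (psubst_prod z) (psubst_injprod _ _ z).
congr (_ * _); first by apply: eq_bigr => i _; rewrite psubst_ap.
by apply: eq_injprod => a b _; rewrite (fgl_add_subst F (yz a) (yz b) z).
Qed.

Lemma psubst_fden k y (g : 'I_p -> mps k R) phi : nilf y -> nilf g ->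
  psubst (fden y phi) g = fden (fun a => psubst (y a) g) phi.
Proof.
move=> yz z; rewrite /fden (psubst_injprod _ _ z).
by apply: eq_injprod => a b _; rewrite (fsub_subst HF (yz a) (yz b) z).
Qed.

Lemma fnum_ext y y' phi : y =1 y' -> fnum y phi = fnum y' phi.
Proof. by move/funext=> ->. Qed.
Lemma fden_ext y y' phi : y =1 y' -> fden y phi = fden y' phi.
Proof. by move/funext=> ->. Qed.

Lemma fnum_act (w : 'S_n) y phi : fnum y (pact w phi) = fnum (y \o w) phi.
Proof.
rewrite /fnum injprod_act; congr (_ * _).
by apply: eq_bigr => i _; rewrite ffunE.
Qed.
Lemma fden_act (w : 'S_n) y phi : fden y (pact w phi) = fden (y \o w) phi.
Proof. by rewrite /fden injprod_act. Qed.

End Family.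

Definition injp n : pred {ffun 'I_r -> 'I_n} := fun phi => injectiveb phi.

Lemma injp_small n phi : (n < r)%N -> @injp n phi = false.
Proof.
move=> nr; apply/negP => /injectiveP/leq_card; rewrite !card_ord => le.
by move: (leq_trans nr le); rewrite ltnn.
Qed.

Section Var.
Variable n : nat.
Let X (i : 'I_n) : mps n R := psX R i.
Let X1 i : ord_ge 1 (X i). Proof. exact: ord_psX. Qed.

Lemma lreg_fsub p (a b : mps p R) (c d : R) (i j : 'I_p) : i != j ->
  ord_ge 1 a -> ord_ge 1 b -> GRing.lreg c -> GRing.lreg d ->
  low 1 a - low 1 b = c *: 'X_i + d *: 'X_j -> GRing.lreg (fsub F a b).
Proof.
move=> ij a1 b1 rc rd e; apply: (lreg_lin2 ij (ord_fsub HF a1 b1) _ rc rd).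
by rewrite (low_fsub HF a1 b1).
Qed.

Lemma admissibleX : admissible X.
Proof.
split=> [i|a b ab]; first exact: X1.
apply: (lreg_fsub ab (X1 a) (X1 b) r1 rm1).
by rewrite !low_psX scale1r scaleN1r.
Qed.

Definition is_HL (f : mps n R) := is_fsum (@injp n) (fnum X) (fden X) f.

Lemma is_HL_small (f : mps n R) : (n < r)%N -> is_HL f -> f = 0.
Proof.
move=> nr /(_ 1 (fun=> 1)); rewrite big_pred0 => [|phi]; last exact: injp_small.
by rewrite mulr1; apply=> phi; rewrite injp_small.
Qed.

Lemma is_HL_subst p (y : 'I_n -> mps p R) f : admissible y -> is_HL f ->
  is_fsum (@injp n) (fnum y) (fden y) (psubst f y).
Proof.
move=> gy hf; have z := gy.1; have zX := nilf_psX R (n := n).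
have eX a : psubst (X a) y = y a by apply: psubstX.
have en phi : psubst (fnum X phi) y = fnum y phi.
  by rewrite psubst_fnum //; apply: fnum_ext.
have ed phi : psubst (fden X phi) y = fden y phi.
  by rewrite psubst_fden //; apply: fden_ext.
have := @fsum_morph _ _ _ (@injp n) (fnum X) (fden X) f (fun f => psubst f y)
  (psubstM z) (psubst1 z) (fun a b => psubstD y a b) (psubst0r _) _ hf.
move/(_ _)/fsum_ext; apply=> [i _|i _|i _] //=.
by rewrite ed; apply: lreg_fden.
Qed.

Lemma is_HL_uniq f g : is_HL f -> is_HL g -> f = g.
Proof.
by apply: fsum_uniq => phi _; apply: lreg_fden; apply: admissibleX.
Qed.

(** Permuting the variables only reindexes the injections. *)
Lemma is_HL_sym f : is_HL f -> ps_symmetric f.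
Proof.
move=> hf w; have z := nilf_perm R w.
apply: is_HL_uniq (hf).
have gw : admissible (X \o w).
  split=> [i|a b ab]; first exact: X1.
  by apply: admissibleX.2; rewrite (inj_eq perm_inj).
have hI : injective (pact (r := r) w^-1) := can_inj (@pactKV r n w).
have hP phi : @injp n (pact w^-1 phi) = @injp n phi by apply: pact_inj.
have hK (phi : {ffun 'I_r -> 'I_n}) : @injp n phi -> exists psi, pact w^-1 psi = phi.
  by move=> _; exists (pact w phi); rewrite pactK.
have := fsum_reindex hI hP hK (is_HL_subst gw hf).
apply: fsum_ext => phi _ /=.
  by rewrite -fnum_act pactKV.
by rewrite -fden_act pactKV.
Qed.

Hypothesis rn : (r <= n)%N.

(** The denominator covers the pairs whose first index is below r, with formal instead of ordinary
    differences. The cofactor supplies the quotients c, the remaining pairs and the sign of w. *)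
Lemma vdm_cofactor (w : 'S_n) : exists e, fden X (restr rn w) * e = vdm n R.
Proof.
have [c cE] : exists c : 'I_n -> 'I_n -> mps n R, forall a b, a != b ->
    X b - X a = fsub F (X a) (X b) * c a b.
  have [|c h] := @choice ('I_n * 'I_n) (mps n R) (fun p g => p.1 != p.2 ->
     X p.2 - X p.1 = fsub F (X p.1) (X p.2) * g).
    move=> [a b] /=; have [_|ne] := eqVneq a b; first by exists 0.
    by have [g gE] := fsub_factor HF ne; exists g.
  by exists (fun a b => c (a, b)) => a b; apply: (h (a, b)).
exists ((-1) ^+ w * (injprod (restr rn w) c *
  \prod_(i < n | ~~ (i < r)%N) \prod_(j < n | (i < j)%N) (X (w j) - X (w i)))).
rewrite /fden mulrCA [X in _ * X]mulrA -injprodM.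
rewrite -(eq_injprod _ (fun a b ab => cE a b ab)) -injprod_restr.
transitivity ((-1) ^+ w * \prod_(i < n) \prod_(j < n | (i < j)%N) (X (w j) - X (w i))).
  by rewrite [in RHS](bigID (fun i : 'I_n => (i < r)%N)).
by rewrite psperm_vdm signrMK.
Qed.

Lemma vdm_cofactors : exists e, forall phi, @injp n phi -> fden X phi * e phi = vdm n R.
Proof.
suff /choice[e eE] : forall phi, exists e, @injp n phi -> fden X phi * e = vdm n R by exists e.
move=> phi; have [/(restr_onto rn)[w <-]|ni] := boolP (injectiveb phi).
  by have [e eE] := vdm_cofactor w; exists e.
by exists 0 => h; case/negP: ni.
Qed.

Lemma is_HL_exists : exists f, is_HL f.
Proof.
have [e eE] := vdm_cofactors.
pose S := \sum_(phi | @injp n phi) fnum X phi * e phi.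
have hS (w : 'S_n) : psperm w S = (-1) ^+ w * S.
  have z := nilf_perm R w.
  have zX := nilf_psX R (n := n).
  have eX a : psubst (X a) (X \o w) = (X \o w) a by apply: psubstX.
  rewrite /psperm /S psubst_sum mulr_sumr.
  rewrite [RHS](reindex_onto (pact w) (pact w^-1)) => [|phi _]; last exact: pactKV.
  apply: eq_big => [phi|phi inj]; first by rewrite /injp pact_inj pactK eqxx andbT.
  rewrite (psubstM z) (psubst_fnum _ zX z) fnum_act (fnum_ext _ eX) mulrCA.
  congr (_ * _).
  have inj' : @injp n (pact w phi) by rewrite /injp pact_inj.
  apply: (lreg_fden (phi := pact w phi) admissibleX).
  rewrite mulrCA (eE _ inj') fden_act -(fden_ext _ eX) -(psubst_fden _ zX z).
  by rewrite -(psubstM z) (eE _ inj) -psperm_vdmE.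
have [|g gE] := @vdm_div n R S.
  move=> a b ab; have z := nilf_evar R a b; have zp := nilf_perm R (tperm a b).
  have := congr1 (esub a b) (hS (tperm a b)).
  rewrite odd_tperm ab expr1 mulN1r /esub /psperm psubst_comp // psubstN.
  have -> : psubst S (fun i => psubst (psX R (tperm a b i)) (evar R a b)) =
    psubst S (evar R a b).
    apply: psubst_ext => i; rewrite (psubstX _ z) /evar.
    case: tpermP => [->|->|/eqP ia /eqP ib]; rewrite ?eqxx ?if_same //.
  (* On x_a = x_b antisymmetry reads S = -S, and there is no 2-torsion. *)
  move=> e0; apply: (@lregMn _ _ 2) => [x|]; first exact: tf.
  by rewrite mulr2n {1}e0 addNr.
exists g; refine (@fsum_intro _ _ (@injp n) (fnum X) (fden X) g (vdm n R) e _ eE _); first exact: (@lreg_vdm n R).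
by rewrite mulrC -gE.
Qed.

(** f satisfies the equation that specifies [frac_sum], as each injection arises from (n-r)!
    permutations. Torsion freeness and regularity of the product of the denominators make the
    solution unique. *)
Lemma HL_sym_is_HL mono f :
    (forall w : 'S_n, psperm w mono = \prod_(i < r) ap (t i) (X (w (widen_ord rn i)))) ->
  is_HL f -> HL_sym F r mono = f.
Proof.
move=> hmono hf; rewrite /HL_sym.
set num := fun w : 'S_n => _; set den := fun w : 'S_n => _.
have zX := nilf_psX R (n := n).
have numE w : num w = fnum X (restr rn w).
  have z := nilf_perm R w.
  rewrite /num /psperm (psubstM z) -/(psperm w mono) hmono /fnum -injprod_restr.
  congr (_ * _); first by apply: eq_bigr => i _; rewrite ffunE.
  rewrite (psubst_prod z); apply: eq_bigr => i _; rewrite (psubst_prod z).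
  apply: eq_bigr => j _; rewrite (fgl_add_subst F (X1 i) (X1 j) z).
  by rewrite !(psubstX _ z).
have denE w : den w = fden X (restr rn w).
  have z := nilf_perm R w.
  rewrite /den /psperm /fden -injprod_restr.
  rewrite (psubst_prod z); apply: eq_bigr => i _; rewrite (psubst_prod z).
  apply: eq_bigr => j _; rewrite -/(fsub F (psX R i) (psX R j)).
  by rewrite (fsub_subst HF (X1 i) (X1 j) z) !(psubstX _ z).
have lden w : GRing.lreg (den w) by rewrite denE; apply/lreg_fden/admissibleX.
pose V := \prod_w den w.
have lV : GRing.lreg V by apply: lreg_prod => w _; apply: lden.
have VE w : V = den w * \prod_(w' | w' != w) den w' by rewrite /V (bigD1 w).
have he phi : exists e, @injp n phi -> fden X phi * e = V.
  have [/(restr_onto rn)[w <-]|ni] := boolP (injectiveb phi).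
    by exists (\prod_(w' | w' != w) den w') => _; rewrite -denE -VE.
  by exists 0 => h; case/negP: ni.
have [e eE] := choice he.
have eE' w : e (restr rn w) = \prod_(w' | w' != w) den w'.
  apply: (lden w); rewrite -VE denE; apply: eE; exact: restr_inj.
have eq_f : (f * V) *+ (n - r)`! = \sum_w num w * \prod_(w' | w' != w) den w'.
  rewrite (hf V e eE) -(sum_restr rn (fun phi => fnum X phi * e phi)).
  by apply: eq_bigr => w _; rewrite numE eE'.
have k0 := fact_gt0 (n - r).
rewrite /frac_sum; set S := [set g | _]%classic.
have := @xgetPex _ 0 S (ex_intro _ f eq_f).
set g := xget 0 S => gE; apply/eqP; rewrite -subr_eq0; apply/eqP/lV.
rewrite mulr0; apply: (@lregMn _ _ (n - r)`!); first by case: (_`!) k0 => // k _ a /tf.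
by rewrite mulrC mulrBl mulrnBl [X in X - _]gE [X in _ - X]eq_f subrr.
Qed.

End Var.
End HL.

(** * Stability under setting the last variable to 0 *)

Section HL.
Variables (R : comNzRingType) (F : mps 2 R).
Hypothesis HF : is_fgl F.
Let HU := fgl_unitP HF.
Hypothesis tf : forall (a : R) k, a *+ k.+1 = 0 -> a = 0.
Variables (r : nat) (t : 'I_r -> mps 1 R).
Hypothesis t1 : forall i, ord_ge 1 (t i).

Let r2 : GRing.lreg (1 *+ 2 : R).
Proof. by apply: mulrI0_lreg => a; rewrite mulr_natl => /tf. Qed.
Let r1 : GRing.lreg (1 : R). Proof. exact: lreg1. Qed.
Let rm1 : GRing.lreg (- 1 : R). Proof. exact/lregN/lreg1. Qed.

Lemma ap_zero i n : ap (t i) (0 : mps n R) = 0.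
Proof. rewrite /ap psubst0; have /ord_ge1P -> := t1 i; exact: rmorph0. Qed.

Section Stab.
Variable n : nat.

Definition widenv (i : 'I_n.+1) : mps n R := if unlift ord_max i is Some k then psX R k else 0.

Lemma widenv_max : widenv ord_max = 0. Proof. by rewrite /widenv unlift_none. Qed.
Lemma widenv_lift k : widenv (lift ord_max k) = psX R k.
Proof. by rewrite /widenv liftK. Qed.

Lemma admissible_widenv : admissible F widenv.
Proof.
have oX (k : 'I_n) : ord_ge 1 (psX R k) by apply: ord_psX.
have o0 : ord_ge 1 (0 : mps n R) by [].
split=> [i|a b].
  by rewrite /widenv; case: unlift.
case: (unliftP ord_max a) => [k ->|->]; case: (unliftP ord_max b) => [l ->|->];
  rewrite ?widenv_max ?widenv_lift => ne.
- apply: (@lreg_fsub _ _ HF _ _ _ 1 (- 1) k l) => //.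
    by apply: contraNneq ne => ->.
  by rewrite !low_psX scale1r scaleN1r.
- apply: (@lreg_lin1 _ _ k _ 1) => //; first exact: ord_fsub.
  by rewrite (low_fsub HF) // low_psX low0 subr0 scale1r.
- apply: (@lreg_lin1 _ _ l _ (-1)) => //; first exact: ord_fsub.
  by rewrite (low_fsub HF) // low_psX low0 sub0r scaleN1r.
by rewrite eqxx in ne.
Qed.

Definition liftf (psi : {ffun 'I_r -> 'I_n}) : {ffun 'I_r -> 'I_n.+1} :=
  [ffun i => lift ord_max (psi i)].

Lemma liftf_inj : injective liftf.
Proof.
move=> p q /ffunP e; apply/ffunP => i; have := e i; rewrite !ffunE.
exact: lift_inj.
Qed.

Lemma injprod_lift (A : comNzRingType) psi (F2 : 'I_n.+1 -> 'I_n.+1 -> A) :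
  injprod (liftf psi) F2 = (\prod_(i < r) F2 (lift ord_max (psi i)) ord_max) *
    injprod psi (fun a b => F2 (lift ord_max a) (lift ord_max b)).
Proof.
rewrite /injprod -big_split; apply: eq_bigr => i _.
have am : avoids (liftf psi) i ord_max.
  by apply/forallP => k; rewrite ffunE eq_sym neq_lift implybT.
rewrite (bigD1 ord_max) //= ffunE; congr (_ * _).
rewrite (reindex_omap (lift ord_max) (unlift ord_max)) /=; last first.
  by move=> j /andP[_ jm]; case: unliftP => [k ->|e] //; rewrite e eqxx in jm.
apply: eq_big => [j|j _ //].
rewrite liftK eqxx andbT eq_sym neq_lift andbT.
by apply: eq_forallb => k; rewrite ffunE (inj_eq lift_inj).
Qed.

(** Injections that meet the last index lose their numerator, since t_i has no constant term. For
    the others the factors x +_F 0 and x -_F 0 both equal x and cancel. *)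
Lemma is_HL_stab (f : mps n.+1 R) (g : mps n R) : is_HL F t f -> is_HL F t g -> set_last0 f = g.
Proof.
move=> hf hg; have gy := admissible_widenv; have oX (k : 'I_n) : ord_ge 1 (psX R k) by apply: ord_psX.
have hs := is_HL_subst HF gy hf.
pose Q (phi : {ffun 'I_r -> 'I_n.+1}) := [forall i, phi i != ord_max].
have hl phi : @injp r n.+1 phi -> GRing.lreg (fden F widenv phi) by move=> _; apply: lreg_fden.
have hQ phi : @injp r n.+1 phi -> ~~ Q phi -> fnum F t widenv phi = 0.
  move=> _; rewrite negb_forall => /existsP[i]; rewrite negbK => /eqP e.
  by rewrite /fnum (bigD1 i) //= e widenv_max ap_zero !mul0r.
have h1 := fsum_drop hl hQ hs.
have hP psi : @injp r n.+1 (liftf psi) && Q (liftf psi) = @injp r n psi.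
  have -> : Q (liftf psi).
    by apply/forallP => i; rewrite ffunE eq_sym neq_lift.
  rewrite andbT; apply/injectiveP/injectiveP => h i k.
    by move=> e; apply: h; rewrite !ffunE e.
  by rewrite !ffunE => /lift_inj/h.
have hK phi : @injp r n.+1 phi && Q phi -> exists psi, liftf psi = phi.
  move=> /andP[_ /forallP q].
  have ex i : exists k, phi i == lift ord_max k.
    by case: (unliftP ord_max (phi i)) (q i) => [k ->|->]; [exists k|rewrite eqxx].
  exists [ffun i => xchoose (ex i)]; apply/ffunP => i; rewrite !ffunE.
  exact/esym/eqP/(xchooseP (ex i)).
have h2 := fsum_reindex liftf_inj hP hK h1.
pose a (psi : {ffun 'I_r -> 'I_n}) := \prod_(i < r) psX R (psi i).
have en psi : fnum F t widenv (liftf psi) = a psi * fnum F t (@psX n R) psi.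
  rewrite /fnum injprod_lift mulrCA; congr (_ * (_ * _)).
  - by apply: eq_bigr => i _; rewrite widenv_lift widenv_max (faddr0 HU).
  - by apply: eq_bigr => i _; rewrite ffunE widenv_lift.
  by apply: eq_injprod => b c _; rewrite !widenv_lift.
have ed psi : fden F widenv (liftf psi) = a psi * fden F (@psX n R) psi.
  rewrite /fden injprod_lift; congr (_ * _).
    apply: eq_bigr => i _; rewrite widenv_lift widenv_max /fsub (fopp0 HF).
    exact: (faddr0 HU).
  by apply: eq_injprod => b c _; rewrite !widenv_lift.
have h3 : is_HL F t (set_last0 f).
  apply: fsum_cancel (fun psi _ => en psi) (fun psi _ => ed psi) h2.
  by move=> psi _ /=; apply: lreg_fden gy.
exact: (is_HL_uniq HF h3 hg).
Qed.
End Stab.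
End HL.

(** * The cancellation property and divisibility by [2](x) *)

Section HL.
Variables (R : comNzRingType) (F : mps 2 R).
Hypothesis HF : is_fgl F.
Let HU := fgl_unitP HF.
Hypothesis tf : forall (a : R) k, a *+ k.+1 = 0 -> a = 0.
Variables (r : nat) (t : 'I_r -> mps 1 R).
Hypothesis t1 : forall i, ord_ge 1 (t i).

Let r2 : GRing.lreg (1 *+ 2 : R).
Proof. by apply: mulrI0_lreg => a; rewrite mulr_natl => /tf. Qed.
Let rm2 : GRing.lreg (- (1 *+ 2) : R). Proof. exact: lregN. Qed.
Let r1 : GRing.lreg (1 : R). Proof. exact: lreg1. Qed.
Let rm1 : GRing.lreg (- 1 : R). Proof. exact/lregN/lreg1. Qed.

Variable n : nat.
Let X (i : 'I_n) : mps n R := psX R i.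
Let X1 i : ord_ge 1 (X i). Proof. exact: ord_psX. Qed.
Implicit Types (phi : {ffun 'I_r -> 'I_n}).

Section Split.
Variable Z : pred 'I_n.

Definition misses phi := [forall k, ~~ Z (phi k)].

(** Z is the set of variables about to be specialised. An index that phi never takes is avoided at
    every stage, so it is paired with all values of phi. *)
Lemma injprod_split (A : comNzRingType) phi (F2 G2 : 'I_n -> 'I_n -> A) : misses phi ->
  (forall a b, ~~ Z a -> ~~ Z b -> F2 a b = G2 a b) ->
  injprod phi F2 = (\prod_(k < r) \prod_(z | Z z) F2 (phi k) z) *
     injprod phi (fun a b => if Z b then 1 else G2 a b).
Proof.
move=> /forallP m e; rewrite /injprod -big_split; apply: eq_bigr => k _ /=.
rewrite (bigID Z) /=; congr (_ * _).
  apply: eq_bigl => z; case Zz: (Z z); rewrite ?andbF // andbT.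
  apply/forallP => l; apply/implyP => _; apply: contraTneq Zz => <-; exact: m.
rewrite [RHS](bigID Z) /= [X in _ = X * _]big1 ?mul1r => [|z /andP[_ ->] //].
by apply: eq_bigr => z /andP[_ Zz]; rewrite (negPf Zz) e // m.
Qed.

(** Zero on Z makes [numZ] and [denZ] free of the variables in Z for every phi. *)
Definition offZ a : mps n R := if Z a then 0 else X a.
Lemma ord_offZ a : ord_ge 1 (offZ a). Proof. by rewrite /offZ; case: ifP. Qed.

Definition numZ phi := (\prod_(k < r) ap (t k) (offZ (phi k))) *
  injprod phi (fun a b => if Z b then 1 else fgl_add F (offZ a) (offZ b)).
Definition denZ phi :=
  injprod phi (fun a b => if Z b then 1 else fsub F (offZ a) (offZ b)).

Lemma fnum_split y phi : (forall a, ~~ Z a -> y a = X a) -> misses phi ->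
  fnum F t y phi = (\prod_(k < r) \prod_(z | Z z) fgl_add F (X (phi k)) (y z)) * numZ phi.
Proof.
move=> yE m; have m' := forallP m.
rewrite /fnum (injprod_split (G2 := fun a b => fgl_add F (offZ a) (offZ b)) m); last first.
  by move=> a b Za Zb; rewrite !yE // /offZ (negPf Za) (negPf Zb).
rewrite mulrCA; congr (_ * (_ * _)).
  by apply: eq_bigr => k _; apply: eq_bigr => z _; rewrite yE.
by apply: eq_bigr => k _; rewrite yE // /offZ (negPf (m' k)).
Qed.

Lemma fden_split y phi : (forall a, ~~ Z a -> y a = X a) -> misses phi ->
  fden F y phi = (\prod_(k < r) \prod_(z | Z z) fsub F (X (phi k)) (y z)) * denZ phi.
Proof.
move=> yE m; have m' := forallP m.
rewrite /fden (injprod_split (G2 := fun a b => fsub F (offZ a) (offZ b)) m); last first.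
  by move=> a b Za Zb; rewrite !yE // /offZ (negPf Za) (negPf Zb).
by congr (_ * _); apply: eq_bigr => k _; apply: eq_bigr => z _; rewrite yE.
Qed.

Lemma zsub_offZ i a : Z i -> zsub i (offZ a) = offZ a.
Proof.
move=> Zi; rewrite /offZ; case: ifP => Za; first by rewrite /zsub psubst0r.
by rewrite /X zsubX ifN //; apply: contraFneq Za => ->.
Qed.

Lemma zsub_numZ i phi : Z i -> zsub i (numZ phi) = numZ phi.
Proof.
move=> Zi; have z := nilf_zvar R i; rewrite /zsub /numZ (psubstM z) (psubst_prod z).
rewrite (psubst_injprod _ _ z); congr (_ * _).
  by apply: eq_bigr => k _; rewrite (psubst_ap _ (ord_offZ _) z) -/(zsub i _) zsub_offZ.
apply: eq_injprod => a b _; case: ifP => Zb; first exact: psubst1 z.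
rewrite (fgl_add_subst F (ord_offZ _) (ord_offZ _) z) -!/(zsub i _).
by rewrite !zsub_offZ.
Qed.

Lemma zsub_denZ i phi : Z i -> zsub i (denZ phi) = denZ phi.
Proof.
move=> Zi; have z := nilf_zvar R i; rewrite /zsub /denZ.
rewrite (psubst_injprod _ _ z).
apply: eq_injprod => a b _; case: ifP => Zb; first exact: psubst1 z.
rewrite (fsub_subst HF (ord_offZ _) (ord_offZ _) z) -!/(zsub i _).
by rewrite !zsub_offZ.
Qed.

Lemma lreg_denZ phi : misses phi -> GRing.lreg (denZ phi).
Proof.
move=> m; have := lreg_fden (phi := phi) (admissibleX HF n).
by rewrite (fden_split (y := X) (fun _ _ => erefl) m) => /lreg_factor.
Qed.

Lemma fsum_numZ_zsub i f : Z i ->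
  is_fsum (fun phi => @injp r n phi && misses phi) numZ denZ f -> zsub i f = f.
Proof.
move=> Zi hf; have z := nilf_zvar R i.
have h := @fsum_morph _ _ _ _ numZ denZ f (zsub i)
  (psubstM z) (psubst1 z) (fun a b => psubstD _ a b) (psubst0r _) _ hf.
have h' : is_fsum (fun phi => @injp r n phi && misses phi) numZ denZ (zsub i f).
  apply: fsum_ext (h _) => phi /andP[_ m] /=.
  - exact: zsub_numZ.
  - exact: zsub_denZ.
  by rewrite zsub_denZ //; apply: lreg_denZ.
by apply: fsum_uniq h' hf => phi /andP[_ m]; apply: lreg_denZ.
Qed.
End Split.

(** Injections that meet i or j have a factor t +_F (inverse of t) = 0. For the others the factors
    with t and its inverse are the same above and below. What remains is free of x_i, so setting x_i
    = 0 changes nothing. *)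
Lemma is_HL_cancel (f : mps n R) : is_HL F t f -> cancellation F f.
Proof.
move=> hf i j i0 j1.
have ij : i != j by rewrite -val_eqE /= i0 j1.
pose Z := pred2 i j.
pose y (k : 'I_n) := if k == i then X i else if k == j then fgl_opp F (X i) else X k.
have oi := ord_fopp HF (X1 i).
have oy k : ord_ge 1 (y k) by rewrite /y; do 2!case: ifP => // _.
have yi : y i = X i by rewrite /y eqxx.
have yj : y j = fgl_opp F (X i) by rewrite /y eq_sym (negPf ij) eqxx.
have yZ a : ~~ Z a -> y a = X a.
  by rewrite /= negb_or /y => /andP[/negPf -> /negPf ->].
pose cf (k : 'I_n) : R := if k == j then -1 else 1.
pose ix (k : 'I_n) := if k == j then i else k.
have lowy k : low 1 (y k) = cf k *: 'X_(ix k).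
  rewrite /y /cf /ix; case: (k =P i) => [->|_]; last case: ifP => _.
  - by rewrite (negPf ij) low_psX scale1r.
  - by rewrite (low_fopp HF (X1 i)) low_psX scaleN1r.
  by rewrite low_psX scale1r.
have rcf k : GRing.lreg (cf k) by rewrite /cf; case: ifP.
have rcfN k : GRing.lreg (- cf k) by apply: lregN.
(* For the pair i, j itself the lowest form of the denominator is 2 x_i up to sign, regular because
   there is no 2-torsion. *)
have gy : admissible F y.
  split=> // a b ab; have [e|ne] := eqVneq (ix a) (ix b); last first.
    apply: (lreg_fsub HF ne (oy a) (oy b) (rcf a) (rcfN b)).
    by rewrite !lowy scaleNr.
  have o := ord_fsub HF (oy a) (oy b).
  apply: (lreg_lin1 (a := cf a - cf b) o).
    by rewrite (low_fsub HF (oy a) (oy b)) !lowy e scalerBl.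
  move: e ab; rewrite /ix /cf; case: (a =P j) => [->|_]; case: (b =P j) => [->|_].
  - by rewrite eqxx.
  - by rewrite -opprD -mulr2n.
  - by rewrite opprK -mulr2n.
  - by move=> ->; rewrite eqxx.
have hs := is_HL_subst HF gy hf.
have hl phi : @injp r n phi -> GRing.lreg (fden F y phi) by move=> _; apply: lreg_fden.
have hQ phi : @injp r n phi -> ~~ misses Z phi -> fnum F t y phi = 0.
  move=> /injectiveP inj; rewrite negb_forall => /existsP[k0]; rewrite negbK => Zk0.
  (* At the first k that meets i or j, the other of the two has not been taken yet, so the vanishing
     factor occurs in the product. *)
  pose k := [arg min_(k < k0 | Z (phi k)) (k : nat)].
  have [Zk kmin] : Z (phi k) /\ forall l, Z (phi l) -> (k <= l)%N.
    by rewrite /k; case: arg_minnP => // l Zl lmin.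
  pose o := if phi k == i then j else i.
  have fo : fgl_add F (y (phi k)) (y o) = 0.
    rewrite /o; case/orP: Zk => /eqP e.
      rewrite e eqxx yi yj; exact: (faddN HF (X1 i)).
    by rewrite e [j == i]eq_sym (negPf ij) yi yj (faddC HF oi (X1 i)) (faddN HF).
  have ok : avoids phi k o.
    apply/forallP => l; apply/implyP => lk; apply: contraTneq (Zk) => e.
    have lk' : l = k.
      apply/val_inj/eqP; rewrite eqn_leq lk kmin // e /o.
      by case: ifP => _; rewrite /= eqxx ?orbT.
    move: e; rewrite lk' /o; case: ifP => [/eqP -> /eqP|ni e].
      by rewrite (negPf ij).
    by rewrite e eqxx in ni.
  rewrite /fnum /injprod [X in _ * X](bigD1 k) //= [X in _ * (X * _)](bigD1 o) //= fo.
  by rewrite !mul0r mulr0.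
have hZ (G : 'I_n -> mps n R) : \prod_(a | Z a) G a = G i * G j.
  rewrite (bigD1 i) /= ?eqxx // (bigD1 j) /=; last by rewrite eqxx orbT eq_sym ij.
  rewrite big1 ?mulr1 // => a; rewrite andbAC -andbA andbC -negb_or orbC.
  by case: (_ || _); rewrite ?andbF.
have h1 := fsum_drop hl hQ hs.
have h2 : is_fsum (fun phi => @injp r n phi && misses Z phi) (numZ Z) (denZ Z) (psubst f y).
  apply: fsum_cancel h1 => [phi /andP[_ m]|phi /andP[_ m]|phi /andP[_ m]].
  - exact: lreg_fden.
  - exact: fnum_split.
  rewrite (fden_split yZ m); congr (_ * _); apply: eq_bigr => k _.
  by rewrite !hZ yi yj /fsub (foppK HF (X1 i)) mulrC.
have Zi : Z i by rewrite /= eqxx.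
rewrite -[LHS](fsum_numZ_zsub Zi h2) /zsub psubst_comp //; last exact: nilf_zvar.
have z := nilf_zvar R i.
apply: psubst_ext => k; rewrite /y; case: (k =P i) => [->|/eqP ki] /=.
  by rewrite (psubstX _ z) /zvar eqxx.
case: ifP => kj; last by rewrite (psubstX _ z) /zvar (negPf ki).
by rewrite (fopp_subst F (X1 i) z) (psubstX _ z) /zvar eqxx (fopp0 HF).
Qed.

(** Terms that meet i0 contain t_k(x_i0), a multiple of h = [2](x_i0). In the others the factors
    with x_i0 above and below are congruent modulo h by [fadd_fsub]. Both facts are used after
    multiplication by the Vandermonde determinant, which is then cancelled modulo h. *)
Lemma is_HL_plus (f : mps n R) (i0 : 'I_n) : is_HL F t f ->
    (forall k, exists s, t k = dbl F ord0 * s) ->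
  exists g, f - zsub i0 f = dbl F i0 * g.
Proof.
move=> hf ht; set h := dbl F i0.
pose Z := pred1 i0; have Zi : Z i0 by rewrite /= eqxx.
have z := nilf_zvar R i0.
have th k : exists s, ap (t k) (X i0) = h * s.
  have [s sE] := ht k; exists (ap s (X i0)).
  have zz : nilf (fun _ : 'I_1 => X i0) by [].
  have o : ord_ge 1 (psX R (ord0 : 'I_1)) by apply: ord_psX.
  by rewrite sE /dbl /ap (psubstM zz) (fgl_add_subst F o o zz) (psubstX _ zz).
have oz a : ord_ge 1 (zvar R i0 a) by apply: z.
have gz : admissible F (zvar R i0).
  split=> // a b ab; have o := ord_fsub HF (oz a) (oz b).
  rewrite /zvar in o *; case: (a =P i0) o => [ai|ai] o; case: (b =P i0) o => [bi|bi] o.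
  - by rewrite ai bi eqxx in ab.
  - apply: (lreg_lin1 (i := b) (a := -1) o) => //.
    by rewrite (low_fsub HF) // low_psX low0 sub0r scaleN1r.
  - apply: (lreg_lin1 (i := a) (a := 1) o) => //.
    by rewrite (low_fsub HF) // low_psX low0 subr0 scale1r.
  apply: (lreg_fsub HF ab (X1 a) (X1 b) r1 rm1).
  by rewrite !low_psX scale1r scaleN1r.
have hs := is_HL_subst HF gz hf.
have hl phi : @injp r n phi -> GRing.lreg (fden F (zvar R i0) phi) by move=> _; apply: lreg_fden.
have hQ phi : @injp r n phi -> ~~ misses Z phi -> fnum F t (zvar R i0) phi = 0.
  move=> _; rewrite negb_forall => /existsP[k]; rewrite negbK => /eqP e.
  by rewrite /fnum (bigD1 k) //= e {1}/zvar eqxx (ap_zero t1) !mul0r.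
have h1 := fsum_drop hl hQ hs.
have zZ a : ~~ Z a -> zvar R i0 a = X a by rewrite /zvar /= => /negPf ->.
have h2 : is_fsum (fun phi => @injp r n phi && misses Z phi) (numZ Z) (denZ Z) (zsub i0 f).
  apply: fsum_cancel h1 => [phi /andP[_ m]|phi /andP[_ m]|phi /andP[_ m]].
  - exact: lreg_fden.
  - exact: fnum_split.
  rewrite (fden_split zZ m); congr (_ * _); apply: eq_bigr => k _.
  by rewrite !big_pred1_eq /zvar eqxx /fsub (fopp0 HF).
have [rn|nr] := leqP r n; last first.
  by exists 0; rewrite (is_HL_small nr hf) /zsub psubst0r subrr mulr0.
have [e eE] := vdm_cofactors HF rn.
pose N phi := \prod_(k < r) \prod_(a | Z a) fgl_add F (X (phi k)) (X a).
pose M phi := \prod_(k < r) \prod_(a | Z a) fsub F (X (phi k)) (X a).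
have xX a : ~~ Z a -> X a = X a by [].
have q1 : zsub i0 f * vdm n R =
    \sum_(phi | @injp r n phi && misses Z phi) numZ Z phi * (M phi * e phi).
  apply: h2 => phi /andP[inj m].
  by rewrite mulrCA mulrA -(fden_split xX m) eE.
have q2 := hf _ _ eE; rewrite (bigID (misses Z)) /= in q2.
have NM phi : exists c, N phi - M phi = h * c.
  rewrite /N /M; elim/big_ind2: _ => [|a b a' b' [c cE] [c' cE']|k _].
  - by exists 0; rewrite subrr mulr0.
  - exists (c * b' + a * c').
    transitivity ((b - a) * b' + a * (b' - a')); first by ring.
    by rewrite cE cE'; ring.
  rewrite !big_pred1_eq (fadd_fsub HF (X1 _) (X1 i0)).
  have o := ord_fsub HF (X1 (phi k)) (X1 i0); have o' := ord_fadd HU (X1 i0) (X1 i0).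
  rewrite (fadd_decomp HU o o') -/(dbl F i0) -/h.
  exists (1 + fsub F (X (phi k)) (X i0) * psubst (fgl_rest F) (ppair (fsub F (X (phi k)) (X i0)) h)).
  ring.
have dsum (P : pred {ffun 'I_r -> 'I_n}) G : (forall phi, P phi -> exists c, G phi = h * c) ->
    exists c, \sum_(phi | P phi) G phi = h * c.
  move=> hG; elim/big_ind: _ => [|a b [c ->] [c' ->]|phi /hG //].
    by exists 0; rewrite mulr0.
  by exists (c + c'); rewrite mulrDr.
have [Y YE] : exists Y, vdm n R * (f - zsub i0 f) = h * Y.
  rewrite mulrC mulrBl q1 q2.
  have [c cE] : exists c, \sum_(phi | @injp r n phi && ~~ misses Z phi) fnum F t X phi * e phi = h * c.
    apply: dsum => phi /andP[_]; rewrite negb_forall => /existsP[k]; rewrite negbK => /eqP ek.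
    have [s sE] := th k; rewrite /fnum (bigD1 k) //= ek sE -!mulrA.
    by eexists.
  have [c' cE'] : exists c, \sum_(phi | @injp r n phi && misses Z phi)
      (fnum F t X phi * e phi - numZ Z phi * (M phi * e phi)) = h * c.
    apply: dsum => phi /andP[_ m]; have [c0 cE0] := NM phi.
    rewrite (fnum_split xX m) -/(N phi).
    exists (c0 * (numZ Z phi * e phi)); rewrite [RHS]mulrA -cE0; ring.
  exists (c' + c); rewrite mulrDr -cE -cE' sumrB; ring.
apply: (vdm_div_ideal _ YE) => a b ab; have ze := nilf_evar R a b.
rewrite /esub /h /dbl (fgl_add_subst F (X1 i0) (X1 i0) ze) (psubstX _ ze) /evar.
by case: ifP => _; apply: (lreg_dbl HF tf).
Qed.
End HL.

(** * The order of a Hall-Littlewood sum *)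

Section HL.
Variables (R : comNzRingType) (F : mps 2 R).
Hypothesis HF : is_fgl F.
Let HU := fgl_unitP HF.
Hypothesis tf : forall (a : R) k, a *+ k.+1 = 0 -> a = 0.
Variables (r : nat) (t : 'I_r -> mps 1 R) (la : 'I_r -> nat).
Hypothesis tla : forall i, ord_ge (la i) (t i).

Section Order.
Variable n : nat.
Let X (i : 'I_n) : mps n R := psX R i.
Let X1 i : ord_ge 1 (X i). Proof. exact: ord_psX. Qed.
Implicit Types (phi : {ffun 'I_r -> 'I_n}).

Definition npairs phi := (\sum_(i < r) \sum_(y | avoids phi i y) 1)%N.
Definition nvdm := (\sum_(p : 'I_n * 'I_n | (p.1 < p.2)%N) 1)%N.

Lemma ord_vdm : ord_ge nvdm (vdm n R).
Proof. by apply: ord_ge_prod => p _; apply: ord_geB; apply: X1. Qed.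

Lemma low_vdm : low nvdm (vdm n R) =
  \prod_(p : 'I_n * 'I_n | (p.1 < p.2)%N) ('X_p.2 - 'X_p.1).
Proof.
rewrite /nvdm low_prod => [|p _]; last by apply: ord_geB; apply: X1.
by apply: eq_bigr => p _; rewrite lowB !low_psX.
Qed.

Lemma lreg_mXB (a b : 'I_n) : a != b -> GRing.lreg ('X_a - 'X_b : {mpoly R[n]}).
Proof.
move=> ab p q e; apply: (@ps_of_inj n R); apply: (lreg_psXB ab).
by rewrite -!(ps_ofX R) -rmorphB -!rmorphM e.
Qed.

Lemma lreg_low_vdm : GRing.lreg (low nvdm (vdm n R)).
Proof.
rewrite low_vdm; apply: lreg_prod => p lt; apply: lreg_mXB.
by rewrite -val_eqE neq_ltn lt orbT.
Qed.

Lemma ord_fden phi : ord_ge (npairs phi) (fden F X phi).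
Proof.
apply: ord_ge_prod => i _; apply: ord_ge_prod => y _.
exact: (ord_fsub HF (X1 _) (X1 _)).
Qed.

Lemma low_fden phi : low (npairs phi) (fden F X phi) =
  \prod_(i < r) \prod_(y | avoids phi i y) ('X_(phi i) - 'X_y).
Proof.
have o a b : ord_ge 1 (fsub F (X a) (X b)) by exact: (ord_fsub HF (X1 _) (X1 _)).
rewrite /npairs /fden /injprod low_prod => [|i _]; last first.
  by apply: ord_ge_prod => y _; apply: o.
apply: eq_bigr => i _; rewrite low_prod => [|y _]; last exact: o.
by apply: eq_bigr => y _; rewrite (low_fsub HF (X1 _) (X1 _)) !low_psX.
Qed.

Lemma lreg_low_fden phi : GRing.lreg (low (npairs phi) (fden F X phi)).
Proof.
rewrite low_fden; apply: lreg_prod => i _; apply: lreg_prod => y /avoids_neq.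
exact: lreg_mXB.
Qed.

Lemma ord_fnum phi : ord_ge (\sum_i la i + npairs phi) (fnum F t X phi).
Proof.
apply: ord_geM.
  by apply: ord_ge_prod => i _; apply: ord_ap.
apply: ord_ge_prod => i _; apply: ord_ge_prod => y _.
exact: (ord_fadd HU (X1 _) (X1 _)).
Qed.

(** The lowest forms of the denominator and of the Vandermonde determinant are products of
    differences of variables, hence regular, so orders subtract exactly. *)
Lemma ord_cofactor phi e : fden F X phi * e = vdm n R ->
  (npairs phi <= nvdm)%N /\ ord_ge (nvdm - npairs phi) e.
Proof.
move=> eE; have le : (npairs phi <= nvdm)%N.
  rewrite leqNgt; apply/negP => lt.
  have h : ord_ge nvdm.+1 (vdm n R).
    by rewrite -eE; apply: ord_geMr; apply: ord_geW lt (@ord_fden phi).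
  have /low_eq0 e0 := ord_vdm; have := lreg_low_vdm; rewrite (e0.2 h) => /(_ 0 1).
  by rewrite !mul0r => /(_ erefl)/eqP; rewrite eq_sym oner_eq0.
split=> //; apply: (ord_ge_cancel (@ord_fden phi) (@lreg_low_fden phi)).
by rewrite subnKC // eE; apply: ord_vdm.
Qed.

(** Numerator and denominator have equally many factors of order 1, so after clearing denominators
    each term exceeds the Vandermonde order by the sum of the la_i. *)
Lemma is_HL_ord (f : mps n R) : is_HL F t f -> ord_ge (\sum_i la i) f.
Proof.
move=> hf; have [rn|nr] := leqP r n; last by rewrite (is_HL_small nr hf); apply: ord_ge_zero.
have [e eE] := vdm_cofactors HF rn; have q := hf _ _ eE.
apply: (ord_ge_cancel ord_vdm lreg_low_vdm); rewrite mulrC q.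
apply: ord_ge_sum => phi inj; have [le o] := ord_cofactor (eE _ inj).
rewrite addnC -(subnKC le) addnA; apply: ord_geM o; exact: ord_fnum.
Qed.
End Order.
End HL.

(** * Leading monomials *)

Section LeadTerm.
Import Order.TTheory.
Variables (n : nat) (R : comNzRingType).
Implicit Types (p q : {mpoly R[n]}) (m : 'X_{1..n}).

(** c may be 0, so m only bounds the leading monomial; no case distinction on vanishing coefficients
    is then necessary. *)
Definition leadterm p m (c : R) := (forall m', (m < m')%O -> p@_m' = 0) /\ p@_m = c.

Lemma leadterm_le p m c : leadterm p m c -> (mlead p <= m)%O.
Proof.
move=> [h _]; rewrite leNgt; apply/negP => lt; have := h _ lt.
move/eqP; rewrite mleadc_eq0 => /eqP p0; move: lt; rewrite p0 mlead0.
by rewrite ltNge le0x.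
Qed.

Lemma leadtermI p m : (mlead p <= m)%O -> leadterm p m p@_m.
Proof.
by move=> h; split=> // m' lt; apply: mcoeff_gt_mlead; apply: le_lt_trans lt.
Qed.

Lemma leadtermM p q m m' c c' : leadterm p m c -> leadterm q m' c' ->
  leadterm (p * q) (m + m')%MM (c * c').
Proof.
move=> hp hq; have lp := leadterm_le hp; have lq := leadterm_le hq.
rewrite -hp.2 -hq.2 -mleadcMW //; apply: leadtermI.
by apply: le_trans (mleadM_le p q) _; apply: lem_add.
Qed.

Lemma leadterm1 : leadterm 1 0%MM 1.
Proof.
split=> [m' lt|]; rewrite mcoeff1 ?eqxx //.
by case: eqP lt => // ->; rewrite ltxx.
Qed.

Lemma leadterm_prod (I : Type) (s : seq I) (P : pred I) (G : I -> {mpoly R[n]}) (e : I -> 'X_{1..n}) :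
  (forall i, P i -> leadterm (G i) (e i) 1) ->
  leadterm (\prod_(i <- s | P i) G i) (\sum_(i <- s | P i) e i)%MM 1.
Proof.
move=> h; elim/big_rec2: _ => [|i a b Pi hb]; first exact: leadterm1.
by rewrite -[1]mul1r; apply: leadtermM => //; apply: h.
Qed.

Lemma ltmc_U (i j : 'I_n) : (i < j)%N -> (U_(j)%MM < U_(i)%MM)%O.
Proof.
move=> ij; apply/ltmcP; rewrite ?mdeg1 //; exists i => [k ki|].
  by rewrite !mnm1E -!val_eqE /= !gtn_eqF // (ltn_trans ki).
by rewrite !mnm1E eqxx -val_eqE /= gtn_eqF.
Qed.

Lemma leadterm_lin (i j : 'I_n) (a : R) : (i < j)%N ->
  leadterm ('X_i + a *: 'X_j) U_(i)%MM 1.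
Proof.
move=> ij; have lt := ltmc_U ij.
split=> [m' lt'|]; rewrite mcoeffD mcoeffZ !mcoeffX.
  have lt2 := lt_trans lt lt'.
  by rewrite !(lt_eqF) // mulr0 addr0.
by rewrite eqxx (lt_eqF lt) mulr0 addr0.
Qed.

Lemma leadterm_div v g m m' c : leadterm v m 1 -> leadterm (v * g) (m + m')%MM c ->
  leadterm g m' c.
Proof.
move=> hv hvg; have lv := leadterm_le hv.
have part_coef : mlead v = m.
  apply/le_anti; rewrite lv /=; apply: msupp_le_mlead.
  by rewrite mcoeff_msupp hv.2 oner_eq0.
have [g0|gn] := eqVneq g 0.
  move: hvg; rewrite g0 mulr0 => -[_]; rewrite mcoeff0 => <-.
  by split=> [m'' _|]; rewrite mcoeff0.
have lg : (mlead g <= m')%O.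
  have := leadterm_le hvg; rewrite mleadM_proper ?part_coef ?lemc_add2r //.
  by rewrite hv.2 mul1r mleadc_eq0.
have := mleadcMW lv lg; rewrite hvg.2 hv.2 mul1r => ->; exact: leadtermI.
Qed.
End LeadTerm.

(** * The leading monomial in r variables *)

Section Lead.
Variables (R : comNzRingType) (F : mps 2 R).
Hypothesis HF : is_fgl F.
Let HU := fgl_unitP HF.
Hypothesis tf : forall (a : R) k, a *+ k.+1 = 0 -> a = 0.
Variables (r : nat) (t : 'I_r -> mps 1 R) (la : 'I_r -> nat) (kap : R).
Hypothesis tla : forall i, ord_ge (la i) (t i).
Hypothesis tlow : forall i, low (la i) (t i) = kap *: 'X_ord0 ^+ la i.
Hypothesis lamono : forall i j : 'I_r, (i < j)%N -> (la j < la i)%N.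
Let X (i : 'I_r) : mps r R := psX R i.
Let X1 i : ord_ge 1 (X i). Proof. exact: ord_psX. Qed.
Implicit Types (phi : {ffun 'I_r -> 'I_r}).
Let phi0 : {ffun 'I_r -> 'I_r} := [ffun i => i].
Let la_m : 'X_{1..r} := [multinom la i | i < r].

Lemma restr_full phi : injectiveb phi -> exists w : 'S_r, forall i, w i = phi i.
Proof.
move=> /(restr_onto (leqnn r))[w <-]; exists w => i; rewrite ffunE; congr (w _).
exact: val_inj.
Qed.

Lemma avoids_phi0 i y : avoids phi0 i y = (i < y)%N.
Proof.
apply/forallP/idP => [h|iy k].
  rewrite ltnNge; apply/negP => yi; have := h y; rewrite yi ffunE eqxx //.
apply/implyP => ki; rewrite ffunE -val_eqE /= neq_ltn (leq_ltn_trans ki iy) //.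
Qed.

(** The sign is chosen before the ring and the elements x, so the same sign serves for the x_a and
    for their squares. *)
Lemma injprod_anti phi : injectiveb phi ->
  exists s : bool, forall (A : comNzRingType) (x : 'I_r -> A),
    injprod phi (fun a b => x a - x b) = (-1) ^+ s * injprod phi0 (fun a b => x a - x b).
Proof.
move=> inj; have [w wE] := restr_full inj.
exists w => A x.
pose a : 'rV[A]_r := \row_j (- x j).
have V (u : 'S_r) : injprod (restr (leqnn r) u) (fun a b => x a - x b) =
    (-1) ^+ u * \det (Vandermonde r a).
  rewrite -injprod_restr.
  transitivity (\det (Vandermonde r (\row_j a 0 (u j)))).
    rewrite det_Vandermonde; apply: eq_big => [i|i _]; first exact: ltn_ord.
    by apply: eq_bigr => j _; rewrite !mxE opprK addrC.
  have -> : Vandermonde r (\row_j a 0 (u j)) = col_perm u (Vandermonde r a).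
    by apply/matrixP => i j; rewrite !mxE.
  by rewrite col_permE det_mulmx det_perm odd_permV mulrC.
have -> : phi = restr (leqnn r) w.
  by apply/ffunP => i; rewrite ffunE -wE; congr (w _); apply: val_inj.
have -> : phi0 = restr (leqnn r) 1.
  by apply/ffunP => i; rewrite !ffunE perm1; apply: val_inj.
by rewrite !V odd_perm1 mul1r.
Qed.

Let lreg_m (a b : 'I_r) : a != b -> GRing.lreg ('X_a - 'X_b : {mpoly R[r]}) := @lreg_mXB R r a b.

Definition mdiff phi : {mpoly R[r]} := injprod phi (fun a b => 'X_a - 'X_b).
Definition msum phi : {mpoly R[r]} := injprod phi (fun a b => 'X_a + 'X_b).

Lemma lreg_mdiff phi : GRing.lreg (mdiff phi).
Proof. by apply: lreg_prod => i _; apply: lreg_prod => y /avoids_neq; apply: lreg_m. Qed.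

(* The products of the [x_a - x_b] and of the [x_a^2 - x_b^2] change by the same sign. *)
Lemma msum_sym phi : injectiveb phi -> msum phi = msum phi0.
Proof.
move=> /injprod_anti[s sE]; have s1 := sE _ (fun a => 'X_a : {mpoly R[r]}).
have s2 := sE _ (fun a => 'X_a ^+ 2 : {mpoly R[r]}).
have D2 psi : injprod psi (fun a b => 'X_a ^+ 2 - 'X_b ^+ 2 : {mpoly R[r]}) = mdiff psi * msum psi.
  by rewrite -injprodM; apply: eq_injprod => a b _; rewrite subr_sqr.
move: s2; rewrite !D2 /mdiff s1 -/(mdiff phi0) => e.
apply: (@lreg_mdiff phi0); apply: (@lreg_sign _ s); rewrite mulrA e //.
Qed.

(** The number of pairs is the degree of a product with one factor 'X per pair, and by
    [injprod_restr] this product is the same for all phi. *)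
Lemma npairs_inj phi : injectiveb phi -> npairs (r:=r) (n:=r) phi = npairs phi0.
Proof.
move=> inj; have [w wE] := restr_full inj.
have h (psi : {ffun 'I_r -> 'I_r}) : injprod psi (fun _ _ => 'X : {poly int}) = 'X^(npairs psi).
  rewrite /npairs -prodrXr; apply: eq_bigr => i _.
  by rewrite -prodrXr; apply: eq_bigr => y _; rewrite expr1.
have := congr1 (fun p : {poly int} => size p) (h phi); rewrite size_polyXn.
have -> : injprod phi (fun _ _ => 'X : {poly int}) = injprod phi0 (fun _ _ => 'X).
  have -> : phi = restr (leqnn r) w.
    by apply/ffunP => i; rewrite ffunE -wE; congr (w _); apply: val_inj.
  have -> : phi0 = restr (leqnn r) 1.
    by apply/ffunP => i; rewrite !ffunE perm1; apply: val_inj.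
  by rewrite -!injprod_restr.
by rewrite h size_polyXn => -[].
Qed.

Let inj0 : injectiveb phi0.
Proof. by apply/injectiveP => i j; rewrite !ffunE. Qed.

Definition expo phi : 'X_{1..r} := (\sum_i (U_(phi i) *+ la i))%MM.

Lemma expoE phi : injectiveb phi -> forall i, expo phi (phi i) = la i.
Proof.
move=> /injectiveP inj i; rewrite /expo mnm_sumE (bigD1 i) //= mulmnE mnm1E eqxx mul1n.
rewrite big1 ?addn0 // => j ji; rewrite mulmnE mnm1E (inj_eq inj) (negPf ji) mul0n //.
Qed.

Lemma mdeg_expo phi : mdeg (expo phi) = \sum_i la i.
Proof.
rewrite /expo (big_morph _ (@mdegD r) (@mdeg0 r)); apply: eq_bigr => i _.
by rewrite mdegMn mdeg1 mul1n.
Qed.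

Lemma expo0 : expo phi0 = la_m.
Proof. by apply/mnmP => i; rewrite mnmE; have := expoE inj0 i; rewrite ffunE. Qed.

(** At the first k moved by phi, the exponent of x_k is la_l for some l > k, which is smaller than
    la_k. *)
Lemma expo_lt phi : injectiveb phi -> phi != phi0 -> (expo phi < la_m)%O.
Proof.
move=> inj ne; have e0 := expoE inj0; have e := expoE inj.
have /existsP[k0 k0P] : [exists k, phi k != k].
  rewrite -negb_forall; apply: contra ne => /forallP h; apply/eqP/ffunP => i.
  by rewrite ffunE; apply/eqP.
pose k := [arg min_(k < k0 | phi k != k) (k : nat)].
have [kP kmin] : phi k != k /\ forall l, phi l != l -> (k <= l)%N.
  by rewrite /k; case: arg_minnP.
have below (l : 'I_r) : (l < k)%N -> phi l = l.
  by move=> lk; apply/eqP; apply: contraTT lk => /kmin; rewrite -leqNgt.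
rewrite -expo0; apply/ltmcP; first by rewrite !mdeg_expo.
exists k => [j jk|].
  by have := e j; rewrite below // => ->; have := e0 j; rewrite ffunE.
have := e0 k; rewrite ffunE => ->.
have [w wE] := restr_full inj.
pose l := w^-1%g k; have lk : phi l = k by rewrite -wE /l permKV.
rewrite -{1}lk e; apply: lamono; rewrite ltnNge leq_eqVlt; apply/negP => /orP[/eqP/val_inj lk'|/below lk'].
  by rewrite -lk' lk lk' eqxx in kP.
have kl : k = l by rewrite -{1}lk lk'.
by move: kP; rewrite kl lk' eqxx.
Qed.

(** The staircase (r-1, ..., 1, 0), leading exponent of the products over i < j both of x_i - x_j
    and of x_i + x_j. *)
Definition delta : 'X_{1..r} := (\sum_(i < r) \sum_(y | avoids phi0 i y) U_(i))%MM.

Lemma leadterm_delta (a : R) :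
  leadterm (injprod phi0 (fun i j => 'X_i + a *: 'X_j : {mpoly R[r]})) delta 1.
Proof.
apply: leadterm_prod => i _; rewrite [phi0 i]ffunE; apply: leadterm_prod => y.
by rewrite avoids_phi0; apply: leadterm_lin.
Qed.

Lemma low_ap i a : low (la i) (ap (t i) (X a)) = kap *: 'X_a ^+ la i.
Proof.
rewrite /ap psubst_low //.
rewrite tlow mmapZ rmorphXn /= mmapX mmap1U low_psX mul_mpolyC //.
Qed.

Lemma low_fnum phi : low (\sum_i la i + npairs phi) (fnum F t X phi) =
  kap ^+ r *: ('X_[expo phi] * msum phi).
Proof.
have o1 i : ord_ge (la i) (ap (t i) (X (phi i))) by apply: ord_ap.
have o2 a b : ord_ge 1 (fgl_add F (X a) (X b)) by exact: (ord_fadd HU (X1 _) (X1 _)).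
rewrite lowM; [|exact: ord_ge_prod|]; last first.
  by apply: ord_ge_prod => i _; apply: ord_ge_prod => y _; apply: o2.
rewrite scalerAl; congr (_ * _).
  rewrite low_prod // (eq_bigr _ (fun i _ => low_ap i (phi i))) scaler_prod.
  rewrite prodr_const card_ord; congr (_ *: _); rewrite /expo.
  rewrite (big_morph (fun m => 'X_[m] : {mpoly R[r]}) (@mpolyXD r R) (@mpolyX0 r R)).
  by apply: eq_bigr => i _; rewrite mpolyXn.
rewrite low_prod => [|i _]; last by apply: ord_ge_prod => y _; apply: o2.
apply: eq_bigr => i _; rewrite low_prod => [|y _]; last exact: o2.
by apply: eq_bigr => y _; rewrite (low_fadd HU (X1 _) (X1 _)) !low_psX.
Qed.

Lemma injprod_phi0 (A : comNzRingType) (F2 : 'I_r -> 'I_r -> A) :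
  injprod phi0 F2 = \prod_(i < r) \prod_(j < r | (i < j)%N) F2 i j.
Proof.
by apply: eq_bigr => i _; apply: eq_big => [y|y _]; rewrite ?avoids_phi0 ?ffunE.
Qed.

(** For n = r the lowest forms satisfy: product of the x_i - x_j, times that of f, equals kap^r
    times the product of the x_i + x_j times the alternating sum of the x^(phi la). Both products
    lead with [delta], and the alternating sum with la. *)
Lemma is_HL_lead (f : mps r R) : is_HL F t f ->
  leadterm (low (\sum_i la i) f) la_m (kap ^+ r).
Proof.
move=> hf; have oF := is_HL_ord HF tla hf.
pose V : mps r R := injprod phi0 (fun a b => X a - X b).
pose c : mps r R := injprod phi0 (fun _ _ => -1).
have cc : c * c = 1.
  rewrite /c -injprodM /injprod big1 // => i _; rewrite big1 // => y _.
  by rewrite mulN1r opprK.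
have VE : V = c * vdm r R.
  rewrite vdm_nested -injprod_phi0 /c -injprodM; apply: eq_injprod => a b _.
  by rewrite mulN1r opprB.
have [e eE] : exists e, forall phi, @injp r r phi -> fden F X phi * e phi = V.
  have [e eE] := vdm_cofactors HF (leqnn r).
  by exists (fun phi => c * e phi) => phi inj; rewrite mulrCA eE -?VE.
have q := hf _ _ eE.
have oV : ord_ge (npairs phi0) V.
  by apply: ord_ge_prod => i _; apply: ord_ge_prod => y _; apply: ord_geB; apply: X1.
have lV : low (npairs phi0) V = mdiff phi0.
  rewrite /V /npairs low_prod => [|i _]; last first.
    by apply: ord_ge_prod => y _; apply: ord_geB; apply: X1.
  apply: eq_bigr => i _; rewrite low_prod => [|y _]; last by apply: ord_geB; apply: X1.
  by apply: eq_bigr => y _; rewrite lowB !low_psX.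
have ue phi : injectiveb phi -> mdiff phi * low 0 (e phi) = mdiff phi0.
  move=> inj; rewrite -lV -(eE _ inj) -(npairs_inj inj) -(addn0 (npairs phi)).
  by rewrite (lowM (@ord_fden _ _ HF _ _ phi) (@ord_ge0 _ _ _)) low_fden.
have us phi : injectiveb phi -> exists s : bool, low 0 (e phi) = (-1) ^+ s.
  move=> inj; have [s sE] := injprod_anti inj; exists s.
  apply: (@lreg_mdiff phi); rewrite ue // {2}/mdiff sE -/(mdiff phi0).
  by rewrite mulrAC -exprD addnn -mul2n exprM sqrrN !expr1n mul1r.
have u0 : low 0 (e phi0) = 1.
  by apply: (@lreg_mdiff phi0); rewrite ue // mulr1.
have key : mdiff phi0 * low (\sum_i la i) f =
    kap ^+ r *: (msum phi0 * \sum_(phi : {ffun 'I_r -> 'I_r} | injectiveb phi) 'X_[expo phi] * low 0 (e phi)).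
  rewrite -lV mulrC -(lowM oF oV) q raddf_sum /= mulr_sumr scaler_sumr.
  apply: eq_bigr => phi inj; have o := @ord_fnum _ _ HF _ _ _ tla _ phi.
  rewrite -(npairs_inj inj) -[in LHS](addn0 (\sum_i la i + npairs phi)%N) (lowM o (@ord_ge0 _ _ _)) low_fnum.
  rewrite (msum_sym inj) -scalerAl; congr (_ *: _).
  by rewrite mulrCA mulrA.
apply: (@leadterm_div _ _ (mdiff phi0) _ delta).
  have := leadterm_delta (-1); congr (leadterm _ _ _); apply: eq_bigr => i _.
  by apply: eq_bigr => y _; rewrite scaleN1r.
have h1 : leadterm (msum phi0) delta 1.
  have := leadterm_delta 1; congr (leadterm _ _ _); apply: eq_bigr => i _.
  by apply: eq_bigr => y _; rewrite scale1r.
have h2 : leadterm (\sum_(phi : {ffun 'I_r -> 'I_r} | injectiveb phi) 'X_[expo phi] * low 0 (e phi)) la_m 1.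
  have z m phi : injectiveb phi -> phi != phi0 -> (la_m <= m)%O -> ('X_[expo phi] * low 0 (e phi))@_m = 0.
    move=> inj ne le; have [s ->] := us _ inj; have lt := expo_lt inj ne.
    have {}lt := Order.POrderTheory.lt_le_trans lt le.
    rewrite mulrC; case: s; rewrite ?mulN1r ?mul1r ?mcoeffN mcoeffX.
      by rewrite (Order.POrderTheory.lt_eqF lt) oppr0.
    by rewrite (Order.POrderTheory.lt_eqF lt).
  split=> [m lt|]; rewrite raddf_sum /= (bigD1 phi0) //= u0 mulr1 mcoeffX expo0.
    rewrite (Order.POrderTheory.lt_eqF lt) add0r big1 // => phi /andP[inj ne].
    by apply: z => //; apply: Order.POrderTheory.ltW.
  rewrite eqxx big1 ?addr0 // => phi /andP[inj ne]; exact: z.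
rewrite key; have h3 := leadtermM h1 h2.
split=> [m lt|]; rewrite mcoeffZ; first by rewrite h3.1 // mulr0.
by rewrite h3.2 !mulr1.
Qed.
End Lead.

(** * Supersymmetric series without strict monomials *)

Section Low.
Variables (n p : nat) (R : comNzRingType).

Lemma psubst_low_lin (y : 'I_n -> mps p R) (c : 'I_n -> R) (ix : 'I_n -> 'I_p) d (g : mps n R) :
    nilf y -> (forall k, low 1 (y k) = c k *: 'X_(ix k)) -> ord_ge d g ->
  low d (psubst g y) = \sum_(m <- msupp (low d g))
    (g m * \prod_k c k ^+ m k) *: 'X_[\sum_k (U_(ix k) *+ m k)].
Proof.
move=> z yl o; rewrite (psubst_low z o) /mmap; apply: eq_big_seq => m mP.
rewrite lowE (mdeg_low mP) eqxx -scalerA mul_mpolyC; congr (_ *: _).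
rewrite /mmap1 (eq_bigr (fun k => c k ^+ m k *: 'X_[U_(ix k) *+ m k])) => [|k _]; last first.
  by rewrite yl exprZn mpolyXn.
by rewrite scaler_prod (big_morph (fun m => 'X_[m] : {mpoly R[p]}) (@mpolyXD p R) (@mpolyX0 p R)).
Qed.
End Low.

Section Key.
Variables (R : comNzRingType) (F : mps 2 R).
Hypothesis HF : is_fgl F.

Definition energy n (m : 'X_{1..n}) := (\sum_k m k ^ 2)%N.

Lemma energy_perm n (w : 'S_n) (m : 'X_{1..n}) : energy [multinom m (w k) | k < n] = energy m.
Proof.
rewrite /energy [RHS](reindex_inj (@perm_inj _ w)) /=.
by apply: eq_bigr => k _; rewrite mnmE.
Qed.

Lemma mdeg_perm n (w : 'S_n) (m : 'X_{1..n}) : mdeg [multinom m (w k) | k < n] = mdeg m.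
Proof.
rewrite !mdegE [RHS](reindex_inj (@perm_inj _ w)) /=.
by apply: eq_bigr => k _; rewrite mnmE.
Qed.

(** In lowest degree the substitution merges all x^m' with the same m'_i + m'_j and the same other
    exponents. Among these the balanced m has the least sum of squares, so maximality leaves it
    alone, and its coefficient survives up to sign. *)
Lemma maxenergy01 n d (g : mps n R) (m : 'X_{1..n}) (i j : 'I_n) :
    i = 0%N :> nat -> j = 1%N :> nat -> cancellation F g -> ord_ge d g ->
    mdeg m = d -> (forall m', mdeg m' = d -> g m' != 0 -> (energy m' <= energy m)%N) ->
  m i = m j -> (0 < m i)%N -> g m = 0.
Proof.
move=> i0 j1 gc o md mmax mij mi.
have ij : i != j by rewrite -val_eqE /= i0 j1.
have ji : j == i = false by rewrite eq_sym (negPf ij).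
have X1 k : ord_ge 1 (psX R k : mps n R) by apply: ord_psX.
have oi := ord_fopp HF (X1 i).
pose y1 (k : 'I_n) : mps n R := if k == i then psX R i else if k == j then fgl_opp F (psX R i) else psX R k.
pose y0 (k : 'I_n) : mps n R := if (k == i) || (k == j) then 0 else psX R k.
have z1 : nilf y1 by move=> k; rewrite /y1; do 2!case: ifP => // _.
have z0 : nilf y0 by move=> k; rewrite /y0; case: ifP => // _; apply: ord_ge_zero.
pose c1 (k : 'I_n) : R := if k == j then -1 else 1.
pose x1 (k : 'I_n) := if k == j then i else k.
pose c0 (k : 'I_n) : R := if (k == i) || (k == j) then 0 else 1.
have l1 k : low 1 (y1 k) = c1 k *: 'X_(x1 k).
  rewrite /y1 /c1 /x1; case: (k =P i) => [->|_]; last case: ifP => _.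
  - by rewrite (negPf ij) low_psX scale1r.
  - by rewrite (low_fopp HF (X1 i)) low_psX scaleN1r.
  by rewrite low_psX scale1r.
have l0 k : low 1 (y0 k) = c0 k *: 'X_k.
  by rewrite /y0 /c0; case: ifP => _; rewrite ?low0 ?scale0r // low_psX scale1r.
have := congr1 (low d) (gc i j i0 j1); rewrite (psubst_low_lin z1 l1 o) (psubst_low_lin z0 l0 o).
(* The exponent to which m is sent. It involves x_i, so the side with x_i = x_j = 0 contributes
   nothing. *)
pose mu : 'X_{1..n} := [multinom if k == i then (m i + m j)%N else if k == j then 0%N else m k | k < n].
move/(congr1 (mcoeff mu)); rewrite !raddf_sum /= [X in _ = X]big1 => [|m' _]; last first.
  rewrite mcoeffZ mcoeffX -[X in X == mu](_ : m' = _); last first.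
    by apply/mnmP => k; rewrite mnm_sumE (bigD1 k) //= mulmnE mnm1E eqxx mul1n big1 ?addn0 // => l lk; rewrite mulmnE mnm1E (negPf lk).
  case: eqP => [->|]; rewrite ?mulr0 // mulr1 (bigD1 i) //= /c0 eqxx mnmE eqxx /=.
  by rewrite expr0n addn_eq0 (gtn_eqF mi) mul0r mulr0.
have mono (m' : 'X_{1..n}) k : (\sum_l (U_(x1 l) *+ m' l))%MM k =
    if k == i then (m' i + m' j)%N else if k == j then 0%N else m' k.
  rewrite mnm_sumE (bigD1 i) //= (bigD1 j) /=; last by rewrite ji.
  rewrite !mulmnE !mnm1E {1 2}/x1 (negPf ij) eqxx [i == k]eq_sym.
  have [->|ki] := eqVneq k i.
    rewrite !mul1n big1 ?addn0 ?addnA ?addn0 // => l /andP[li lj].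
    by rewrite mulmnE mnm1E /x1 (negPf lj) (negPf li).
  rewrite !mul0n !add0n; have [kj|kj] := eqVneq k j.
    rewrite big1 // => l /andP[li lj].
    by rewrite mulmnE mnm1E /x1 (negPf lj) kj (negPf lj).
  rewrite (bigD1 k) /=; last by rewrite ki kj.
  rewrite mulmnE mnm1E /x1 (negPf kj) eqxx mul1n big1 ?addn0 // => l /andP[/andP[li lj] lk].
  by rewrite mulmnE mnm1E (negPf lj) (negPf lk).
have [gm0|gm] := eqVneq (g m) 0 => //.
have mS : m \in msupp (low d g) by rewrite mcoeff_msupp lowE md eqxx.
rewrite (bigD1_seq m) ?msupp_uniq //= [X in _ + X]big_seq_cond [X in _ + X]big1 => [|m' /andP[m'S ne]]; last first.
  rewrite mcoeffZ mcoeffX; case: eqP => [e|]; rewrite ?mulr0 //.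
  have e' k : (\sum_l (U_(x1 l) *+ m' l))%MM k = mu k by rewrite e.
  have sij : (m' i + m' j = m i + m j)%N.
    by have := e' i; rewrite mono mnmE eqxx.
  have other k : k != i -> k != j -> m' k = m k.
    by move=> ki kj; have := e' k; rewrite mono mnmE (negPf ki) (negPf kj).
  have m'n : g m' != 0 by move: m'S; rewrite mcoeff_msupp lowE; case: ifP; rewrite ?eqxx.
  have := mmax _ (mdeg_low m'S) m'n.
  rewrite /energy (bigD1 i) //= (bigD1 j) /=; last by rewrite ji.
  rewrite [X in (_ <= X)%N](bigD1 i) //= [X in (_ <= _ + X)%N](bigD1 j) /=; last by rewrite ji.
  rewrite (eq_bigr (fun k => m k ^ 2)%N) => [|k /andP[ki kj]]; last by rewrite other.
  rewrite !addnA leq_add2r -mij => le.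
  case/negP: ne; apply/eqP/mnmP => k.
  (* For a given sum, a^2 + b^2 is least only when a = b. *)
  have m'ij : m' i = m i /\ m' j = m j.
    move: le sij; rewrite -mij; move: (m' i) (m' j) (m i) => a b k' le s.
    have [ab|ab] := leqP a b.
      have : (a = k')%N; last by move=> ae; split=> //; lia.
      nia.
    nia.
  have [->|ki] := eqVneq k i; first by case: m'ij.
  have [->|kj] := eqVneq k j; first by case: m'ij.
  exact: other.
rewrite addr0 mcoeffZ mcoeffX; have -> : (\sum_l (U_(x1 l) *+ m l))%MM = mu.
  by apply/mnmP => k; rewrite mono mnmE.
rewrite eqxx mulr1 => /eqP; have -> : \prod_k c1 k ^+ m k = (-1) ^+ m j.
  rewrite (bigD1 j) //= /c1 eqxx big1 ?mulr1 // => k kj.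
  by rewrite (negPf kj) expr1n.
by rewrite mulrC -signr_odd; case: (odd _); rewrite ?mulN1r ?mul1r ?oppr_eq0 => /eqP.
Qed.
End Key.

Definition mon_of n (s : seq nat) : 'X_{1..n} := [multinom nth 0%N s i | i < n].

Lemma set_last0_nth (n : nat) (R : comNzRingType) (g : forall n, mps n R) (s : seq nat) k :
    (forall n, set_last0 (g n.+1) = g n) -> (size s <= n)%N ->
  g (n + k)%N (mon_of _ s) = g n (mon_of _ s).
Proof.
move=> gs sn; elim: k => [|k IH]; first by rewrite addn0.
rewrite -IH addnS -(gs (n + k)%N) set_last0_coef; congr (g _ _).
apply/mnmP => i; rewrite !mnmE /mnmwiden; case: (unliftP ord_max i) => [j ->|->].
  have -> : lift ord_max j = widen_ord (leqnSn (n + k)) j.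
    by apply: val_inj; rewrite /= /bump leqNgt ltn_ord.
  by rewrite mnmwiden_widen mnmE.
rewrite mnmwiden_ordmax nth_default //=.
exact: leq_trans sn (leq_addr _ _).
Qed.

Section Key.
Variables (R : comNzRingType) (F : mps 2 R).
Hypothesis HF : is_fgl F.

Lemma sym_distinct n d (g : mps n R) : ps_symmetric g -> cancellation F g -> ord_ge d g ->
  ~ ord_ge d.+1 g -> exists m : 'X_{1..n}, [/\ mdeg m = d, g m != 0
    & forall i j, i != j -> m i = m j -> m i = 0%N].
Proof.
move=> gs gc o no.
have [m0 m0d gm0] : exists2 m0 : 'X_{1..n < d.+1}, mdeg m0 = d & g m0 != 0.
  apply/not_exists2P => h; apply: no => m; rewrite ltnS leq_eqVlt => /orP[/eqP md|/o //].
  have mb : (mdeg m < d.+1)%N by rewrite md.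
  by have [//|/negP] := h (BMultinom mb); rewrite negbK => /eqP.
pose P (m : 'X_{1..n < d.+1}) := (mdeg m == d) && (g m != 0).
have P0 : P m0 by rewrite /P m0d eqxx.
have [m /andP[/eqP md gm] mmax] := arg_maxnP (fun m : 'X_{1..n < d.+1} => energy (bmnm m)) P0.
exists m; split=> // i j ij mij; apply/eqP; rewrite -leqn0 leqNgt; apply/negP => mi.
have ij' : (i : nat) != j by [].
have n1 : (1 < n)%N.
  have := ltn_ord i; have := ltn_ord j; move: ij'; move: (nat_of_ord i) (nat_of_ord j) => a b; lia.
pose i0 := Ordinal (ltnW n1); pose j0 := Ordinal n1.
have ij0 : i0 != j0 by [].
pose j' := tperm i0 i j; pose w : 'S_n := (tperm j0 j' * tperm i0 i)%g.
have wj : w j0 = j by rewrite permM tpermL /j' tpermK.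
have wi : w i0 = i.
  have j'i0 : j' != i0.
    by apply: contraNneq ij => e; rewrite -(tpermK i0 i j) -/j' e tpermL.
  rewrite permM [tperm j0 j' i0]tpermD //; exact: tpermL.
have := gs w; move/(congr1 (fun f : mps n R => f (bmnm m))); rewrite psperm_coef => gw.
case/eqP: gm; rewrite -gw.
apply: (maxenergy01 HF (i := i0) (j := j0) (d := d) _ _ gc o) => //.
- by rewrite mdeg_perm.
- move=> m' m'd gm'; rewrite energy_perm; have mb : (mdeg m' < d.+1)%N by rewrite m'd.
  by apply: (mmax (BMultinom mb)); rewrite /P m'd eqxx.
- by rewrite !mnmE wi wj.
by rewrite mnmE wi.
Qed.

(** A surviving monomial has distinct positive exponents. Symmetry sorts them into a strict
    partition, and stability drops the variables with exponent 0. *)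
Lemma Gamma_ordS d (g : forall n, mps n R) : Gamma F g -> (forall n, ord_ge d (g n)) ->
    (forall la : strict_part, sumn (val la) = d -> g _ (mon_of (size (val la)) (val la)) = 0) ->
  forall n, ord_ge d.+1 (g n).
Proof.
move=> gG o h n; apply: contrapT => no.
have [[gs gc] _] := gG n; have stab k : set_last0 (g k.+1) = g k by have [] := gG k.
have [m [md gm mdis]] := sym_distinct gs gc (o n) no.
pose l : seq nat := [seq m i | i <- enum 'I_n].
have lE : l = val (val m) by rewrite /l -[RHS]map_tnth_enum /=.
pose s := sort geq [seq x <- l | (0 < x)%N].
have s0 : 0%N \notin s by rewrite mem_sort mem_filter.
have us : uniq s.
  rewrite sort_uniq /l filter_map map_inj_in_uniq; first by rewrite filter_uniq ?enum_uniq.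
  move=> i j; rewrite !mem_filter /= => /andP[mi _] _ e.
  by apply/eqP; apply: contraTT mi => ij; rewrite (mdis _ _ ij e).
have ss : sorted gtn s.
  rewrite gtn_sorted_uniq_geq us; apply: sort_sorted => x y; exact: leq_total.
have sP : sorted gtn s && (0%N \notin s) by rewrite ss s0.
pose la : strict_part := exist _ s sP.
have szl : size l = n by rewrite size_map size_enum_ord.
have pe : perm_eq (s ++ nseq (n - size s) 0%N) l.
  rewrite perm_sym -(perm_filterC (fun x => 0 < x)%N l) perm_sym.
  have -> : [seq x <- l | predC (fun x => 0 < x)%N x] = nseq (n - size s) 0%N.
    have /all_pred1P -> : all (pred1 0%N) [seq x <- l | predC (fun x => 0 < x)%N x].
      by apply/allP => x; rewrite mem_filter /= -eqn0Ngt => /andP[].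
    congr nseq; rewrite size_sort !size_filter -szl -(count_predC (fun x => 0 < x)%N l).
    by rewrite addKn.
  by rewrite perm_cat2r perm_sort.
have sn : (size s <= n)%N.
  by rewrite -szl -(perm_size pe) size_cat leq_addr.
have sd : sumn s = d.
  rewrite -md mdegE sumnE -(big_map m xpredT id) /=.
  transitivity (\sum_(i <- l) i)%N; last by rewrite /l /index_enum -enumT.
  rewrite -(perm_big _ pe) big_cat /= [X in (_ + X)%N]big1_seq ?addn0 // => x.
  by rewrite mem_nseq => /andP[_ /andP[_ /eqP]].
have := h la sd; rewrite /= => h'; case/eqP: gm.
have szc : size (s ++ nseq (n - size s) 0%N) == n by rewrite (perm_size pe) szl.
have pe' : perm_eq (Tuple szc) (val m) by rewrite /= -lE.
have [w wE] := tuple_permP pe'.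
have := gs w; move/(congr1 (fun f : mps n R => f m)); rewrite psperm_coef => <-.
rewrite -h'.
have := set_last0_nth (n - size s)%N stab (leqnn (size s)).
rewrite subnKC // => <-; congr (g _ _); apply/mnmP => k; rewrite !mnmE.
have := congr1 (fun l => nth 0%N l k) wE; rewrite nth_mktuple /= => e.
rewrite [LHS](_ : _ = tnth (val m) (w k)) // -e nth_cat; case: ltnP => // ks.
by rewrite nth_nseq if_same nth_default.
Qed.
End Key.

(** * Divisibility by powers of two *)

Section Reg.
Variables (n : nat) (R : comNzRingType).
Implicit Types p q A B : mps n R.

(** p is a nonzerodivisor modulo q. *)
Definition regmod p q := forall A B, p * A = q * B -> exists C, A = q * C.

Lemma regmodM p p' q : regmod p q -> regmod p' q -> regmod (p * p') q.
Proof.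
move=> h h' A B; rewrite -mulrA => /h[C e]; exact: (h' _ _ e).
Qed.

Lemma regmodMr p q q' : GRing.lreg q -> regmod p q -> regmod p q' -> regmod p (q * q').
Proof.
move=> lq h h' A B; rewrite -mulrA => e; have [C CE] := h _ _ e.
have [|D DE] := h' C B; first by apply: lq; rewrite -e CE mulrCA.
by exists D; rewrite CE DE mulrA.
Qed.

Lemma regmod_psX p k : GRing.lreg (zsub k p) -> regmod p (psX R k).
Proof.
move=> l A B e; apply: div_psX; apply: l; rewrite mulr0 -zsubM e.
exact: zsub_psX_mul.
Qed.

Lemma regmod_add p p' q : regmod p q -> regmod (p + q * p') q.
Proof.
move=> h A B e; apply: (h A (B - p' * A)).
by rewrite mulrBr -e; ring.
Qed.

Lemma zsubB k p q : zsub k (p - q) = zsub k p - zsub k q.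
Proof. exact: psubstB. Qed.

(* Successive approximation: a solution modulo [x_k] leaves a remainder [x_k A1] that
   satisfies the same hypothesis. *)
Lemma regmod_zsub k p q a : ord_ge a q -> GRing.lreg (low a q) ->
  GRing.lreg (zsub k q) -> regmod (zsub k p) (zsub k q) -> regmod p q.
Proof.
move=> oq lq lzq h A B e; apply: (ideal_closed oq lq) => d.
suff [C [A' [B' [CE e']]]] : exists C A' B', A - q * C = psX R k ^+ d * A' /\ p * A' = q * B'.
  exists C; rewrite CE; apply: ord_geMr; apply: ord_geX; exact: ord_psX.
elim: d => [|d [C [A' [B' [CE e']]]]].
  by exists 0, A, B; rewrite mulr0 subr0 expr0 mul1r.
have [|C0 C0E] := h (zsub k A') (zsub k B'); first by rewrite -!zsubM e'.
have [|A1 A1E] := @div_psX n R k (A' - q * C0).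
  by rewrite zsubB zsubM -[X in X - _]zsubK C0E !zsubM zsubK subrr.
have [|B1 B1E] := @div_psX n R k (B' - p * C0).
  apply: lzq; rewrite mulr0 -zsubM mulrBr -e' [q * _]mulrCA -mulrBr A1E.
  by rewrite mulrCA zsub_psX_mul.
exists (C + psX R k ^+ d * C0), A1, B1; split.
  rewrite mulrDr opprD addrA CE mulrCA -mulrBr A1E exprSr; ring.
apply: (@lreg_psX n R k); rewrite mulrCA -A1E mulrBr e' [RHS]mulrCA -B1E mulrBr.
by rewrite [p * (q * C0)]mulrCA.
Qed.

Lemma div_coef c A : (forall m, exists b, A m = c * b) -> exists C, A = mps_const n c * C.
Proof.
move=> /choice[C CE]; exists (Mps C); apply: mpsP => m; rewrite mps_constM; exact: CE.
Qed.

Lemma regmod_const (a c : R) : (forall x y, a * x = c * y -> exists z, x = c * z) ->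
  regmod (mps_const n a) (mps_const n c).
Proof.
move=> h A B e; apply: div_coef => m; apply: (h _ (B m)).
by rewrite -!mps_constM e.
Qed.

Lemma regmod_psX_const k (c : R) : regmod (psX R k) (mps_const n c).
Proof.
move=> A B e; apply: div_coef => m; exists (B (U_(k) + m)%MM).
by rewrite -mps_constM -e psX_mul_coef.
Qed.
End Reg.

(** * The series [2](x_i) are regular modulo each other *)

Section Double.
Variables (R : comNzRingType) (F : mps 2 R).
Hypothesis HF : is_fgl F.
Let HU := fgl_unitP HF.
Hypothesis tf : forall (a : R) k, a *+ k.+1 = 0 -> a = 0.
Hypothesis a11 : forall x y : R, F (mk2 1 1) * x = y *+ 2 -> exists x', x = x' *+ 2.
Variable n : nat.
Let X (i : 'I_n) : mps n R := psX R i.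
Let X1 i : ord_ge 1 (X i). Proof. exact: ord_psX. Qed.
Let two : R := 1 *+ 2.
Let lreg_two : GRing.lreg two.
Proof. by apply: mulrI0_lreg => a; rewrite mulr_natl => /tf. Qed.

(** The series with [2](x_i) = x_i (2 + x_i [dblr i]); its constant coefficient is a_{1,1}. *)
Definition dblr i : mps n R := psubst (fgl_rest F) (ppair (X i) (X i)).

Lemma lreg_mpolyC (c : R) : GRing.lreg c -> GRing.lreg (c%:MP : {mpoly R[n]}).
Proof.
move=> h p q e; apply/mpolyP => m; apply: h.
by rewrite -!mcoeffCM e.
Qed.

Lemma lreg_mps_const (c : R) : GRing.lreg c -> GRing.lreg (mps_const n c).
Proof.
by move=> h p q e; apply: mpsP => m; apply: h; rewrite -!mps_constM e.
Qed.

Lemma fgl_rest0 : fgl_rest F 0%MM = F (mk2 1 1).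
Proof.
have -> : mk2 1 1 = (U_(ord0) + (U_(i1of2) + 0))%MM.
  by apply/mnmP => k; rewrite !mnmDE !mnm1E mnmE mnm0E; case: k => [[|[|]]].
rewrite {2}(fgl_restE HU) !mpsDE -mulrA !psX_mul_coef !mpsXE.
have e0 : (U_(ord0)%MM == (U_(ord0) + (U_(i1of2) + 0))%MM :> 'X_{1..2}) = false.
  by apply/negP => /eqP/(congr1 (@mdeg 2)); rewrite !mdegD !mdeg1.
have e1 : (U_(i1of2)%MM == (U_(ord0) + (U_(i1of2) + 0))%MM :> 'X_{1..2}) = false.
  by apply/negP => /eqP/(congr1 (@mdeg 2)); rewrite !mdegD !mdeg1.
by rewrite e0 e1 !add0r.
Qed.

Lemma dblE i : dbl F i = X i * (mps_const n two + X i * dblr i).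
Proof.
rewrite /dbl (fadd_decomp HU (X1 i) (X1 i)) -/(dblr i) /two.
have -> : mps_const n (1 *+ 2 : R) = 1 *+ 2 by rewrite raddfMn.
ring.
Qed.

Lemma zsub_dblr k i : zsub k (dblr i) = if i == k then mps_const n (F (mk2 1 1)) else dblr i.
Proof.
rewrite /zsub /dblr psubst_comp; [|exact: nilf_ppair|exact: nilf_zvar].
have e : (fun j => psubst (ppair (X i) (X i) j) (zvar R k)) = (fun _ : 'I_2 => if i == k then 0 else X i).
  by apply/funext => j; rewrite /ppair if_same -/(zsub k _) zsubX.
rewrite e; case: ifP => _; first by rewrite psubst0 fgl_rest0.
by apply: psubst_ext => j; rewrite /ppair if_same.
Qed.

Lemma zsub_dbl (k i : 'I_n) : i != k -> zsub k (dbl F i) = dbl F i.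
Proof.
move=> ik; rewrite /dbl /zsub (fgl_add_subst F (X1 i) (X1 i) (nilf_zvar R k)).
by rewrite -/(zsub k _) zsubX (negPf ik).
Qed.

Let c2 := mps_const n two.

Lemma zsub_const k (c : R) : zsub k (mps_const n c) = mps_const n c.
Proof. exact: psubstC (nilf_zvar R k). Qed.

Lemma ord_low_c2 (u : mps n R) : u 0%MM = two -> GRing.lreg (low 0 u).
Proof. by move=> e; rewrite low0_const e; apply: lreg_mpolyC. Qed.

(** At x_i = 0 the series becomes the constant a_{1,1}, which is regular modulo 2. *)
Lemma regmod_dblr_c2 i : regmod (dblr i) c2.
Proof.
apply: (@regmod_zsub n R i _ _ 0); first exact: ord_ge0.
- by apply: ord_low_c2; rewrite /c2 /= eqxx.
- by rewrite zsub_const; apply: lreg_mps_const.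
rewrite zsub_const zsub_dblr eqxx; apply: regmod_const => x y.
rewrite mulr_natl => /a11[z ->]; exists z; by rewrite mulr_natl.
Qed.

Lemma regmod_dbl_c2 (i : 'I_n) : regmod (dbl F i) c2.
Proof.
rewrite dblE; apply: regmodM; first exact: regmod_psX_const.
rewrite addrC -[X in _ + X]mulr1; apply: regmod_add; apply: regmodM.
  exact: regmod_psX_const.
exact: regmod_dblr_c2.
Qed.

(** Write [2](x_k) = x_k u. Modulo x_k the claim is regularity of [2](x_i); for u, setting x_k = 0
    turns u into 2. *)
Lemma regmod_dbl (i k : 'I_n) : i != k -> regmod (dbl F i) (dbl F k).
Proof.
move=> ik; have zi := zsub_dbl ik; rewrite [dbl F k]dblE; set u := _ + _.
have u0 : u 0%MM = two.
  have /ord_ge1P o : ord_ge 1 (X k * dblr k) by apply: ord_geMr; apply: X1.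
  by rewrite /u mpsDE o addr0 /= eqxx.
have zu : zsub k u = c2.
  rewrite /u /zsub psubstD -!/(zsub k _) zsub_const zsub_psX_mul addr0 //.
apply: regmodMr; first exact: lreg_psX.
  by apply: regmod_psX; rewrite zi; apply: (lreg_dbl HF tf).
apply: (@regmod_zsub n R k _ _ 0); first exact: ord_ge0.
- exact: ord_low_c2.
- by rewrite zu; apply: lreg_mps_const.
by rewrite zu zi; apply: regmod_dbl_c2.
Qed.

Definition dsub (s : seq 'I_n) (f : mps n R) := foldr (fun i g => g - zsub i g) f s.

Lemma dsub_coef s f m : dsub s f m = if all (fun i => m i != 0%N) s then f m else 0.
Proof.
elim: s => [|i s IH]; first by [].
rewrite -[dsub (i :: s) f]/(dsub s f - zsub i (dsub s f)) mpsBE zsub_coef IH /=.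
by case: (m i == 0%N); case: (all _ s); rewrite /= ?subrr ?subr0.
Qed.

Lemma dsub_mul s i g : i \notin s -> dsub s (dbl F i * g) = dbl F i * dsub s g.
Proof.
elim: s => [|k s IH]; first by [].
rewrite inE negb_or => /andP[ik is_].
by rewrite -[LHS]/(dsub s _ - zsub k (dsub s _)) IH // zsubM (zsub_dbl ik) mulrBr.
Qed.

Lemma regmod_prod (s : seq 'I_n) k : k \notin s -> regmod (\prod_(i <- s) dbl F i) (dbl F k).
Proof.
elim: s => [|i s IH] /=.
  by move=> _ A B; rewrite big_nil mul1r => ->; exists B.
rewrite inE negb_or eq_sym => /andP[ik ks]; rewrite big_cons; apply: regmodM.
  exact: regmod_dbl.
exact: IH.
Qed.

(** The operators commute, so the next one yields a multiple both of the product so far and of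
    [2](x_i). Regularity of that product modulo [2](x_i) makes it a multiple of the full product. *)
Lemma dsub_factor s f : uniq s -> (forall i, exists g, f - zsub i f = dbl F i * g) ->
  exists g, dsub s f = (\prod_(i <- s) dbl F i) * g.
Proof.
move=> us hf; elim: s us => [|i s IH] /=; first by exists f; rewrite big_nil mul1r.
case/andP=> is_ us; have [g gE] := IH us; have [h hE] := hf i.
have e1 : dsub s f - zsub i (dsub s f) = \prod_(j <- s) dbl F j * (g - zsub i g).
  rewrite gE zsubM mulrBr; congr (_ - _ * _); rewrite /zsub (psubst_prod (nilf_zvar R i)).
  apply: eq_big_seq => j js; apply: zsub_dbl; by apply: contraNneq is_ => <-.
have e2 : dsub s f - zsub i (dsub s f) = dbl F i * dsub s h.
  rewrite -(dsub_mul _ is_) -hE; apply: mpsP => m.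
  rewrite mpsBE zsub_coef !dsub_coef mpsBE zsub_coef.
  by case: (m i == 0%N); case: (all _ s); rewrite ?subrr ?subr0.
have [C CE] := regmod_prod is_ (etrans (esym e1) e2).
by exists C; rewrite -/(dsub s f) e1 CE big_cons mulrCA mulrA.
Qed.

(** Applying all the operators keeps the coefficient of x^m, as no exponent is 0, and gives a
    multiple of a product with lowest form 2^n x_1 ... x_n. *)
Lemma pow2_divides d (f : mps n R) (m : 'X_{1..n}) :
    (forall i, exists g, f - zsub i f = dbl F i * g) -> ord_ge d f ->
    mdeg m = d -> (forall i, m i != 0%N) ->
  exists x, f m = two ^+ n * x.
Proof.
move=> hf o md mi.
have [g gE] := dsub_factor (enum_uniq 'I_n) hf.
have fm : f m = dsub (enum 'I_n) f m.
  by rewrite dsub_coef; have -> : all (fun i => m i != 0%N) (enum 'I_n) by apply/allP => i _.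
have oD : ord_ge d (dsub (enum 'I_n) f).
  by move=> m' lt; rewrite dsub_coef (o _ lt) if_same.
have -> : f m = (low d (dsub (enum 'I_n) f))@_m by rewrite lowE md eqxx fm.
rewrite gE.
pose P := \prod_(i <- enum 'I_n) dbl F i.
have nE : (\sum_(i <- enum 'I_n) 1 = n)%N by rewrite big_enum sum1_card card_ord.
have oP : ord_ge n P.
  have := @ord_ge_prod _ _ _ (enum 'I_n) xpredT (@dbl R F n) (fun=> 1%N) (fun i _ => ord_dbl HF i).
  by rewrite nE.
have lP : low n P = two ^+ n *: \prod_(i <- enum 'I_n) 'X_i.
  have := @low_prod _ _ _ (enum 'I_n) xpredT (@dbl R F n) (fun=> 1%N) (fun i _ => ord_dbl HF i).
  rewrite nE -/P => ->.
  rewrite (eq_bigr _ (fun i _ => low_dbl HF i)) scaler_prod big_enum_cond /= prodr_const card_ord //.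
have rP : GRing.lreg (low n P).
  rewrite lP -(@mul_mpolyC n R); apply: lregM; first by apply: lreg_mpolyC; apply: lregX.
  apply: lreg_prod => i _ p q e; apply: (@ps_of_inj n R); apply: (@lreg_psX n R i).
  by rewrite -!(ps_ofX R) -!rmorphM e.
have nd : (n <= d)%N.
  rewrite -md mdegE -[X in (X <= _)%N]card_ord -sum1_card; apply: leq_sum => i _.
  by rewrite lt0n.
have og : ord_ge (d - n) g.
  by apply: (ord_ge_cancel oP rP); rewrite subnKC // -gE.
exists ((\prod_(i <- enum 'I_n) 'X_i * low (d - n) g)@_m).
by rewrite -{1}(subnKC nd) (lowM oP og) lP -scalerAl mcoeffZ.
Qed.
End Double.

(** * Elimination along strict partitions *)

Section Parts.
Implicit Types (la mu : strict_part) (s : seq nat).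
Import Order.TTheory.

Lemma sum_nth n s : (size s <= n)%N -> (\sum_(i < n) nth 0 s i = sumn s)%N.
Proof.
elim: s n => [|x s IH] [|n] //=; first by rewrite big_ord0.
  by move=> _; rewrite big1 // => i _; rewrite nth_nil.
by rewrite ltnS => sn; rewrite big_ord_recl /= IH.
Qed.

Lemma mdeg_mon_of n s : (size s <= n)%N -> mdeg (mon_of n s) = sumn s.
Proof. by move=> sn; rewrite mdegE -(sum_nth sn); apply: eq_bigr => i _; rewrite mnmE. Qed.

Lemma strict_part_gt0 la i : (i < size (val la))%N -> (0 < nth 0 (val la) i)%N.
Proof.
case: la => s /= /andP[_ s0] lt; rewrite lt0n.
by apply: contraNneq s0 => e; rewrite -e mem_nth.
Qed.

Lemma strict_part_ltn la i j : (i < j < size (val la))%N -> (nth 0 (val la) j < nth 0 (val la) i)%N.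
Proof.
case: la => s /= /andP[ss _] /andP[ij js].
apply: (sorted_ltn_nth (leT := gtn) _ 0%N ss) => //; last by rewrite inE (ltn_trans ij).
by move=> x y z yx xz; apply: ltn_trans yx.
Qed.

Lemma size_strict_part la : (size (val la) <= sumn (val la))%N.
Proof.
rewrite -(sum_nth (leqnn _)) -[X in (X <= _)%N]card_ord -sum1_card.
by apply: leq_sum => i _; apply: strict_part_gt0.
Qed.

(** A strict partition of d is the decreasing list of a subset of {1, ..., d}. *)
Definition strict_parts d : seq strict_part :=
  undup [seq la <- pmap insub [seq [seq x <- rev (iota 1 d) | inord x \in A] | A : {set 'I_d.+1} <- enum {: {set 'I_d.+1}}]
        | sumn (val la) == d].

Lemma mem_strict_parts d la : (la \in strict_parts d) = (sumn (val la) == d).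
Proof.
rewrite mem_undup mem_filter; case: eqP => //= <-.
rewrite mem_pmap_sub; apply/mapP.
exists [set i : 'I_(sumn (val la)).+1 | (i : nat) \in val la]; first by rewrite mem_enum.
have gtrans : transitive gtn by move=> x y z yx xz; apply: ltn_trans yx.
have girr : irreflexive gtn by move=> x; apply: ltnn.
have bound x : x \in val la -> (0 < x <= sumn (val la))%N.
  move=> xs; have xi : (index x (val la) < size (val la))%N by rewrite index_mem.
  rewrite -(nth_index 0%N xs) strict_part_gt0 //= -(sum_nth (leqnn _)).
  by rewrite (bigD1 (Ordinal xi)) //= leq_addr.
apply: (irr_sorted_eq gtrans girr).
- by case: (la) => s /= /andP[].
- by apply: sorted_filter => //; rewrite rev_sorted; apply: iota_ltn_sorted.
move=> x; rewrite mem_filter mem_rev mem_iota inE add1n ltnS.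
apply/idP/andP => [xs|[]].
  have /andP[x0 xd] := bound _ xs.
  by rewrite inordK ?x0 ?xd ?xs.
by move=> h /andP[_ xd]; move: h; rewrite inordK.
Qed.

(* In this order x^mu does not occur in P_la or Q_la when mu comes before la. *)
Definition sp_le d : rel strict_part := fun mu la =>
  (size (val mu) < size (val la))%N ||
  (size (val mu) == size (val la)) && (mon_of d (val la) <= mon_of d (val mu))%O.

Lemma sp_le_total d : total (sp_le d).
Proof.
move=> mu la; rewrite /sp_le; case: ltngtP => //= _; exact: le_total.
Qed.

Lemma sp_le_trans d : transitive (sp_le d).
Proof.
move=> mu la nu; rewrite /sp_le => /orP[h1|/andP[/eqP h1 h2]] /orP[h3|/andP[/eqP h3 h4]].
- by rewrite (ltn_trans h1 h3).
- by rewrite -h3 h1.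
- by rewrite h1 h3.
by rewrite h1 h3 eqxx (le_trans h4 h2) orbT.
Qed.

Lemma mon_of_inj d la mu : sumn (val la) = d -> sumn (val mu) = d ->
  mon_of d (val la) = mon_of d (val mu) -> la = mu.
Proof.
move=> lad mud e; have e' i : nth 0 (val la) i = nth 0 (val mu) i.
  have [id|id] := ltnP i d.
    by have := congr1 (fun m : 'X_{1..d} => m (Ordinal id)) e; rewrite !mnmE.
  rewrite !nth_default //; apply: leq_trans id.
    by rewrite -mud size_strict_part.
  by rewrite -lad size_strict_part.
apply: val_inj; apply: (@eq_from_nth _ 0%N) => [|i _]; last exact: e'.
wlog le : la mu lad mud {e} e' / (size (val la) <= size (val mu))%N.
  move=> h; case/orP: (leq_total (size (val la)) (size (val mu))) => le; first exact: h.
  by apply/esym; apply: h.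
apply/eqP; rewrite eqn_leq le leqNgt; apply/negP => lt.
by have := strict_part_gt0 lt; rewrite -e' nth_default.
Qed.

(** For equal lengths, passing from d variables to as many variables as parts drops only exponents
    0, so the strict comparison persists. *)
Lemma sp_lt d la mu : sumn (val la) = d -> sumn (val mu) = d -> mu != la -> sp_le d mu la ->
  (size (val mu) < size (val la))%N \/ size (val mu) = size (val la) /\
    (mon_of (size (val mu)) (val la) < mon_of (size (val mu)) (val mu))%O.
Proof.
move=> lad mud ne /orP[|/andP[/eqP sz le]]; first by left.
right; split=> //.
have szd : (size (val mu) <= d)%N by rewrite -mud size_strict_part.
have lt : (mon_of d (val la) < mon_of d (val mu))%O.
  rewrite lt_neqAle le andbT; apply: contra ne => /eqP/(mon_of_inj lad mud) -> //.
have [|i h1 h2] := ltmcP _ lt.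
  by rewrite !mdeg_mon_of -?sz // lad mud.
rewrite !mnmE in h2.
have ir : (i < size (val mu))%N.
  by rewrite ltnNge; apply/negP => le'; move: h2; rewrite !nth_default // -?sz.
apply/ltmcP; first by rewrite !mdeg_mon_of -?sz // lad mud.
exists (Ordinal ir) => [j ji|]; last by rewrite !mnmE.
have jd : (j < d)%N := leq_trans (ltn_ord j) szd.
by have := h1 (Ordinal jd) ji; rewrite !mnmE.
Qed.

Definition sorted_strict_parts d := sort (sp_le d) (strict_parts d).
Lemma mem_sorted_strict_parts d la : (la \in sorted_strict_parts d) = (sumn (val la) == d).
Proof. by rewrite mem_sort mem_strict_parts. Qed.
Lemma uniq_sorted_strict_parts d : uniq (sorted_strict_parts d). Proof. by rewrite sort_uniq undup_uniq. Qed.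

Lemma pairwise_strict_parts d (P : rel strict_part) :
    (forall mu la, sumn (val mu) = d -> sumn (val la) = d -> mu != la -> sp_le d mu la -> P mu la) ->
  pairwise P (sorted_strict_parts d).
Proof.
move=> h; have := uniq_sorted_strict_parts d; rewrite uniq_pairwise => pu.
have := sort_sorted (@sp_le_total d) (strict_parts d); rewrite (sorted_pairwise (@sp_le_trans d)) => ps.
have : pairwise [rel x y | (x != y) && sp_le d x y] (sorted_strict_parts d) by rewrite pairwise_relI pu.
apply: (sub_in_pairwise (P := [pred la : strict_part | sumn (val la) == d])).
  by move=> mu la /eqP h1 /eqP h2 /andP[]; apply: h.
by apply/allP => la; rewrite mem_sorted_strict_parts.
Qed.
End Parts.

(** * Triangular elimination, for P and Q at once *)

Section Basis.
Variables (R : comNzRingType) (F : mps 2 R).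
Hypothesis HF : is_fgl F.
Variables (th : nat -> mps 1 R) (kap : R).
Hypothesis lreg_kap : GRing.lreg kap.
Hypothesis th_ord : forall k, (0 < k)%N -> ord_ge k (th k).
Hypothesis th_low : forall k, (0 < k)%N -> low k (th k) = kap *: 'X_ord0 ^+ k.
Variable b : strict_part -> forall n, mps n R.
Hypothesis bB : forall (la : strict_part) n, is_HL F (fun i : 'I_(size (val la)) => th (nth 0%N (val la) i)) (b la n).
Variable M : set (forall n, mps n R).
Hypothesis MG : forall g, M g -> Gamma F g.
Hypothesis Mb : forall la, M (b la).
Hypothesis Mlin : forall x f g, M f -> M g -> M (fun n => f n - mps_const n x * g n).
(** The diagonal entry of the elimination is kap^r, with kap = 1 for P and 2 for Q, so the
    coefficient to be removed has to be a multiple of it. *)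
Hypothesis Mdiv : forall d f (la : strict_part), M f -> (forall n, ord_ge d (f n)) -> sumn (val la) = d ->
  exists x, f (size (val la)) (mon_of _ (val la)) = kap ^+ size (val la) * x.

Implicit Types (la mu nu : strict_part) (s : seq strict_part).

(** Taken in exactly as many variables as mu has parts: there the members indexed by longer
    partitions vanish. *)
Definition part_coef (mu : strict_part) (f : forall n, mps n R) := f (size (val mu)) (mon_of _ (val mu)).

Lemma b_ord la n : ord_ge (sumn (val la)) (b la n).
Proof.
rewrite -(sum_nth (leqnn _)); apply: (is_HL_ord HF (la := fun i => nth 0%N (val la) i) _ (@bB la n)) => i.
by apply: th_ord; apply: strict_part_gt0.
Qed.

Lemma b_lead la : leadterm (low (sumn (val la)) (b la (size (val la)))) (mon_of _ (val la)) (kap ^+ size (val la)).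
Proof.
rewrite -(sum_nth (leqnn _)); apply: (is_HL_lead HF (la := fun i => nth 0%N (val la) i) _ _ _ (@bB la _)) => [i|i|i j ij].
- by apply: th_ord; apply: strict_part_gt0.
- by apply: th_low; apply: strict_part_gt0.
by apply: strict_part_ltn; rewrite ij /=.
Qed.

Lemma part_coef_self la : part_coef la (b la) = kap ^+ size (val la).
Proof.
have [_ <-] := b_lead la; rewrite lowE /part_coef mdeg_mon_of //.
by rewrite eqxx.
Qed.

Lemma part_coef_zero d mu la : sumn (val mu) = d -> sumn (val la) = d -> mu != la -> sp_le d mu la ->
  part_coef mu (b la) = 0.
Proof.
move=> mud lad ne le; have [lt|[sz lt]] := sp_lt lad mud ne le.
  by rewrite /part_coef (is_HL_small lt (@bB la _)) mps0E.
have := b_lead la; rewrite /part_coef.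
move: (b la); rewrite lad => b'.
rewrite -sz => -[/(_ _ lt) h _].
by move: h; rewrite lowE mdeg_mon_of // mud eqxx.
Qed.

Lemma lreg_kapX k : GRing.lreg (kap ^+ k). Proof. exact: lregX. Qed.

Let tri (s : seq strict_part) := pairwise (fun mu la => part_coef mu (b la) == 0) s.

Lemma tri_strict_parts d : tri (sorted_strict_parts d).
Proof. by apply: pairwise_strict_parts => mu la mud lad ne le; apply/eqP; exact: (@part_coef_zero d). Qed.

Definition lcomb (s : seq strict_part) (e : strict_part -> R) n : mps n R :=
  \sum_(la <- s) mps_const n (e la) * b la n.

Lemma part_coef_lcomb mu s e : part_coef mu (lcomb s e) = \sum_(la <- s) e la * part_coef mu (b la).
Proof. by rewrite /part_coef /lcomb mps_sumE; apply: eq_bigr => la _; rewrite mps_constM. Qed.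

Lemma ord_lcomb d s e n : (forall la : strict_part, la \in s -> sumn (val la) = d) -> ord_ge d (lcomb s e n).
Proof.
move=> h; rewrite /lcomb big_seq; apply: ord_ge_sum => la /h <-.
by apply: ord_geMl; apply: b_ord.
Qed.

(** Remove the coefficient at the head of the list first; by triangularity the later members of the
    family do not contain that monomial. *)
Lemma eliminate d s f : uniq s -> tri s -> (forall la : strict_part, la \in s -> sumn (val la) = d) ->
    M f -> (forall n, ord_ge d (f n)) ->
  exists e, M (fun n => f n - lcomb s e n) /\
    forall la : strict_part, la \in s -> part_coef la (fun n => f n - lcomb s e n) = 0.
Proof.
elim: s f => [|la s IH] f.
  move=> _ _ _ Mf o; exists (fun=> 0); split=> //.
  suff -> : (fun n => f n - lcomb [::] (fun=> 0) n) = f by [].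
  by apply: functional_extensionality_dep => n; rewrite /lcomb big_nil subr0.
rewrite /= => /andP[las us] /andP[/allP tla ts] sd Mf o.
have lad : sumn (val la) = d by apply: sd; rewrite inE eqxx.
have [x xE] := Mdiv Mf o lad.
pose f1 n := f n - mps_const n x * b la n.
have Mf1 : M f1 by apply: Mlin.
have o1 n : ord_ge d (f1 n).
  apply: ord_geB; first exact: o.
  by apply: ord_geMl; rewrite -lad; apply: b_ord.
have [|e [Me eE]] := IH f1 us ts _ Mf1 o1.
  by move=> mu mus; apply: sd; rewrite inE mus orbT.
exists (fun mu => if mu == la then x else e mu).
have E : (fun n => f n - lcomb (la :: s) (fun mu => if mu == la then x else e mu) n) =
   (fun n => f1 n - lcomb s e n).
  apply: functional_extensionality_dep => n; rewrite /lcomb big_cons eqxx opprD addrA.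
  congr (_ - _); apply: eq_big_seq => mu mus; case: eqP => // mula.
  by move: las; rewrite -mula mus.
rewrite E; split=> // mu; rewrite inE => /orP[/eqP ->|]; last exact: eE.
have evB g h : part_coef la (fun n => g n - h n) = part_coef la g - part_coef la h by [].
rewrite evB part_coef_lcomb big_seq big1 => [|nu nus]; last by rewrite (eqP (tla _ nus)) mulr0.
rewrite subr0 /f1 evB {1}/part_coef xE /part_coef mps_constM -/(part_coef la (b la)) part_coef_self mulrC subrr //.
Qed.

Lemma eliminate_step d f : M f -> (forall n, ord_ge d (f n)) ->
  exists e, M (fun n => f n - lcomb (sorted_strict_parts d) e n) /\
    forall n, ord_ge d.+1 (f n - lcomb (sorted_strict_parts d) e n).
Proof.
move=> Mf o; have sd la : la \in sorted_strict_parts d -> sumn (val la) = d by rewrite mem_sorted_strict_parts => /eqP.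
have [e [Me eE]] := eliminate (uniq_sorted_strict_parts d) (tri_strict_parts d) sd Mf o.
exists e; split=> //; apply: (Gamma_ordS HF (MG Me)).
  by move=> n; apply: ord_geB; [exact: o|exact: ord_lcomb].
by move=> la lad; apply: eE; rewrite mem_sorted_strict_parts lad.
Qed.

(** A homogeneous triangular system with regular diagonal entries, solved from the head. *)
Lemma tri_indep s (e : strict_part -> R) : uniq s -> tri s ->
  (forall mu, mu \in s -> \sum_(la <- s) e la * part_coef mu (b la) = 0) -> forall la : strict_part, la \in s -> e la = 0.
Proof.
elim: s => [|la s IH] //= /andP[las us] /andP[/allP tla ts] h.
have e0 : e la = 0.
  have := h la; rewrite inE eqxx big_cons => /(_ isT).
  rewrite big_seq big1 => [|nu nus]; last by rewrite (eqP (tla _ nus)) mulr0.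
  by rewrite addr0 part_coef_self mulrC => q; apply: (@lreg_kapX (size (val la))); rewrite q mulr0.
move=> mu; rewrite inE => /orP[/eqP -> //|]; apply: IH => // nu nus.
by have := h nu; rewrite inE nus orbT big_cons e0 mul0r add0r => ->.
Qed.

Definition psum N (c : strict_part -> R) n : mps n R := \sum_(d < N) lcomb (sorted_strict_parts d) c n.

Lemma b_support la n m : b la n m != 0 -> (sumn (val la) <= mdeg m)%N.
Proof.
by move=> h; rewrite leqNgt; apply: contra h => /(@b_ord la n) ->.
Qed.

Definition strict_parts_lt N : seq strict_part := flatten [seq sorted_strict_parts d | d <- iota 0 N].

Lemma mem_strict_parts_lt N la : (la \in strict_parts_lt N) = (sumn (val la) < N)%N.
Proof.
apply/idP/idP => [/flattenP[s /mapP[d dN ->]]|lt].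
  by move: dN; rewrite mem_iota mem_sorted_strict_parts => /= dN /eqP ->.
by apply/flattenP; exists (sorted_strict_parts (sumn (val la))); rewrite ?mem_sorted_strict_parts // map_f // mem_iota.
Qed.

Lemma uniq_strict_parts_lt N : uniq (strict_parts_lt N).
Proof.
suff h k : uniq (flatten [seq sorted_strict_parts d | d <- iota k N]) by exact: h.
elim: N k => [|N IH] k //=.
rewrite cat_uniq uniq_sorted_strict_parts IH andbT /=; apply/hasPn => la /flattenP[s /mapP[d dk ->]].
move: dk; rewrite mem_iota => /andP[kd _]; rewrite /= !mem_sorted_strict_parts => /eqP ->.
by rewrite gtn_eqF.
Qed.

Lemma summable_b : formally_summable b.
Proof.
move=> n m; apply: (@sub_finite_set _ _ [set` strict_parts_lt (mdeg m).+1]); last exact: finite_seq.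
move=> la h; have : la \in strict_parts_lt (mdeg m).+1 by rewrite mem_strict_parts_lt ltnS; apply: b_support h.
by [].
Qed.

Lemma formal_sum_psum c N n m : (mdeg m < N)%N -> formal_sum c b n m = psum N c n m.
Proof.
move=> mN; rewrite /= -(@fsbig_widen _ _ _ _ [set` strict_parts_lt N]) //; last first.
  move=> la [_ h]; apply/eqP; apply: contrapT => /negP ne; apply: h.
  have : la \in strict_parts_lt N; last by [].
  rewrite mem_strict_parts_lt; apply: leq_ltn_trans mN; apply: (@b_support la n).
  by apply: contraNneq ne => ->; rewrite mulr0.
rewrite -(@fsbig_seq _ _ _ _ (strict_parts_lt N)) ?uniq_strict_parts_lt // big_flatten big_map /psum mps_sumE -(big_mkord xpredT (fun d => lcomb (sorted_strict_parts d) c n m)).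
rewrite /index_iota subn0; apply: eq_bigr => d _; rewrite /lcomb mps_sumE.
by apply: eq_bigr => la _; rewrite mps_constM.
Qed.

Lemma formal_sum_inj c c' : formal_sum c b = formal_sum c' b -> c = c'.
Proof.
move=> E; suff h d : forall la, sumn (val la) = d -> c la - c' la = 0.
  by apply/funext => la; apply/subr0_eq/(h (sumn (val la))).
have [D] := ubnP d; elim: D d => // D IH d; rewrite ltnS => dD la lad.
have sd mu : mu \in sorted_strict_parts d -> sumn (val mu) = d by rewrite mem_sorted_strict_parts => /eqP.
apply: (tri_indep (s := sorted_strict_parts d) (e := fun la => c la - c' la)) => //; last by rewrite mem_sorted_strict_parts lad.
- exact: uniq_sorted_strict_parts.
- exact: tri_strict_parts.
move=> mu /sd mud.
have mm : (mdeg (mon_of (size (val mu)) (val mu)) < d.+1)%N by rewrite mdeg_mon_of // mud.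
have := congr1 (part_coef mu) E; rewrite {1 2}/part_coef.
rewrite !(formal_sum_psum _ mm) /psum !big_ord_recr /= => e.
(* By induction the coefficients in smaller degrees agree, so only degree d is left to compare. *)
have small : \sum_(i < d) lcomb (sorted_strict_parts i) c (size (val mu)) = \sum_(i < d) lcomb (sorted_strict_parts i) c' (size (val mu)).
  apply: eq_bigr => i _; rewrite /lcomb; apply: eq_big_seq => nu; rewrite mem_sorted_strict_parts => /eqP nui.
  congr (mps_const _ _ * _); apply: subr0_eq; apply: (IH i) => //.
  exact: leq_trans (ltn_ord i) dD.
move: e; rewrite small => /addrI e.
rewrite (eq_bigr (fun la => c la * part_coef mu (b la) - c' la * part_coef mu (b la))) => [|nu _]; last by rewrite mulrBl.
by rewrite sumrB -!part_coef_lcomb /part_coef e subrr.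
Qed.

Lemma formal_sum_exists f : M f -> exists c, f = formal_sum c b.
Proof.
move=> Mf.
have [|E EP] := @choice (nat * (forall n, mps n R)) (strict_part -> R)
   (fun p e => M p.2 -> (forall n, ord_ge p.1 (p.2 n)) ->
     M (fun n => p.2 n - lcomb (sorted_strict_parts p.1) e n) /\
     forall n, ord_ge p.1.+1 (p.2 n - lcomb (sorted_strict_parts p.1) e n)).
  move=> [d g] /=; have [[Mg o]|h] := pselect (M g /\ forall n, ord_ge d (g n)).
    by have [e eP] := eliminate_step Mg o; exists e.
  by exists (fun=> 0) => Mg o; case: h.
pose step d (g : forall n, mps n R) : forall n, mps n R := fun n => g n - lcomb (sorted_strict_parts d) (E (d, g)) n.
pose gs := fix gs d : forall n, mps n R := if d is d'.+1 then step d' (gs d') else f.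
have gP d : M (gs d) /\ forall n, ord_ge d (gs d n).
  elim: d => [|d [Md od]]; first by split=> // n; apply: ord_ge0.
  exact: (EP (d, gs d) Md od).
(* The coefficient at la is fixed at stage |la| of the elimination and not touched afterwards. *)
pose c la := E (sumn (val la), gs (sumn (val la))) la.
have gsE d n : gs d n = f n - psum d c n.
  elim: d => [|d IH]; first by rewrite /psum big_ord0 subr0.
  rewrite /psum big_ord_recr /= opprD addrA -/(psum d c n) -IH.
  congr (_ - _); apply: eq_big_seq => la; rewrite mem_sorted_strict_parts => /eqP lad.
  by rewrite /c lad.
exists c; apply: functional_extensionality_dep => n; apply: mpsP => m.
rewrite (formal_sum_psum c (ltnSn (mdeg m))).
have [_ /(_ n m (ltnSn _))] := gP (mdeg m).+1; rewrite gsE mpsBE.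
exact: subr0_eq.
Qed.

Lemma basis_of_family : formal_basis b M.
Proof.
split=> [//||f Mf]; first exact: summable_b.
have [c cE] := formal_sum_exists Mf; exists c; split=> // c' c'E.
by apply: formal_sum_inj; rewrite -cE.
Qed.
End Basis.

(** * Membership in the two rings *)

Section Rings.
Variables (R : comNzRingType) (F : mps 2 R).
Hypothesis HF : is_fgl F.
Let HU := fgl_unitP HF.

Lemma psubst_lin n p (y : 'I_n -> mps p R) x (f g : mps n R) : nilf y ->
  psubst (f - mps_const n x * g) y = psubst f y - mps_const p x * psubst g y.
Proof. by move=> z; rewrite psubstB (psubstM z) (psubstC _ z). Qed.

Lemma Gamma_lin x f g : Gamma F f -> Gamma F g -> Gamma F (fun n => f n - mps_const n x * g n).
Proof.
move=> Gf Gg n; have [[fs fc] fl] := Gf n; have [[gs gc] gl] := Gg n; split; last first.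
  rewrite -fl -gl /set_last0; apply: psubst_lin => i.
  by case: unliftP => [j _|_]; [apply: ord_psX|apply: ord_ge_zero].
split=> [w|i j i0 j1].
  by rewrite /psperm (psubst_lin _ _ _ (nilf_perm R w)) -!/(psperm w _) fs gs.
rewrite !psubst_lin ?(fc _ _ i0 j1) ?(gc _ _ i0 j1) // => k.
  by case: ifP => _; [apply: ord_ge_zero|apply: ord_psX].
case: ifP => _; first exact: ord_psX.
by case: ifP => _; [apply: (ord_fopp HF)|]; apply: ord_psX.
Qed.

Lemma Gamma_plus_sub f : Gamma_plus F f -> Gamma F f.
Proof. by move=> h n; have [[]] := h n. Qed.

Lemma Gamma_plus_lin x f g : Gamma_plus F f -> Gamma_plus F g ->
  Gamma_plus F (fun n => f n - mps_const n x * g n).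
Proof.
move=> Gf Gg n; have [h hl] := Gamma_lin x (Gamma_plus_sub Gf) (Gamma_plus_sub Gg) n.
split=> //; split=> // i i0.
have [[_ /(_ i i0)[a aE]] _] := Gf n; have [[_ /(_ i i0)[b bE]] _] := Gg n.
have z := nilf_zvar R i; exists (a - mps_const n x * b).
rewrite (psubst_lin x (f n) (g n) z) mulrBr mulrCA -aE -bE /zvar; ring.
Qed.

(** The definition speaks of the first variable; symmetry carries it to the others. *)
Lemma Gamma_plus_all n f (i : 'I_n) : Gamma_plus F f ->
  exists g, f n - zsub i (f n) = dbl F i * g.
Proof.
case: n i => [[]//|n] i Gf; have [[[fs _] /(_ ord0 erefl)[g gE]] _] := Gf n.+1.
have z := nilf_perm R (tperm ord0 i).
exists (psperm (tperm ord0 i) g).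
have := congr1 (psperm (tperm ord0 i)) gE; rewrite -/(zsub ord0 (f n.+1)).
rewrite [psperm _ (_ - _)]psubstB -!/(psperm _ _) fs [psperm _ (_ * _)](psubstM z).
rewrite (fgl_add_subst F (ord_psX _ _) (ord_psX _ _) z) (psubstX _ z) tpermL.
move=> <-; congr (_ - _).
apply: mpsP => m; rewrite psperm_coef !zsub_coef mnmE tpermL.
by case: (m i == 0%N) => //; rewrite -psperm_coef fs.
Qed.

Hypothesis tf : forall (a : R) k, a *+ k.+1 = 0 -> a = 0.
Variable th : nat -> mps 1 R.
Hypothesis th1 : forall k, (0 < k)%N -> ord_ge 1 (th k).

(** Common form of [PL] and [QL], with th_k = x^k or th_k = [2](x) x^(k-1). *)
Definition HLth (la : strict_part) n : mps n R :=
  let r := size (val la) in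
  if (r <= n)%N then
    HL_sym F r (\prod_(i < n | (i < r)%N) ap (th (nth 0%N (val la) i)) (psX R i))
  else 0.

Let t (la : strict_part) (i : 'I_(size (val la))) := th (nth 0%N (val la) i).
Let t1 la i : ord_ge 1 (t (la := la) i).
Proof. by apply: th1; apply: strict_part_gt0. Qed.

Lemma is_HL_HLth la n : is_HL F (t (la := la)) (HLth la n).
Proof.
rewrite /HLth; case: leqP => [rn|nr]; last first.
  by move=> V e _; rewrite mul0r big_pred0 // => phi; apply: injp_small.
have [f fB] := is_HL_exists HF tf (t (la := la)) rn.
rewrite (HL_sym_is_HL HF tf (rn := rn) _ fB) // => w.
have z := nilf_perm R w; rewrite /psperm (psubst_prod z) (big_ord_narrow rn).
apply: eq_bigr => i _; rewrite (psubst_ap _ (ord_psX _ _) z).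
by rewrite (psubstX _ z).
Qed.

Lemma Gamma_HLth la : Gamma F (HLth la).
Proof.
move=> n; have B := @is_HL_HLth la; split; last exact: (is_HL_stab HF (t1 (la := la)) (B n.+1) (B n)).
by split; [apply: (is_HL_sym HF (B n))|apply: (is_HL_cancel HF tf (B n))].
Qed.

Lemma Gamma_plus_HLth la :
    (forall k, exists s, th k = dbl F ord0 * s) ->
  Gamma_plus F (HLth la).
Proof.
move=> hth n; have [h hl] := Gamma_HLth la n; split=> //; split=> // i _.
by apply: (is_HL_plus HF tf (t1 (la := la)) i (@is_HL_HLth la n)) => k; apply: hth.
Qed.
End Rings.

Theorem corollary4p21 (L : comNzRingType) (F : mps 2 L) (HL : is_lazard F) :
  formal_basis (PL F) (Gamma F) /\ formal_basis (QL F) (Gamma_plus F).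
Proof.
have HF := HL.1; have HU := fgl_unitP HF.
have tf (a : L) k : a *+ k.+1 = 0 -> a = 0 := @FreeRing.lazard_torsion_free L F HL a k.
have X1 : ord_ge 1 (psX L (ord0 : 'I_1)) by apply: ord_psX.
pose D := dbl F (ord0 : 'I_1); have oD : ord_ge 1 D := ord_dbl HF _.
(* The factors for P and Q have lowest forms x^k and 2 x^k, whence kap = 1 and kap = 2. *)
pose thP k : mps 1 L := psX L ord0 ^+ k.
pose thQ k : mps 1 L := D * psX L ord0 ^+ k.-1.
have oP k : (0 < k)%N -> ord_ge k (thP k).
  by move=> _; apply: ord_geX.
have oQ k : (0 < k)%N -> ord_ge k (thQ k).
  case: k => // k _; rewrite -(add1n k); apply: ord_geM => //.
  by apply: ord_geX.
have lP k : (0 < k)%N -> low k (thP k) = 1 *: 'X_ord0 ^+ k.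
  by move=> _; rewrite scale1r -low_psX -lowX.
have lQ k : (0 < k)%N -> low k (thQ k) = (1 *+ 2) *: 'X_ord0 ^+ k.
  case: k => // k _; rewrite -(add1n k).
  rewrite (lowM oD (@ord_geX _ _ _ k X1)) lowX // low_psX (low_dbl HF) -scalerAl.
  by rewrite -exprS.
have eP la n : PL F la n = HLth F thP la n.
  rewrite /PL /HLth; case: (_ <= _)%N; last exact: (erefl 0).
  congr (HL_sym F _ _); apply: eq_bigr => i _.
  have z : nilf (fun _ : 'I_1 => psX L i) by move=> _; apply: ord_psX.
  by rewrite /ap /thP (psubstXn z) (psubstX _ z).
have eQ la n : QL F la n = HLth F thQ la n.
  rewrite /QL /HLth; case: (_ <= _)%N; last exact: (erefl 0).
  congr (HL_sym F _ _); apply: eq_bigr => i _.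
  have z : nilf (fun _ : 'I_1 => psX L i) by move=> _; apply: ord_psX.
  rewrite /ap /thQ (psubstM z) (psubstXn z) (psubstX _ z).
  by rewrite /D /dbl (fgl_add_subst F X1 X1 z) (psubstX _ z).
have P1 k : (0 < k)%N -> ord_ge 1 (thP k) by move=> k0; apply: ord_geW (oP k k0).
have Q1 k : (0 < k)%N -> ord_ge 1 (thQ k) by move=> k0; apply: ord_geW (oQ k k0).
have r2 : GRing.lreg (1 *+ 2 : L).
  by apply: mulrI0_lreg => a; rewrite mulr_natl => /tf.
have {}eP : PL F = HLth F thP.
  by apply/funext => la; apply: functional_extensionality_dep => n; apply: eP.
have {}eQ : QL F = HLth F thQ.
  by apply/funext => la; apply: functional_extensionality_dep => n; apply: eQ.
rewrite eP eQ; split.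
  refine (basis_of_family HF (@lreg1 L) oP lP (@is_HL_HLth L F HF tf thP) _ _ _ _).
  - by [].
  - exact: (Gamma_HLth HF tf P1).
  - exact: (Gamma_lin HF).
  move=> d f la _ _ _; exists (f (size (val la)) (mon_of _ (val la))).
  by rewrite expr1n mul1r.
refine (basis_of_family HF r2 oQ lQ (@is_HL_HLth L F HF tf thQ) _ _ _ _).
- exact: Gamma_plus_sub.
- move=> la; apply: (Gamma_plus_HLth HF tf Q1 la) => k.
  by exists (psX L ord0 ^+ k.-1).
- exact: (Gamma_plus_lin HF).
(* The coefficient of x^la is divisible by 2^r because all r exponents are positive in r variables;
   a_{1,1} being regular modulo 2 is used here. *)
move=> d f la Gf o lad; apply: (pow2_divides HF tf (FreeRing.lazard_a11_regular HL) _ (o _)).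
- by move=> i; exact: (@Gamma_plus_all L F _ f i Gf).
- by rewrite mdeg_mon_of.
by move=> i; rewrite mnmE -lt0n; apply: strict_part_gt0.
Qed.
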